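(* Let $\Omega\subset\mathbb R^n$, $n\in\{2,3\}$, be a bounded convex domain with a Lipschitz continuous boundary and assume that the spaces $V^h=S^1_d(\mathcal T)$ have the optimal approximation property and satisfy the inverse estimates stated in the context. Assume that the discrete problem: find $u_h\in V^h$, $u_h=g_h$ on $\partial\Omega$, with $\langle F_h(u_h),\psi_h\rangle=\int_\Omega f\psi_h\,dx$ for all $\psi_h\in V_0^h$, has a unique strictly convex solution $u_h$. Then, for $h$ sufficiently small and for $u_0\in V^h$ with $u_0=g_h$ on $\partial\Omega$ sufficiently close to $u_h$, Newton's method, i.e. the sequence $u_{k+1}\in V^h$, $u_{k+1}=g_h$ on $\partial\Omega$, $$\langle F_h'(u_k)(u_{k+1}-u_k),\psi_h\rangle=-\langle F_h(u_k)-f,\psi_h\rangle\quad\forall\psi_h\in V_0^h,$$ is well defined and converges to $u_h$ with a quadratic convergence rate: there is a constant $C(h)>0$ such that $\|u_{k+1}-u_h\|_1\le C(h)\|u_k-u_h\|_1^2$ for all $k\ge0$.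
   Context: $\mathcal T=\mathcal T_h$ is a family of shape-regular, quasi-uniform triangulations of $\Omega$ into simplices with maximal diameter $h$; $S_d^1(\mathcal T)=\{s\in C^1(\Omega): s|_K\in\mathcal P_d\ \forall K\in\mathcal T\}$, with $\mathcal P_d$ the polynomials of degree at most $d$; $V_0^h=V^h\cap H_0^1(\Omega)$. $\|\cdot\|_{k,p}$, $|\cdot|_{k,p}$ are the norm and seminorm of $W^{k,p}(\Omega)$, and $\|\cdot\|_k,|\cdot|_k$ those of $H^k(\Omega)$. Optimal approximation property: there are a linear quasi-interpolation operator $Q_h:L^1(\Omega)\to V^h$ and a constant $C$ independent of $h$ with $\|v-Q_hv\|_{k,p}\le Ch^{l+1-k}|v|_{l+1,p}$ for $v\in W^{l+1,p}(\Omega)$, $1\le p\le\infty$, $0\le k\le l\le d$. Inverse estimates: $\|v\|_{s,p}\le Ch^{l-s+\min(0,n/p-n/q)}\|v\|_{l,q}$ for all $v\in V^h$, $0\le l\le s$, $1\le p,q\le\infty$, norms being understood element by element when necessary. $f\in C(\Omega)$, $f>0$, is such that $\langle f,\psi_h\rangle=\int_\Omega f\psi_h\,dx$ defines an element of the dual $(V_0^h)'$; $g\in C(\partial\Omega)$ and $g_h$ is the interpolant in $V^h$ of a smooth extension of $g$. The map $F_h:V^h\to(V_0^h)'$ is $\langle F_h(v_h),\psi_h\rangle=\int_\Omega(\det D^2v_h)\psi_h\,dx$, and its Fréchet derivative is $\langle F_h'(v_h)(p),\psi_h\rangle=-\int_\Omega[(\operatorname{cof}D^2v_h)Dp]\cdot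 D\psi_h\,dx$ for $p,\psi_h\in V_0^h$. Here $\operatorname{cof}A$ is the matrix of cofactors of $A$. *)

(* Defs.v *)
From HB Require Import structures.
From mathcomp Require Import all_boot all_order all_algebra.
From mathcomp Require Import all_classical all_reals all_analysis.
Set Implicit Arguments. Unset Strict Implicit. Unset Printing Implicit Defensive.
Import Order.TTheory GRing.Theory Num.Theory.
Import numFieldNormedType.Exports.
Local Open Scope classical_set_scope.
Local Open Scope ring_scope.

(* Product sigma-algebra of the Borel sets of R; it coincides with the Borel
   sets of ['rV[R]_n]. *)
Section measurable_rV.
Variables (R : realType) (n : nat).

Let coors : 'I_n -> 'rV[R]_n -> measurableTypeR R := fun i x => x ord0 i.

Let rV_set0 : g_sigma_preimage coors set0.
Proof. exact: sigma_algebra0. Qed.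

Let rV_setC A : g_sigma_preimage coors A -> g_sigma_preimage coors (~` A).
Proof. exact: sigma_algebraC. Qed.

Let rV_bigcup (F : _^nat) : (forall i, g_sigma_preimage coors (F i)) ->
  g_sigma_preimage coors (\bigcup_i (F i)).
Proof. exact: sigma_algebra_bigcup. Qed.

HB.instance Definition _ := @isMeasurable.Build default_measure_display
  'rV[R]_n (g_sigma_preimage coors) rV_set0 rV_setC rV_bigcup.

Lemma measurable_coor (i : 'I_n) :
  measurable_fun [set: 'rV[R]_n] (fun x => x ord0 i : measurableTypeR R).
Proof.
move=> _ Y mY; rewrite setTI; apply: sub_sigma_algebra => /=.
rewrite -bigcup_seq/=; exists i => /=; first by rewrite mem_index_enum.
by exists Y => //; rewrite setTI.
Qed.

Lemma measurable_fun_rV d (T : measurableType d) (f : T -> 'rV[R]_n) :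
  (forall i, measurable_fun [set: T] (fun t => f t ord0 i : measurableTypeR R)) ->
  measurable_fun [set: T] f.
Proof.
move=> mf _ Y mY; rewrite setTI.
have sub : sigma_algebra [set: 'rV[R]_n] [set A | measurable (f @^-1` A)].
  split => /=; first by rewrite preimage_set0.
  - by move=> A mA; rewrite setTD preimage_setC; exact: measurableC.
  - by move=> F mF; rewrite preimage_bigcup; exact: bigcup_measurable.
have := @smallest_sub _ _ _ _ sub _ Y mY; apply => A /=.
rewrite -bigcup_seq => -[i _ [B mB <-]].
rewrite setTI -comp_preimage -[X in measurable X]setTI.
exact: mf.
Qed.
End measurable_rV.

Section lebesgue_rV.
Variable R : realType.

(* The Lebesgue measure of R^(n+1) is the image of the product of those of R
   and R^n under (x, v) |-> (x, v_0, ..., v_(n-1)). *)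
Definition rV_cons n (p : measurableTypeR R * 'rV[R]_n) : 'rV[R]_n.+1 :=
  row_mx (p.1)%:M p.2.

Definition rV_uncons n (v : 'rV[R]_n.+1) : measurableTypeR R * 'rV[R]_n :=
  (v ord0 ord0, \row_i v ord0 (lift ord0 i)).

Lemma rV_cons_ord0 n p : @rV_cons n p ord0 ord0 = p.1.
Proof.
transitivity (rV_cons p ord0 (@lshift 1 n ord0)).
  by congr fun_of_matrix; apply/val_inj.
by rewrite /rV_cons (@row_mxEl _ 1 1 n) mxE eqxx mulr1n.
Qed.

Lemma rV_cons_lift n p i : @rV_cons n p ord0 (lift ord0 i) = p.2 ord0 i.
Proof.
transitivity (rV_cons p ord0 (@rshift 1 n i)).
  by congr fun_of_matrix; apply/val_inj.
by rewrite /rV_cons (@row_mxEr _ 1 1 n).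
Qed.

Lemma rV_consK n : cancel (@rV_cons n) (@rV_uncons n).
Proof.
move=> [x v]; rewrite /rV_uncons rV_cons_ord0; congr pair.
by apply/rowP => i; rewrite mxE rV_cons_lift.
Qed.

Lemma measurable_rV_cons n : measurable_fun [set: _] (@rV_cons n).
Proof.
apply: measurable_fun_rV => i.
case: (unliftP ord0 i) => [j ->|->].
  under eq_fun do rewrite rV_cons_lift.
  exact: (measurableT_comp (measurable_coor j) measurable_snd).
under eq_fun do rewrite rV_cons_ord0.
exact: measurable_fst.
Qed.

Lemma measurable_rV_uncons n : measurable_fun [set: _] (@rV_uncons n).
Proof.
apply/measurable_fun_pairP; split; first exact: measurable_coor.
apply: measurable_fun_rV => i /=.
rewrite /comp /=.
under eq_fun do rewrite mxE.
exact: measurable_coor.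
Qed.

Section step.
Variables (n : nat) (mu : {sigma_finite_measure set 'rV[R]_n -> \bar R}).

Definition lebesgue_rV_step : set 'rV[R]_n.+1 -> \bar R :=
  pushforward (@lebesgue_measure R \x mu)%E (@rV_cons n).

Let step0 : lebesgue_rV_step set0 = 0%E.
Proof.
rewrite /lebesgue_rV_step /pushforward preimage_set0.
exact: measure0.
Qed.

Let step_ge0 A : (0 <= lebesgue_rV_step A)%E.
Proof. by rewrite /lebesgue_rV_step /pushforward measure_ge0. Qed.

Let mpre A : measurable A -> measurable (@rV_cons n @^-1` A).
Proof.
move=> mA; rewrite -[X in measurable X]setTI.
exact: measurable_rV_cons.
Qed.

Let step_sigma_additive : semi_sigma_additive lebesgue_rV_step.
Proof.
move=> F mF tF mUF; rewrite /lebesgue_rV_step /pushforward preimage_bigcup.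
apply: measure_semi_sigma_additive.
- by move=> k; exact: mpre.
- apply/trivIsetP => /= i j _ _ ij; rewrite -preimage_setI.
  by move/trivIsetP : tF => /(_ _ _ _ _ ij) ->//; rewrite preimage_set0.
- by rewrite -preimage_bigcup; exact: mpre.
Qed.

HB.instance Definition _ := isMeasure.Build _ _ _ lebesgue_rV_step
  step0 step_ge0 step_sigma_additive.

Let step_sigma_finite : sigma_finite setT lebesgue_rV_step.
Proof.
have /sigma_finiteP[F [TF ndF Foo]] := sigma_finiteT (@lebesgue_measure R).
have /sigma_finiteP[G [TG ndG Goo]] := sigma_finiteT mu.
exists (fun k => @rV_uncons n @^-1` (F k `*` G k)).
  rewrite -preimage_bigcup (_ : \bigcup_k (F k `*` G k) = setT).
    by rewrite preimage_setT.
  rewrite -setXTT TF TG predeqE => -[x y]; split.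
    by move=> [k _ []/= ? ?]; split; exists k.
  move=> [/= [k _ Fkx] [l _ Gly]]; exists (maxn k l) => //; split.
    by move: x Fkx; exact/subsetPset/ndF/leq_maxl.
  by move: y Gly; exact/subsetPset/ndG/leq_maxr.
move=> k; have [mFk Fk] := Foo k; have [mGk Gk] := Goo k; split.
  rewrite -[X in measurable X]setTI.
  by apply: measurable_rV_uncons => //; exact: measurableX.
rewrite /lebesgue_rV_step /pushforward -comp_preimage.
rewrite (_ : @rV_uncons n \o @rV_cons n = id).
  by rewrite preimage_id product_measure1E// lte_mul_pinfty// ge0_fin_numE.
by apply/funext => p /=; rewrite rV_consK.
Qed.

HB.instance Definition _ := Measure_isSigmaFinite.Build _ _ _ lebesgue_rV_step
  step_sigma_finite.
End step.

Fixpoint lebesgue_rV n : {sigma_finite_measure set 'rV[R]_n -> \bar R} :=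
  match n with
  | 0 => \d_(0 : 'rV[R]_0)
  | n'.+1 => lebesgue_rV_step (lebesgue_rV n')
  end.
End lebesgue_rV.

Section calculus.
Variables (R : realType) (n : nat).
Implicit Types (f p : 'rV[R]_n -> R) (x e : 'rV[R]_n) (U : set 'rV[R]_n).

(* [pder [:: i1; ...; im] f] is d_i1 (... (d_im f)). *)
Definition pder (s : seq 'I_n) f : 'rV[R]_n -> R :=
  foldr (fun i g => 'D_(delta_mx 0 i) g) f s.

Definition dirder (s : seq 'rV[R]_n) f : 'rV[R]_n -> R :=
  foldr (fun e g => 'D_e g) f s.

(* Only for U open: the derivatives are not relative to U. *)
Definition Ck (k : nat) U f := forall s : seq 'I_n, (size s <= k)%N ->
  forall x, U x -> {for x, continuous (pder s f)} /\
    ((size s < k)%N -> forall i, derivable (pder s f) x (delta_mx 0 i)).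

Definition smooth U f := forall k, Ck k U f.

Definition test_function U f := smooth setT f /\
  exists K, [/\ compact K, K `<=` U & forall x, ~ K x -> f x = 0].

Definition gradient p x : 'cV[R]_n := \col_i pder [:: i] p x.

Definition hessian p x : 'M[R]_n := \matrix_(i, j) pder [:: i; j] p x.

Definition cof (A : 'M[R]_n) : 'M[R]_n := \matrix_(i, j) cofactor A i j.

(* Multi-indices with entries at most k; those of length at most k are the
   [a] with [mdeg a <= k]. *)
Definition mindex (k : nat) := {ffun 'I_n -> 'I_k.+1}.

Definition mdeg k (a : mindex k) : nat := (\sum_i a i)%N.

Definition mder k (a : mindex k) : seq 'I_n :=
  flatten [seq nseq (a i) i | i <- enum 'I_n].

Definition is_poly (d : nat) p := exists c : mindex d -> R, forall x,
  p x = \sum_(a : mindex d | (mdeg a <= d)%N) c a * \prod_i x ord0 i ^+ a i.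

End calculus.

Section geometry.
Variables (R : realType) (n : nat).
Implicit Types (x y e : 'rV[R]_n) (A Omega : set 'rV[R]_n) (u : 'rV[R]_n -> R).

Definition dot x y : R := \sum_i x ord0 i * y ord0 i.

(* The norm of the library on matrices is the max norm. *)
Definition enorm x : R := Num.sqrt (dot x x).

Definition boundary Omega := closure Omega `\` Omega.

Definition diameter A : R := sup [set enorm (x - y) | x in A & y in A].

(* Diameter of the largest ball inscribed in A. *)
Definition indiameter A : R :=
  sup [set 2 * r | r in [set r : R | exists c, forall x, enorm (x - c) < r -> A x]].

(* Near each boundary point, in the coordinates given by a unit vector e and
   its orthogonal complement, Omega is the region above the graph of a
   Lipschitz function. *)
Definition lipschitz_boundary Omega := forall z, boundary Omega z ->
  exists (e : 'rV[R]_n) (gamma : 'rV[R]_n -> R) (r : R),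
    [/\ enorm e = 1, lipschitz gamma, 0 < r &
        forall x, enorm (x - z) < r ->
          (Omega x <-> gamma (x - dot x e *: e) < dot x e)].

Definition strictly_convex Omega u := forall x y t, Omega x -> Omega y ->
  x <> y -> 0 < t < 1 ->
  u (t *: x + (1 - t) *: y) < t * u x + (1 - t) * u y.

End geometry.

Section sobolev.
Variables (R : realType) (n : nat).
Implicit Types (u v w phi : 'rV[R]_n -> R) (U : set 'rV[R]_n) (p : \bar R).

Local Notation mu := (lebesgue_rV R n).

(* L^p(U) norm, 1 <= p <= +oo *)
Definition Lpnorm p U v : \bar R := 'N[mu]_p[EFin \o (v \_ U)]%E.

Definition locally_integrable_on U v := measurable_fun U v /\
  forall K, compact K -> K `<=` U -> (\int[mu]_(x in K) `|v x|%:E < +oo)%E.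

(* w is the weak derivative D^a v in U. *)
Definition weak_der U k (a : mindex n k) v w :=
  [/\ locally_integrable_on U v, locally_integrable_on U w &
    forall phi, test_function U phi ->
      \int[mu]_(x in U) (v x * pder (mder a) phi x) =
      (-1) ^+ mdeg a * \int[mu]_(x in U) (w x * phi x)].

(* A representative of D^a v; only meaningful when the weak derivative
   exists. *)
Definition wder U k (a : mindex n k) v : 'rV[R]_n -> R :=
  xget (cst 0) [set w | weak_der U a v w].

Definition sobolev k p U v := forall a : mindex n k, (mdeg a <= k)%N ->
  exists w, weak_der U a v w /\ (Lpnorm p U w < +oo)%E.

(* l^p norm of a finite family, 1 <= p <= +oo *)
Definition lpsum p (I : finType) (P : pred I) (c : I -> \bar R) : \bar R :=
  (match p with
   | r%:E => (\sum_(i | P i) c i `^ r) `^ r^-1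
   | _ => \big[maxe/0]_(i | P i) c i
   end)%E.

(* The norm and the seminorm of W^{k,p}(U), for v \in W^{k,p}(U). *)
Definition Wnorm k p U v : \bar R :=
  lpsum p (fun a : mindex n k => (mdeg a <= k)%N)
    (fun a => Lpnorm p U (wder U a v)).

Definition Wseminorm k p U v : \bar R :=
  lpsum p (fun a : mindex n k => (mdeg a == k)%N)
    (fun a => Lpnorm p U (wder U a v)).

Definition H10 U v := sobolev 1 2%:E U v /\
  forall eps : R, 0 < eps ->
    exists phi, test_function U phi /\ (Wnorm 1 2%:E U (v \- phi)%R < eps%:E)%E.

End sobolev.

(* [verts T i] has the n+1 vertices of the i-th element as rows. *)
Record mesh (R : realType) (n : nat) := Mesh {
  nelem : nat;
  verts : 'I_nelem -> 'M[R]_(n.+1, n) }.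
Arguments verts {R n} m i.

Section splines.
Variables (R : realType) (n : nat).
Implicit Types (T : mesh R n) (Omega : set 'rV[R]_n) (u v s : 'rV[R]_n -> R).

(* Convex hull of the rows of A selected by P. *)
Definition hull (A : 'M[R]_(n.+1, n)) (P : set 'I_n.+1) : set 'rV[R]_n :=
  [set x | exists lam : 'rV[R]_n.+1,
     [/\ forall a, 0 <= lam ord0 a, \sum_a lam ord0 a = 1,
         forall a, ~ P a -> lam ord0 a = 0 & x = lam *m A]].

Definition elem T (i : 'I_(nelem T)) : set 'rV[R]_n := hull (verts T i) setT.
#[local] Arguments elem T i : clear implicits.

Definition triangulation Omega T :=
  [/\ (* the vertices of an element are affinely independent *)
      forall i, row_free (row_mx (const_mx 1 : 'cV[R]_n.+1) (verts T i)),
      closure Omega = \bigcup_i elem T i,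
      forall i j, i != j -> (elem T i)° `&` (elem T j)° = set0 &
      (* two elements meet in the face spanned by their common vertices *)
      forall i j, elem T i `&` elem T j =
        hull (verts T i)
          [set a | exists b, row a (verts T i) = row b (verts T j)]].

(* The meshes T h, h \in H, are shape-regular and quasi-uniform triangulations
   of Omega, h being the maximal diameter of the elements of T h. *)
Definition mesh_family Omega (H : set R) (T : R -> mesh R n) :=
  [/\ forall h, H h -> triangulation Omega (T h),
      forall h, H h -> 0 < h /\ (exists i, diameter (elem (T h) i) = h) /\
        forall i, diameter (elem (T h) i) <= h,
      exists2 sigma : R, 0 < sigma & forall h, H h -> forall i,
        diameter (elem (T h) i) <= sigma * indiameter (elem (T h) i) &
      exists2 c : R, 0 < c & forall h, H h -> forall i,
        c * h <= diameter (elem (T h) i)].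

(* V^h = S^1_d(T); only the values on the closure of Omega matter, those on
   the boundary being the continuous extension of the values inside. *)
Definition spline Omega T (d : nat) s := Ck 1 Omega s /\
  forall i, exists2 p, is_poly d p & forall x, elem T i x -> s x = p x.

Definition spline0 Omega T d s := spline Omega T d s /\ H10 Omega s.

(* W^{k,p} norm understood element by element; it agrees with the W^{k,p}(Omega)
   norm on W^{k,p}(Omega). *)
Definition brokenWnorm T k (p : \bar R) v : \bar R :=
  lpsum p (fun=> true) (fun i => Wnorm k p (elem T i)° v).

Definition L1 Omega v := (lebesgue_rV R n).-integrable Omega (EFin \o v).

Definition quasi_interpolation Omega T d
    (Q : ('rV[R]_n -> R) -> 'rV[R]_n -> R) :=
  [/\ forall v, L1 Omega v -> spline Omega T d (Q v),
      forall u v, L1 Omega u -> L1 Omega v ->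
        {ae lebesgue_rV R n, forall x, Omega x -> u x = v x} ->
        {in Omega, Q u =1 Q v} &
      forall (a : R) u v, L1 Omega u -> L1 Omega v ->
        {in Omega, Q (fun x => a * u x + v x) =1
                   (fun x => a * Q u x + Q v x)}].

Definition approximation_property Omega (H : set R) (T : R -> mesh R n) d :=
  exists Q : R -> ('rV[R]_n -> R) -> 'rV[R]_n -> R,
    (forall h, H h -> quasi_interpolation Omega (T h) d (Q h)) /\
    forall (p : \bar R) (k l : nat), (1 <= p)%E -> (k <= l <= d)%N ->
      exists C : R, forall h v, H h -> sobolev l.+1 p Omega v ->
        (brokenWnorm (T h) k p (v \- Q h v)%R <=
         (C * h ^+ (l.+1 - k))%:E * Wseminorm l.+1 p Omega v)%E.

(* n / p, which is 0 for p = +oo *)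
Definition ndiv (p : \bar R) : R := n%:R * fine (p^-1)%E.

Definition inverse_estimates Omega (H : set R) (T : R -> mesh R n) d :=
  forall (l s : nat) (p q : \bar R), (l <= s)%N -> (1 <= p)%E -> (1 <= q)%E ->
    exists C : R, forall h v, H h -> spline Omega (T h) d v ->
      (brokenWnorm (T h) s p v <=
       (C * h `^ (l%:R - s%:R + Num.min 0 (ndiv p - ndiv q)))%:E *
       brokenWnorm (T h) l q v)%E.

(* Nodal functionals: (i, x, s) is the iterated derivative along the vectors of
   s, at the point x of the i-th element, of the restriction to this element.
   This covers Lagrange and Hermite interpolation. *)
Definition node T := ('I_(nelem T) * 'rV[R]_n * seq 'rV[R]_n)%type.

Definition interpolates T d (N : seq (node T)) G s :=
  forall i x es, (i, x, es) \in N ->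
    forall p, is_poly d p -> (forall y, elem T i y -> s y = p y) ->
      dirder es p x = dirder es G x.

Definition interpolant Omega T d (N : seq (node T)) G s :=
  spline Omega T d s /\ interpolates d N G s.

Definition unisolvent Omega T d (N : seq (node T)) :=
  (forall i x es, (i, x, es) \in N -> elem T i x) /\
  forall G, smooth setT G -> (exists s, interpolant Omega d N G s) /\
    forall s s', interpolant Omega d N G s -> interpolant Omega d N G s' ->
      {in Omega, s =1 s'}.

End splines.
Arguments elem {R n} T i.

Section newton.
Variables (R : realType) (n : nat).
Variables (Omega : set 'rV[R]_n) (T : mesh R n) (d : nat).
Implicit Types (u v p psi f g : 'rV[R]_n -> R).

Local Notation mu := (lebesgue_rV R n).

(* Omega without the null set of element boundaries, where second derivatives
   of splines need not exist. *)
Definition elem_interiors : set 'rV[R]_n := \bigcup_i (elem T i)°.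

Definition load f psi : R := \int[mu]_(x in Omega) (f x * psi x).

Definition MA v psi : R :=
  \int[mu]_(x in elem_interiors) (\det (hessian v x) * psi x).

Definition MA' v p psi : R :=
  - \int[mu]_(x in elem_interiors)
      (((cof (hessian v x) *m gradient p x)^T *m gradient psi x) ord0 ord0).

Definition discrete_solution f g u :=
  [/\ spline Omega T d u, {in boundary Omega, u =1 g} &
      forall psi, spline0 Omega T d psi -> MA u psi = load f psi].

Definition newton_step f g u u' :=
  [/\ spline Omega T d u', {in boundary Omega, u' =1 g} &
      forall psi, spline0 Omega T d psi ->
        MA' u (u' \- u) psi = - (MA u psi - load f psi)].

End newton.

(* Main.v *)
Require Import Defs.
From HB Require Import structures.
From mathcomp Require Import all_boot all_order all_algebra.
From mathcomp Require Import all_classical all_reals all_analysis.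
From mathcomp Require Import perm measurable_realfun ring lra.
Set Implicit Arguments. Unset Strict Implicit. Unset Printing Implicit Defensive.
Import Order.TTheory GRing.Theory Num.Theory.
Import numFieldNormedType.Exports.
Local Open Scope classical_set_scope.
Local Open Scope ring_scope.

(* On each element u_h is a polynomial, and by strict convexity its Hessian is
   positive definite on a dense subset of Omega: subtracting a small paraboloid
   from u_h minus a tangent plane leaves an interior minimum. Hence the cofactor
   matrix is positive semidefinite on the elements and positive definite on a
   dense set, so that -<F_h'(u_h)(p), p> > 0 for p <> 0 in the finite-dimensional
   space V_0^h, and F_h'(v) is coercive for v near u_h.

   The rows of cof D^2 v are divergence free; for a C^1 piecewise polynomial v
   this holds in the weak sense, by mollification, and gives
   <F_h'(v)(p), psi> = \int (cof D^2 v : D^2 p) psi. The Newton equation at u_k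
   thus reads <F_h'(u_k)(u_{k+1} - u_h), psi> =
   \int (det D^2 u_h - det D^2 u_k - cof D^2 u_k : D^2 (u_h - u_k)) psi, whose
   right-hand side is quadratic in u_k - u_h. Since V_0^h consists of the splines
   that vanish on the boundary and all its norms are equivalent, the estimate
   holds in the norm of H^1, and no smallness of h is required. *)

(** * Lebesgue measure and integrals on R^n *)

(** The obstacle is that the Hessian of a $C^1$ spline jumps across the faces. Coercivity needs the
    divergence form of [MA'], in which the energy is visible; the quadratic estimate needs the form
    with $D^2p$, in which the remainder of the determinant is bounded pointwise. The passage between
    the two is made for a mollified v, whose Hessian is an average of that of v and so obeys the
    same bound, and the limit is taken by dominated convergence. No jump terms and no traces are
    computed: integration by parts for Lipschitz functions is read off from the translation
    invariance of the integral, and members of $H^1_0$ are recognised by their extension by 0,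
    convexity of Omega supplying the dilations for the converse. Symmetry of second derivatives,
    needed for the divergence-free rows, is proved by induction on an algebra of explicit functions
    that contains polynomials and bump functions; mollified splines inherit it from the kernel. All
    estimates are made in coordinates with respect to a basis of $V_0^h$, so that the constants
    depend on the mesh, as C(h) may. *)

Section row_norm.
Variables (R : realType) (n : nat).
Implicit Types (x y : 'rV[R]_n).

Lemma rV_norm_ltP x r : 0 < r -> `|x| < r <-> forall i, `|x ord0 i| < r.
Proof.
move=> r0; split.
  by rewrite {1}/Num.norm /= mx_normrE => /bigmax_ltP[_ /= h] i; exact: (h (ord0, i)).
move=> h; rewrite {1}/Num.norm /= mx_normrE; apply/bigmax_ltP; split => // -[i j] _ /=.
by rewrite ord1.
Qed.

Lemma rV_norm_leP x r : 0 <= r -> `|x| <= r <-> forall i, `|x ord0 i| <= r.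
Proof.
move=> r0; split.
  by rewrite {1}/Num.norm /= mx_normrE => /bigmax_leP[_ /= h] i; exact: (h (ord0, i)).
move=> h; rewrite {1}/Num.norm /= mx_normrE; apply/bigmax_leP; split => // -[i j] _ /=.
by rewrite ord1.
Qed.

Lemma coord_norm_le x i : `|x ord0 i| <= `|x|.
Proof. exact: (rV_norm_leP x (normr_ge0 x)).1. Qed.

Lemma ball_rVE x r : ball x r = [set y | `|y - x| < r].
Proof. by rewrite -ball_normE; apply/seteqP; split=> y /=; rewrite distrC. Qed.

End row_norm.

Section rV_borel.
Variables (R : realType) (n : nat).
Implicit Types (x y : 'rV[R]_n) (U : set 'rV[R]_n).

(** For the max norm a ball is a product of intervals, hence a finite intersection of preimages
    under the coordinates, which generate the sigma-algebra. *)
Lemma measurable_ball_rV x r : measurable (ball x r).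
Proof.
have [r0|r0] := ltP 0 r; last by rewrite le0_ball0.
rewrite ball_rVE.
rewrite (_ : [set _ | _] = \bigcap_(i in [set: 'I_n])
  ((fun y : 'rV[R]_n => y ord0 i : measurableTypeR R) @^-1` (ball (x ord0 i) r))).
  apply: fin_bigcap_measurable => // i _.
  rewrite -[X in measurable X]setTI; apply: measurable_coor => //.
  by apply: open_measurable; exact: ball_open.
apply/seteqP; split=> y /=.
  move=> /(rV_norm_ltP _ r0) h i _ /=; rewrite -ball_normE /= distrC.
  by have := h i; rewrite !mxE.
move=> h; apply/(rV_norm_ltP _ r0) => i; have := h i I.
by rewrite -ball_normE /= distrC !mxE.
Qed.

Lemma rational_ball_cover U x : open U -> U x -> exists p : 'rV[rat]_n * nat,
  `|x - map_mx (@ratr R) p.1| < p.2.+1%:R^-1 /\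
  forall y, `|y - map_mx (@ratr R) p.1| <= p.2.+1%:R^-1 -> U y.
Proof.
move=> oU Ux; pose c (p : 'rV[rat]_n) : 'rV[R]_n := map_mx (@ratr R) p.
have [e e0 xeU] : exists2 e, 0 < e & ball x e `<=` U.
  by move: oU; rewrite openE => /(_ _ Ux)/nbhs_ballP[e /= e0 ?]; exists e.
(* The radius 1/(k+1) is below e/2, so that a closed ball of this radius whose centre is this close
   to x stays in [ball x e]. *)
pose k := Num.truncn (e / 2)^-1.
have k0 : (0 : R) < k.+1%:R^-1 by rewrite invr_gt0.
have ke : k.+1%:R^-1 < e / 2.
  rewrite invf_plt ?posrE ?divr_gt0// .
  by rewrite -addn1 natrD; apply: truncnS_gt.
have /choice[q qP] : forall i, exists q : rat, `|ratr q - x ord0 i| < k.+1%:R^-1.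
  move=> i; have /rat_in_itvoo[q] : x ord0 i < x ord0 i + k.+1%:R^-1.
    by rewrite ltrDl.
  rewrite in_itv /= => /andP[q1 q2].
  by exists q; rewrite ltr_distl q2 andbT ltrBlDr (lt_trans q1)// ltrDl.
have xq : `|x - c (\row_i q i)| < k.+1%:R^-1.
  by apply/rV_norm_ltP => // i; rewrite !mxE distrC.
exists (\row_i q i, k); split => //= y yq.
apply: xeU; rewrite ball_rVE /=.
rewrite (splitr e) -(subrKA (c (\row_i q i))) (le_lt_trans (ler_normD _ _))//.
rewrite ltrD// ?(le_lt_trans _ ke)//.
by rewrite distrC ltW.
Qed.

Lemma open_rV_measurable U : open U -> measurable U.
Proof.
move=> oU; pose c (p : 'rV[rat]_n) : 'rV[R]_n := map_mx (@ratr R) p.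
rewrite (_ : U = \bigcup_(p : 'rV[rat]_n * nat)
    (if `[< ball (c p.1) p.2.+1%:R^-1 `<=` U >] then ball (c p.1) p.2.+1%:R^-1
     else set0)).
  apply: countable_bigcupT_measurable; first exact: countableP.
  by move=> p; case: ifP => // _; exact: measurable_ball_rV.
apply/seteqP; split=> [x Ux|x [[q k] _ /=]]; last first.
  by case: ifP => // /asboolP; exact.
have [p [xp pU]] := rational_ball_cover oU Ux; exists p => //.
rewrite asboolT; first by rewrite ball_rVE.
by move=> y; rewrite ball_rVE /= => /ltW; exact: pU.
Qed.

Lemma closed_rV_measurable U : closed U -> measurable U.
Proof. by move/closed_openC/open_rV_measurable/measurableC; rewrite setCK. Qed.

Lemma continuous_coord (i : 'I_n) : continuous (fun x : 'rV[R]_n => x ord0 i).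
Proof. exact: coord_continuous. Qed.

Lemma continuous_on_open_measurable U (f : 'rV[R]_n -> R) : open U ->
  (forall x, U x -> {for x, continuous f}) -> measurable_fun U f.
Proof.
move=> oU cf mU; apply: (measurability _ (RGenOpens.measurableE R)).
move=> _ [_ [a [b ->] <-]]; apply: open_rV_measurable.
rewrite openE => x [Ux /= fx]; apply: filterI; first exact: open_nbhs_nbhs.
apply: (cf x Ux); apply: open_nbhs_nbhs; split => //.
exact: mU.
Qed.

Lemma continuous_rV_measurable (f : 'rV[R]_n -> R) : continuous f -> measurable_fun setT f.
Proof. move=> cf; have oT : open [set: 'rV[R]_n] by exact: openT.
exact: (@continuous_on_open_measurable _ f oT (fun x _ => cf x)). Qed.

Lemma measurable_addr_rV (a : 'rV[R]_n) : measurable_fun setT (fun x => x + a).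
Proof.
apply: measurable_fun_rV => i; under eq_fun do rewrite mxE.
by apply: measurable_funD => //; exact: measurable_coor.
Qed.

End rV_borel.

Section lebesgue_shift.
Variable R : realType.

Lemma lebesgue_measure_shift (a : R) (A : set R) : measurable A ->
  lebesgue_measure ((fun x => x + a) @^-1` A) = lebesgue_measure A.
Proof.
move=> mA.
have mf : measurable_fun setT (fun x : measurableTypeR R => (x + a) : measurableTypeR R).
  exact: measurable_funD.
transitivity (pushforward lebesgue_measure
  (fun x : measurableTypeR R => (x + a) : measurableTypeR R) A) => //.
apply/esym/lebesgue_measure_unique => //= _ [[b c]] _ <-.
rewrite /pushforward.
rewrite (_ : _ @^-1` _ = `](b - a), (c - a)]%classic); last first.
  by apply/seteqP; split => x /=; rewrite !in_itv/= ltrBlDr lerBrDr.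
by rewrite !lebesgue_measure_itv/= !lte_fin ltrD2r// -!EFinB opprB addrA subrK.
Qed.

Lemma rV_consD n (a : 'rV[R]_n.+1) x v :
  rV_cons (x, v) + a = rV_cons (x + (rV_uncons a).1, v + (rV_uncons a).2).
Proof.
apply/rowP => i; case: (unliftP ord0 i) => [j ->|->]; rewrite [LHS]mxE.
  by rewrite !rV_cons_lift /= !mxE.
by rewrite !rV_cons_ord0.
Qed.

(** The slices of a shifted set are shifts of slices: the induction hypothesis treats the tail of
    the vector and the one-dimensional case its head. *)
Lemma lebesgue_rV_shift n (a : 'rV[R]_n) (A : set 'rV[R]_n) : measurable A ->
  lebesgue_rV R n ((fun x => x + a) @^-1` A) = lebesgue_rV R n A.
Proof.
elim: n a A => [a A mA|n IH a A mA].
  congr (lebesgue_rV R 0 _); apply/seteqP; split => x /=.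
    by rewrite (_ : x + a = x)//; apply/rowP => -[].
  by rewrite (_ : x + a = x)//; apply/rowP => -[].
have mfa : measurable_fun setT (fun x : measurableTypeR R =>
  (x + (rV_uncons a).1) : measurableTypeR R) by exact: measurable_funD.
have mcA : measurable (@rV_cons R n @^-1` A).
  rewrite -[X in measurable X]setTI; exact: measurable_rV_cons.
pose phi x := lebesgue_rV R n (xsection (@rV_cons R n @^-1` A) x).
have mphi : measurable_fun setT phi by exact: measurable_fun_xsection.
rewrite /= /lebesgue_rV_step /pushforward /product_measure1.
transitivity (\int[lebesgue_measure]_x phi (x + (rV_uncons a).1)%R)%E.
  apply: eq_integral => x _ /=.
  rewrite /phi -[RHS](IH (rV_uncons a).2); last exact: measurable_xsection.
  congr (lebesgue_rV R n _); apply/seteqP; split => v;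
    by rewrite /xsection /= !inE /= rV_consD.
transitivity (\int[pushforward lebesgue_measure (fun x : measurableTypeR R =>
  (x + (rV_uncons a).1)%R : measurableTypeR R)]_x phi x)%E.
  by rewrite ge0_integral_pushforward//= => x _; exact: measure_ge0.
by apply: eq_measure_integral => B mB _; exact: lebesgue_measure_shift.
Qed.

Lemma lebesgue_rV_ball0 n r : (0 < r)%R ->
  lebesgue_rV R n (ball 0 r) = ((r *+ 2) ^+ n)%:E.
Proof.
move=> r0; elim: n => [|n IH].
  by rewrite /= diracE mem_set ?expr0//; exact: ballxx.
rewrite /= /lebesgue_rV_step /pushforward.
rewrite (_ : _ @^-1` _ = ball (0:R) r `*` ball (0 : 'rV[R]_n) r); last first.
  rewrite !ball_rVE -ball_normE /= .
  apply/seteqP; split => -[x v]; rewrite /= !subr0 sub0r normrN.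
    move/(rV_norm_ltP _ r0) => h; split; first by have := h ord0; rewrite rV_cons_ord0.
    by apply/rV_norm_ltP => // i; have := h (lift ord0 i); rewrite rV_cons_lift.
  move=> [hx /(rV_norm_ltP _ r0) hv]; apply/rV_norm_ltP => // i.
  by case: (unliftP ord0 i) => [j ->|->]; rewrite (rV_cons_lift, rV_cons_ord0).
rewrite product_measure1E; first last.
- exact: measurable_ball_rV.
- by apply: open_measurable; exact: ball_open.
rewrite [X in (_ * X)%E](_ : _ = ((r *+ 2) ^+ n)%:E) ; last exact: IH.
rewrite -[X in (X * _)%E]/(lebesgue_measure (ball (0 : R) r)).
by rewrite lebesgue_measure_ball ?ltW// -EFinM exprS.
Qed.

Lemma lebesgue_rV_ball n (c : 'rV[R]_n) r : (0 < r)%R ->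
  lebesgue_rV R n (ball c r) = ((r *+ 2) ^+ n)%:E.
Proof.
move=> r0; rewrite -(lebesgue_rV_ball0 _ r0) -(lebesgue_rV_shift c); last exact: measurable_ball_rV.
congr (lebesgue_rV R n _); rewrite !ball_rVE; apply/seteqP; split=> x /=; by rewrite addrK subr0.
Qed.

Lemma lebesgue_rV_bounded n (A : set 'rV[R]_n) r : measurable A ->
  (forall x, A x -> `|x| < r) -> (lebesgue_rV R n A < +oo)%E.
Proof.
move=> mA Ar.
have [r0|r0] := ltP 0 r; last first.
  rewrite (_ : A = set0) ?measure0//; apply/seteqP; split => // x /Ar.
  by move=> h; move: (le_lt_trans (normr_ge0 _) (lt_le_trans h r0)); rewrite ltxx.
apply: (@le_lt_trans _ _ (lebesgue_rV R n (ball 0 r))).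
  apply: le_measure; rewrite ?inE//; first exact: measurable_ball_rV.
  by move=> x Ax; rewrite ball_rVE /= subr0; exact: Ar.
by rewrite lebesgue_rV_ball0// ltry.
Qed.

(* Infinitely many disjoint translates of a bounded piece of the hyperplane
   fit into a bounded set. *)
Lemma hyperplane_null n (a : 'rV[R]_n) (b : R) : a != 0 ->
  lebesgue_rV R n [set x : 'rV[R]_n | \sum_i a ord0 i * x ord0 i = b] = 0.
Proof.
move=> a0.
have [j aj] : exists j, a ord0 j != 0.
  apply/existsP; apply: contraNT a0 => /existsPn h.
  by apply/eqP/rowP => j; rewrite mxE; apply/eqP; rewrite -[_ == _]negbK; exact: h.
set Hp := (X in lebesgue_rV R n X).
have cHp : continuous (fun x : 'rV[R]_n => \sum_i a ord0 i * x ord0 i).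
  apply: continuous_big => [|i _ x]; first exact: add_continuous.
  apply: continuousM; [exact: cst_continuous|exact: continuous_coord].
have mHp : measurable Hp.
  apply: closed_rV_measurable.
  by apply: (closed_comp (f := fun x : 'rV[R]_n => \sum_i a ord0 i * x ord0 i)
    (D := [set b])) => [x _|]; [exact: cHp|exact: closed_eq].
have HB r : (0 < r)%R -> lebesgue_rV R n (Hp `&` ball 0 r) = 0.
  move=> r0; set A := Hp `&` _.
  have mA : measurable A by apply: measurableI => //; exact: measurable_ball_rV.
  (* Since [a ord0 j] is nonzero, translations by distinct multiples of the j-th unit vector give
     disjoint sets; multiples in ]0, 1] keep them in a ball of radius r + 1. *)
  pose e (k : nat) : 'rV[R]_n := (k.+1%:R^-1) *: delta_mx 0 j.
  pose F k := (fun x : 'rV[R]_n => x + e k) @^-1` A.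
  have mF k : measurable (F k).
    by rewrite -[X in measurable X]setTI; apply: measurable_addr_rV.
  have Foo : (lebesgue_rV R n (\bigcup_k F k) < +oo)%E.
    apply: (@lebesgue_rV_bounded _ _ (r + 1)); first exact: bigcupT_measurable.
    move=> x [k _ [_]]; rewrite ball_rVE /= subr0 => xr.
    rewrite -(addrK (e k) x) (le_lt_trans (ler_normB _ _))// ltr_leD//.
    apply/rV_norm_leP => // i; rewrite !mxE eqxx/=.
    case: (_ == _); rewrite ?mulr0 ?normr0// mulr1 ger0_norm ?invr_ge0//.
    by rewrite invf_le1// ler1n.
  move: Foo; rewrite measure_bigcup//; last first.
    move=> k l _ _ [x [[] [+ _] [+ _]]]; rewrite /Hp /= => h1 h2.
    have : (\sum_i a ord0 i * (x + e k) ord0 i) - (\sum_i a ord0 i * (x + e l) ord0 i) = 0.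
      by rewrite h1 h2 subrr.
    rewrite -sumrB (bigD1 j)//= big1 ?addr0; last first.
      by move=> i ij; rewrite !mxE (negbTE ij) andbF !mulr0 subrr.
    rewrite !mxE !eqxx/= !mulr1 -mulrBr opprD addrACA subrr add0r => /eqP.
    rewrite mulf_eq0 (negbTE aj)/= subr_eq0 => /eqP/invr_inj/eqP.
    by rewrite eqr_nat => /eqP[].
  rewrite (eq_eseriesr (g := fun=> lebesgue_rV R n A)); last first.
    by move=> k _; exact: lebesgue_rV_shift.
  have [->//|A0] := eqVneq (lebesgue_rV R n A) 0%E.
  set S := (\big[_/_]_(_ <= _ <oo | _) _)%E => Soo.
  have Aoo : (lebesgue_rV R n A < +oo)%E.
    apply: (@lebesgue_rV_bounded _ _ r) => // x [_].
    by rewrite ball_rVE /= subr0.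
  have Afin : lebesgue_rV R n A \is a fin_num by rewrite ge0_fin_numE.
  (* The total S is finite and yet bounds every multiple of the measure of A, against the
     Archimedean property if that measure is positive. *)
  have Sge k : (k%:R * fine (lebesgue_rV R n A) <= fine S)%R.
    have S0 : (0 <= S)%E by apply: nneseries_ge0.
    rewrite -lee_fin fineK; last by rewrite ge0_fin_numE.
    apply: le_trans (@nneseries_lim_ge _ _ (fun i => i \in [set: nat]) 0%N k _) => //.
    rewrite (eq_bigr (fun=> (fine (lebesgue_rV R n A))%:E)); last by move=> i _; rewrite fineK.
    under eq_bigl do rewrite in_setT.
    by rewrite sumEFin lee_fin sumr_const_nat subn0 mulr_natl.
  have c0 : (0 < fine (lebesgue_rV R n A))%R by rewrite fine_gt0// lt0e A0 measure_ge0.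
  have := Sge (Num.truncn (fine S / fine (lebesgue_rV R n A))).+1.
  by rewrite -ler_pdivlMr// leNgt truncnS_gt.
rewrite (_ : Hp = \bigcup_k (Hp `&` ball 0 k.+1%:R)); last first.
  rewrite -setI_bigcupr; apply/esym/setIidl => x _.
  exists (Num.truncn `|x|) => //; rewrite ball_rVE /= subr0.
  exact: truncnS_gt.
have mk k : measurable (Hp `&` ball (0 : 'rV[R]_n) k.+1%:R).
  by apply: measurableI => //; exact: measurable_ball_rV.
apply: measure_negligible; first exact: bigcupT_measurable.
by apply: negligible_bigcup => k; apply/negligibleP; [exact: mk|exact: HB].
Qed.

End lebesgue_shift.

(** * Integrals of bounded functions with bounded support *)

Section bounded_integrals.
Variables (R : realType) (n : nat).
Implicit Types (f g : 'rV[R]_n -> R) (U N : set 'rV[R]_n).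
Local Notation mu := (lebesgue_rV R n).
Local Notation Int f := (Rintegral mu setT f).

(** This class is stable under sums, products and translations and consists of integrable functions,
    so that the real-valued integral is linear on it without further side conditions. Every
    integrand of the development is put into it by extension by 0. *)
Definition bmeas f := measurable_fun setT f /\
  exists M r : R, (forall x, `|f x| <= M) /\ (forall x, r <= `|x| -> f x = 0).

Lemma bounded_supp_integrable f (M r : R) : measurable_fun setT f ->
  (forall x, `|f x| <= M) -> (forall x, r <= `|x| -> f x = 0) ->
  mu.-integrable setT (EFin \o f).
Proof.
move=> mf fM fr.
apply: (@le_integrable _ _ _ mu setT _ _ (EFin \o (fun x => M * \1_(ball (0 : 'rV[R]_n) r) x))) => //.
- exact/measurable_EFinP.
- move=> x _ /=; rewrite lee_fin; have M0 : 0 <= M by exact: le_trans (fM 0).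
  rewrite indicE; have [xr|xr] := boolP (_ \in _).
    by rewrite mulr1 [leRHS]ger0_norm.
  rewrite fr ?normr0// leNgt; apply: contra xr => xr; rewrite inE ball_rVE /=.
  by rewrite subr0.
- rewrite (_ : _ \o _ = (fun x => M%:E * (\1_(ball (0 : 'rV[R]_n) r) x)%:E)%E); last first.
    by apply/funext => x /=; rewrite EFinM.
  apply: integrableZl => //; apply/integrableP; split.
    by apply/measurable_EFinP; apply: measurable_indic; exact: measurable_ball_rV.
  rewrite (eq_integral (fun x => (\1_(ball (0 : 'rV[R]_n) r) x)%:E)); last first.
    by move=> x _; rewrite gee0_abs// lee_fin.
  rewrite integral_indic//; last exact: measurable_ball_rV.
  rewrite setIT; apply: (@lebesgue_rV_bounded _ _ _ r); first exact: measurable_ball_rV.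
  by move=> x; rewrite ball_rVE /= subr0.
Qed.

Lemma bmeas_integrable f : bmeas f -> mu.-integrable setT (EFin \o f).
Proof. by move=> [mf [M [r [fM fr]]]]; exact: (bounded_supp_integrable mf fM fr). Qed.

Lemma bmeasD f g : bmeas f -> bmeas g -> bmeas (fun x => f x + g x).
Proof.
move=> [mf [M [r [fM fr]]]] [mg [L [s [gL gs]]]]; split; first exact: measurable_funD.
exists (M + L), (Num.max r s); split.
  by move=> x; rewrite (le_trans (ler_normD _ _))// lerD.
by move=> x; rewrite ge_max => /andP[rx sx]; rewrite fr// gs// addr0.
Qed.

Lemma bmeasM f g : bmeas f -> measurable_fun setT g -> (exists M, forall x, `|g x| <= M) ->
  bmeas (fun x => f x * g x).
Proof.
move=> [mf [M [r [fM fr]]]] mg [L gL]; split; first exact: measurable_funM.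
exists (M * L), r; split.
  by move=> x; rewrite normrM ler_pM.
by move=> x rx; rewrite fr// mul0r.
Qed.

Lemma bmeasMM f g : bmeas f -> bmeas g -> bmeas (fun x => f x * g x).
Proof. by move=> bf [mg [L [s [gL gs]]]]; apply: bmeasM => //; exists L. Qed.

Lemma bmeasZ (a : R) f : bmeas f -> bmeas (fun x => a * f x).
Proof.
move=> bf; rewrite (_ : (fun _ => _) = (fun x => f x * a)); last by apply/funext => x; rewrite mulrC.
by apply: bmeasM => //; exists `|a|.
Qed.

Lemma bmeasN f : bmeas f -> bmeas (fun x => - f x).
Proof. by move=> /(bmeasZ (-1)); under eq_fun do rewrite mulN1r. Qed.

Lemma bmeasB f g : bmeas f -> bmeas g -> bmeas (fun x => f x - g x).
Proof. by move=> bf bg; apply: bmeasD => //; exact: bmeasN. Qed.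

Lemma bmeas0 : bmeas (fun=> 0).
Proof. by split => //; exists 0, 0; split => // x; rewrite normr0. Qed.

Lemma bmeas_sum (I : Type) (s : seq I) (P : pred I) (F : I -> 'rV[R]_n -> R) :
  (forall i, P i -> bmeas (F i)) -> bmeas (fun x => \sum_(i <- s | P i) F i x).
Proof.
move=> bF; elim: s => [|i s IH].
  by under eq_fun do rewrite big_nil; exact: bmeas0.
under eq_fun do rewrite big_cons; case: (boolP (P i)) => // Pi.
by apply: bmeasD => //; exact: bF.
Qed.

Lemma bmeas_norm f : bmeas f -> bmeas (fun x => `|f x|).
Proof.
move=> [mf [M [r [fM fr]]]]; split.
  by apply: measurableT_comp => //; exact: normr_measurable.
exists M, r; split => x; first by rewrite normr_id.
by move=> /fr ->; rewrite normr0.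
Qed.

Lemma bmeas_shift f (a : 'rV[R]_n) : bmeas f -> bmeas (fun x => f (x + a)).
Proof.
move=> [mf [M [r [fM fr]]]]; split.
  by apply: (measurableT_comp mf); exact: measurable_addr_rV.
exists M, (r + `|a|); split => // x rx; apply: fr.
by rewrite -lerBrDr in rx; rewrite (le_trans rx)// lerBlDr -{1}(addrK a x) ler_normB.
Qed.

Lemma bmeas_patch U f (M r : R) : measurable U -> measurable_fun U f ->
  (forall x, U x -> `|f x| <= M) -> (forall x, U x -> `|x| < r) -> bmeas (f \_ U).
Proof.
move=> mU mf fM Ur; split; first exact/(measurable_restrictT _ mU).
exists `|M|, r; split => x; rewrite patchE; case: ifPn => //.
- by rewrite inE => /fM h; rewrite (le_trans h)// ler_norm.
- by rewrite normr0.
by rewrite inE => /Ur h; rewrite leNgt h.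
Qed.

Lemma IntD f g : bmeas f -> bmeas g -> Int (fun x => f x + g x) = Int f + Int g.
Proof. by move=> bf bg; rewrite RintegralD//; exact: bmeas_integrable. Qed.

Lemma IntB f g : bmeas f -> bmeas g -> Int (fun x => f x - g x) = Int f - Int g.
Proof. by move=> bf bg; rewrite RintegralB//; exact: bmeas_integrable. Qed.

Lemma IntZ a f : bmeas f -> Int (fun x => a * f x) = a * Int f.
Proof. by move=> bf; rewrite RintegralZl//; exact: bmeas_integrable. Qed.

Lemma IntN f : bmeas f -> Int (fun x => - f x) = - Int f.
Proof. by move=> /(IntZ (-1)); under eq_Rintegral do rewrite mulN1r; rewrite mulN1r. Qed.

Lemma Int0 : Int (fun=> 0) = 0.
Proof. by rewrite Rintegral_cst// mul0r. Qed.

Lemma Int_sum (I : Type) (s : seq I) (P : pred I) (F : I -> 'rV[R]_n -> R) :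
  (forall i, P i -> bmeas (F i)) ->
  Int (fun x => \sum_(i <- s | P i) F i x) = \sum_(i <- s | P i) Int (F i).
Proof.
move=> bF; elim: s => [|i s IH].
  by under eq_Rintegral do rewrite big_nil; rewrite big_nil Int0.
under eq_Rintegral do rewrite big_cons; rewrite big_cons; case: ifPn => // Pi.
by rewrite IntD ?IH//; [exact: bF|exact: bmeas_sum].
Qed.

Lemma le_Int f g : bmeas f -> bmeas g -> (forall x, f x <= g x) -> Int f <= Int g.
Proof. by move=> bf bg fg; apply: le_Rintegral => //; exact: bmeas_integrable. Qed.

Lemma Int_norm f : bmeas f -> `|Int f| <= Int (fun x => `|f x|).
Proof. by move=> bf; apply: le_normr_Rintegral => //; exact: bmeas_integrable. Qed.

Lemma Int_shift f (a : 'rV[R]_n) : bmeas f -> Int (fun x => f (x + a)) = Int f.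
Proof.
move=> bf; rewrite /Rintegral; congr fine.
have mfa : measurable_fun setT (fun x : 'rV[R]_n => (x + a)%R : 'rV[R]_n).
  exact: measurable_addr_rV.
transitivity (\int[pushforward mu (fun x : 'rV[R]_n => (x + a)%R : 'rV[R]_n)]_x (f x)%:E)%E; last first.
    by apply: eq_measure_integral => B mB _; exact: lebesgue_rV_shift.
rewrite integral_pushforward//; first by case: bf => mf _; exact/measurable_EFinP.
rewrite preimage_setT.
have := bmeas_integrable (bmeas_shift a bf).
exact.
Qed.

Lemma Int_ae_eq f g N : measurable_fun setT f -> measurable_fun setT g ->
  measurable N -> mu N = 0%E -> (forall x, ~ N x -> f x = g x) -> Int f = Int g.
Proof.
move=> mf mg mN N0 fg; rewrite /Rintegral; congr fine.
apply: ae_eq_integral => //.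
- exact/measurable_EFinP.
- exact/measurable_EFinP.
exists N; split => // x /= h; apply: contrapT => Nx; apply: h => _.
by rewrite fg.
Qed.

(** The dominating function is the constant [|M|] on a fixed ball. *)
Lemma Int_dominated (f_ : nat -> 'rV[R]_n -> R) f N (M r : R) :
  (forall k, measurable_fun setT (f_ k)) -> measurable_fun setT f ->
  (forall k x, `|f_ k x| <= M) -> (forall k x, r <= `|x| -> f_ k x = 0) ->
  measurable N -> mu N = 0%E ->
  (forall x, ~ N x -> f_ ^~ x @ \oo --> f x) ->
  Int (f_ k) @[k --> \oo] --> Int f.
Proof.
move=> mf_ mf fM fr mN N0 ff.
pose g := EFin \o (fun x => `|M| * \1_(ball (0 : 'rV[R]_n) r) x).
have mg : measurable_fun setT (fun x : 'rV[R]_n => `|M| * \1_(ball (0 : 'rV[R]_n) r) x).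
  apply: measurable_funM => //; apply: measurable_indic; exact: measurable_ball_rV.
have ig : mu.-integrable setT g.
  apply: (@bounded_supp_integrable _ `|M| r) => //.
    by move=> x; rewrite normrM normr_id indicE; case: (_ \in _); rewrite ?normr1 ?normr0 ?mulr1 ?mulr0.
  move=> x rx; rewrite indicE memNset ?mulr0//.
  by rewrite ball_rVE /= subr0; apply/negP; rewrite -leNgt.
have [] := @dominated_convergence _ _ _ mu setT measurableT
  (fun k => EFin \o f_ k) (EFin \o f) g.
- by move=> k; apply/measurable_EFinP.
- exact/measurable_EFinP.
- exists N; split => // x /= h; apply: contrapT => Nx; apply: h => _.
  by apply: cvg_EFin; [exact: nearW|exact: ff].
- exact: ig.
- apply/aeW => x k _ /=; rewrite lee_fin indicE.
  have [xr|xr] := boolP (_ \in _).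
    by rewrite mulr1 (le_trans (fM k x))// ler_norm.
  rewrite fr ?normr0 ?mulr0// leNgt; apply: contra xr => xr; rewrite inE ball_rVE /=.
  by rewrite subr0.
move=> intf _ h; apply: fine_cvg; rewrite fineK; last exact: integrable_fin_num.
exact: h.
Qed.

(** By continuity f exceeds [f x0 / 2] on a ball, and balls have positive measure. *)
Lemma Int_gt0 f x0 : bmeas f -> (forall x, 0 <= f x) -> 0 < f x0 ->
  {for x0, continuous f} -> 0 < Int f.
Proof.
move=> bf f0 fx0 cf.
have /nbhs_ballP[e /= e0 he] : \forall x \near x0, f x0 / 2 < f x.
  by apply: (cvgr_gt _ cf); rewrite ltr_pdivrMr// mulr_natr mulr2n ltrDl.
have mB := measurable_ball_rV x0 e.
apply: (@lt_le_trans _ _ (Int (fun x => f x0 / 2 * \1_(ball x0 e) x))).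
  have bi : bmeas (\1_(ball x0 e) : 'rV[R]_n -> R).
    split; first exact: measurable_indic.
    exists 1, (`|x0| + e); split => x; rewrite indicE.
      by case: (_ \in _); rewrite ?normr1 ?normr0.
    move=> xr; rewrite memNset// ball_rVE /= => xx.
    move: xr; rewrite leNgt => /negP; apply.
    by rewrite -(subrK x0 x) addrC (le_lt_trans (ler_normD _ _))// ltrD2l.
  rewrite IntZ// mulr_gt0// ?divr_gt0//.
  rewrite /Rintegral integral_indic// setIT.
  rewrite [X in fine X](_ : _ = ((e *+ 2) ^+ n)%:E) /=; last exact: lebesgue_rV_ball.
  by rewrite exprn_gt0// mulrn_wgt0.
apply: le_Rintegral => //.
- apply: bmeas_integrable; apply: bmeasZ.
    split; first exact: measurable_indic.
    exists 1, (`|x0| + e); split => x; rewrite indicE.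
      by case: (_ \in _); rewrite ?normr1 ?normr0.
    move=> xr; rewrite memNset// ball_rVE /= => xx.
    move: xr; rewrite leNgt => /negP; apply.
    by rewrite -(subrK x0 x) addrC (le_lt_trans (ler_normD _ _))// ltrD2l.
- exact: bmeas_integrable.
move=> x _; rewrite indicE; have [xB|xB] := boolP (x \in _); last by rewrite mulr0.
by rewrite mulr1 ltW//; apply: he; rewrite inE in xB.
Qed.

End bounded_integrals.

(** * Smooth functions and integration by parts *)

Section directional_derivatives.
Variables (R : realType) (V : normedModType R).
Implicit Types (f g : V -> R) (x v : V).

(** The two difference quotients are the same function, so that the one-variable chain rule and mean
    value theorem apply to directional derivatives. *)
Lemma is_derive_line f x v (d : R) :
  is_derive x v f d <-> is_derive (0 : R) 1 (fun t : R => f (t *: v + x)) d.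
Proof.
have E : (fun h : R => h^-1 *: ((f \o shift x) (h *: v) - f x)) =
  (fun h : R => h^-1 *: (((fun t : R => f (t *: v + x)) \o shift 0) (h *: 1) - f (0 *: v + x))).
  apply/funext => h /=; rewrite scale0r add0r addr0.
  by rewrite -[h%:A]/(h * 1) mulr1.
by split => -[dd <-]; apply: DeriveDef; rewrite /derivable /derive ?E// -E.
Qed.

End directional_derivatives.

Section directional_rules.
Variables (R : realType) (V : normedModType R).
Implicit Types (f g : V -> R) (x v : V).

Lemma is_derive_line_at f x v (d t : R) :
  is_derive (t *: v + x) v f d -> is_derive t 1 (fun t : R => f (t *: v + x)) d.
Proof.
move=> /is_derive_line h; apply/is_derive_line.
rewrite (_ : (fun s : R => _) = (fun s : R => f (s *: v + (t *: v + x)))) //.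
by apply/funext => s; rewrite -[s%:A]/(s * 1) mulr1 scalerDl addrA.
Qed.

Lemma is_derive_comp1 (g : R -> R) f x v (e d : R) :
  is_derive (f x) 1 g e -> is_derive x v f d ->
  is_derive x v (fun y => g (f y)) (e * d).
Proof.
move=> dg /is_derive_line df; apply/is_derive_line.
apply: (@is_derive1_comp _ g (fun t : R => f (t *: v + x))) => //.
by rewrite scale0r add0r.
Qed.

Lemma is_derive_add f g x v (a b : R) : is_derive x v f a -> is_derive x v g b ->
  is_derive x v (fun y => f y + g y) (a + b).
Proof. exact: is_deriveD. Qed.

Lemma is_derive_mul f g x v (a b : R) : is_derive x v f a -> is_derive x v g b ->
  is_derive x v (fun y => f y * g y) (a * g x + f x * b).
Proof.
move=> fa gb; apply: (is_derive_eq (is_deriveM fa gb)).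
by rewrite addrC mulrC.
Qed.

Lemma derivable_line_continuous f x v : (forall t : R, derivable f (t *: v + x) v) ->
  continuous (fun t : R => f (t *: v + x)).
Proof.
move=> df t; apply: differentiable_continuous; apply/derivable1_diffP.
by have [] := is_derive_line_at (derivableP (df t)).
Qed.

End directional_rules.

Lemma is_derive_coord (R : realType) n (x v : 'rV[R]_n) i : is_derive x v (fun y : 'rV[R]_n => y ord0 i) (v ord0 i).
Proof.
apply/is_derive_line.
rewrite (_ : (fun _ => _) = (fun t : R => t * v ord0 i + x ord0 i)).
  apply: (is_derive_eq (is_derive_add (is_derive_mul (is_derive_id _ _)
    (is_derive_cst _ _ _)) (is_derive_cst _ _ _))).
  by rewrite mulr0 !addr0 mul1r.
by apply/funext => t; rewrite !mxE.
Qed.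

Section flat_functions.
Variable R : realType.

(* Each derivative of [t |-> exp (- s / t)] is a combination of these. *)
Definition gexp (m : nat) (s t : R) : R :=
  if 0 < t then t^-1 ^+ m * expR (- (s / t)) else 0.

Lemma gexp_ge0 m s t : 0 <= gexp m s t.
Proof.
rewrite /gexp; case: ifP => // t0; rewrite mulr_ge0 ?expR_ge0// exprn_ge0//.
by rewrite invr_ge0 ltW.
Qed.

Lemma gexp_gt0 m s t : 0 < t -> 0 < gexp m s t.
Proof. by move=> t0; rewrite /gexp t0 mulr_gt0 ?expR_gt0// exprn_gt0// invr_gt0. Qed.

Lemma gexp_eq0 m s t : t <= 0 -> gexp m s t = 0.
Proof. by move=> t0; rewrite /gexp ltNge t0. Qed.

Lemma gexp0_le1 s t : 0 < s -> gexp 0 s t <= 1.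
Proof.
move=> s0; rewrite /gexp; case: ifP => // t0; rewrite expr0 mul1r -expR0 ler_expR.
by rewrite oppr_le0 ltW// divr_gt0.
Qed.

(** From $e^x \ge x^{m+1}/(m+1)!$ at x = s/t. The linear decay at 0, valid for every m, yields
    differentiability there. *)
Lemma gexp_le m s t : 0 < s -> `|gexp m s t| <= (m.+1)`!%:R / s ^+ m.+1 * `|t|.
Proof.
move=> s0; rewrite /gexp; case: ifP => t0; last first.
  by rewrite normr0 mulr_ge0// divr_ge0// exprn_ge0// ltW.
have st0 : 0 < s / t by rewrite divr_gt0.
rewrite ger0_norm; last by rewrite mulr_ge0 ?expR_ge0// exprn_ge0// invr_ge0 ltW.
rewrite gtr0_norm// expRN.
have h := expR_ge1Dxn m (ltW st0).
have h1 : (s / t) ^+ m.+1 / (m.+1)`!%:R <= expR (s / t).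
  by apply: le_trans h; rewrite lerDr.
have h2 : 0 < (s / t) ^+ m.+1 / (m.+1)`!%:R.
  by rewrite divr_gt0 ?exprn_gt0// ltr0n fact_gt0.
apply: (@le_trans _ _ (t^-1 ^+ m * ((s / t) ^+ m.+1 / (m.+1)`!%:R)^-1)).
  by rewrite ler_pM2l ?exprn_gt0 ?invr_gt0// lef_pV2 ?posrE ?expR_gt0.
rewrite le_eqVlt; apply/orP; left; apply/eqP.
have tn0 : t != 0 by rewrite gt_eqF.
have sn0 : s != 0 by rewrite gt_eqF.
have fn0 : (m.+1)`!%:R != 0 :> R by rewrite pnatr_eq0 -lt0n fact_gt0.
rewrite expr_div_n exprVn [t ^+ m.+1]exprS.
move: (expf_neq0 m tn0) (expf_neq0 m.+1 sn0) fn0.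
move: (t ^+ m) (s ^+ m.+1) (_`!%:R) => a b c a0 b0 c0.
by field; rewrite a0 b0 c0 tn0.
Qed.

Lemma is_derive_gexp (m : nat) (s t : R) : 0 < s ->
  is_derive t (1 : R) (gexp m s) (- m%:R * gexp m.+1 s t + s * gexp m.+2 s t).
Proof.
move=> s0; have [t0|t0|->] := ltgtP t 0.
- rewrite !gexp_eq0 ?ltW// !mulr0 addr0.
  apply: (@near_eq_is_derive _ _ _ (cst (0:R))) => //.
  by near=> u; rewrite gexp_eq0//; near: u; apply: filterS (lt_nbhsl t0) => ? /ltW.
- pose F := (fun u : R => u^-1) ^+ m * (expR \o (- (s \*: (fun u : R => u^-1)))).
  apply: (@near_eq_is_derive _ _ _ F) => //.
    near=> u; rewrite /gexp /F; case: ifPn; last first.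
      by rewrite -leNgt leNgt; apply: contraNP => _; near: u; exact: lt_nbhsr.
    by move=> u0; rewrite fctE /= exprfctE.
  have tn0 : t != 0 by rewrite gt_eqF.
  have dV : is_derive t (1 : R) (fun u : R => u^-1) (- t ^- 2).
    apply: is_derive_eq; first exact: (@is_deriveV _ id).
    by rewrite -[_%:A]/(_ * _) mulr1.
  rewrite /F; apply: is_derive_eq.
  rewrite /gexp t0 /= !exprfctE /= -[_ *: _]/(_ * _) -[X in _ + X]/(_ * _).
  rewrite -[_ *: - _]/(_ * _).
  have -> : (- (s \*: (fun u : R => u^-1))) t = - (s / t) by [].
  set E := expR _.
  case: m @F => [|m] F; first by rewrite !expr0 -[_ *: _]/(_ * _) !mul0r oppr0 mul0r; field.
  rewrite -[_ *: _]/(_ * _) /= !exprS; field.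
  by [].
- rewrite !gexp_eq0// !mulr0 addr0.
  suff h : (fun h : R => h^-1 *: ((gexp m s \o shift 0) (h *: 1) - gexp m s 0)) @ 0^' --> (0:R).
    by apply: DeriveDef; [apply/cvg_ex; exists 0|apply/cvg_lim].
  apply: (@cvg_trans _ (gexp m.+1 s h @[h --> 0^'])).
    apply: near_eq_cvg; near=> h => /=.
    rewrite addr0 -[h%:A]/(h * 1) mulr1 (@gexp_eq0 m s 0)// subr0 -[RHS]/(_ * _).
    by rewrite /gexp; case: ifP => _; rewrite ?mulr0// exprS mulrA.
  apply/cvgr0Pnorm_le => e e0.
  pose C := (m.+2)`!%:R / s ^+ m.+2.
  have C0 : 0 < C by rewrite divr_gt0 ?exprn_gt0// ltr0n fact_gt0.
  have : \forall h \near (0:R), `|h| <= e / C.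
    apply/nbhs_ballP; exists (e / C); first by rewrite /= divr_gt0.
    by move=> h; rewrite -ball_normE /= sub0r normrN => /ltW.
  move=> /nbhs_dnbhs; apply: filter_app; near=> h => hC.
  by apply: (le_trans (gexp_le _ _ s0)); rewrite mulrC -ler_pdivlMr.
Unshelve. all: by end_near. Qed.

Lemma continuous_gexp m s : 0 < s -> continuous (gexp m s).
Proof.
move=> s0 t; apply: differentiable_continuous; apply/derivable1_diffP.
by have [] := is_derive_gexp m t s0.
Qed.

End flat_functions.

(** * Smooth functions and an algebra of explicit ones *)

Section smooth_functions.
Variables (R : realType) (n : nat).
Implicit Types (f g : 'rV[R]_n -> R) (x : 'rV[R]_n).

(* A record rather than a definition, so that [done] does not unfold it. *)
Record Cinf f : Prop := MkCinf { CinfP : forall s, continuous (pder s f) /\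
  forall i x, derivable (pder s f) x 'e_i }.

Lemma smooth_setTP f : smooth setT f <-> Cinf f.
Proof.
split=> [sf|[cf] k s _ x _]; last by split; [exact: (cf s).1|move=> _ i; exact: (cf s).2].
split=> s; split=> [x|i x].
  by have [] := sf (size s) s (leqnn _) x I.
by have [_] := sf (size s).+1 s (leqnSn _) x I; apply.
Qed.

(** Smoothness by coinduction: it is enough to exhibit a class of continuous functions that contains
    f and is stable under partial derivatives. *)
Lemma Cinf_coind (P : ('rV[R]_n -> R) -> Prop) :
  (forall f, P f -> continuous f /\
     forall i, exists g, P g /\ forall x, is_derive x 'e_i f (g x)) ->
  forall f, P f -> Cinf f.
Proof.
move=> hP f Pf.
have DP i h : P h -> P ('D_('e_i) h) /\ forall x, derivable h x 'e_i.
  move=> /hP[_ /(_ i)[g [Pg dg]]]; split=> [|x]; last by have [] := dg x.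
  by rewrite (_ : 'D_('e_i) h = g)//; apply/funext => x; have [] := dg x.
have PP s : P (pder s f).
  by elim: s => [//|i s IH] /=; have [] := DP i _ IH.
by split=> s; split; [exact: (hP _ (PP s)).1|move=> i; exact: (DP i _ (PP s)).2].
Qed.

Lemma Cinf_continuous f : Cinf f -> continuous f.
Proof. by move=> /CinfP/(_ [::])[]. Qed.

Lemma Cinf_pder s f : Cinf f -> Cinf (pder s f).
Proof.
move=> [cf]; split=> t; have [] := cf (t ++ s).
by rewrite /pder foldr_cat.
Qed.

Lemma Cinf_derive f i x : Cinf f -> is_derive x 'e_i f (pder [:: i] f x).
Proof. by move=> /CinfP/(_ [::])[_ /(_ i x)] /derivableP. Qed.

Section closure.
Variable B : ('rV[R]_n -> R) -> Prop.
Hypothesis BP : forall f, B f -> Cinf f /\ forall i, B (pder [:: i] f).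

(* Sums of products of affine changes of variables of members of B; with B
   empty, this still contains the bump functions. *)
Inductive smooth_alg : ('rV[R]_n -> R) -> Prop :=
| sa_cst c : smooth_alg (fun=> c)
| sa_coord i : smooth_alg (fun x => x ord0 i)
| sa_aff f (c : R) b : B f -> smooth_alg (fun x => f (c *: x + b))
| sa_flat m s i (c b : R) : 0 < s -> smooth_alg (fun x => gexp m s (c * x ord0 i + b))
| sa_add f g : smooth_alg f -> smooth_alg g -> smooth_alg (fun x => f x + g x)
| sa_mul f g : smooth_alg f -> smooth_alg g -> smooth_alg (fun x => f x * g x).

Lemma continuous_aff (c : R) (b : 'rV[R]_n) : continuous (fun x => c *: x + b).
Proof.
by move=> x; apply: continuousD; [exact: scaler_continuous|exact: cst_continuous].
Qed.

Lemma is_derive_aff f (c : R) b x v d : is_derive (c *: x + b) v f d ->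
  is_derive x v (fun y => f (c *: y + b)) (c * d).
Proof.
move=> /is_derive_line h; apply/is_derive_line.
rewrite (_ : (fun t : R => _) = (fun t : R => f (t *: v + (c *: x + b))) \o (fun t => c * t)); last first.
  by apply/funext => t /=; rewrite scalerDr scalerA addrA.
rewrite mulrC; apply: is_derive1_comp; first by rewrite mulr0.
rewrite (_ : (fun t => _) = c \*: (@id R^o)) //.
by apply: is_derive_eq; rewrite -[_%:A]/(_ * _) mulr1.
Qed.

Lemma smooth_alg_step f : smooth_alg f -> continuous f /\
  forall i, exists g, smooth_alg g /\ forall x, is_derive x 'e_i f (g x).
Proof.
elim => {f}.
- move=> c; split=> [|i]; first exact: cst_continuous.
  by exists (fun=> 0); split; [exact: sa_cst|move=> x; exact: is_derive_cst].
- move=> i; split=> [|j]; first exact: continuous_coord.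
  exists (fun=> ('e_j : 'rV[R]_n) ord0 i); split; first exact: sa_cst.
  by move=> x; exact: is_derive_coord.
- move=> f c b Bf; have [cf Bdf] := BP Bf; split.
    move=> x; apply: (@continuous_comp _ _ _ (fun x => c *: x + b) f).
      exact: continuous_aff.
    exact: Cinf_continuous.
  move=> i; exists (fun x => c * pder [:: i] f (c *: x + b)); split.
    apply: (sa_mul (sa_cst c)); exact: (@sa_aff (pder [:: i] f)).
  by move=> x; apply: is_derive_aff; exact: Cinf_derive.
- move=> m s i c b s0.
  have dl x v : is_derive x v (fun y : 'rV[R]_n => c * y ord0 i + b) (c * v ord0 i).
    apply: (is_derive_eq (is_derive_add (is_derive_mul (is_derive_cst c x v)
      (is_derive_coord x v i)) (is_derive_cst b x v))).
    by rewrite mul0r add0r addr0.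
  split.
    move=> x; apply: (@continuous_comp _ _ _ (fun x : 'rV[R]_n => c * x ord0 i + b) (gexp m s)).
      apply: continuousD; last exact: cst_continuous.
      by apply: continuousM; [exact: cst_continuous|exact: continuous_coord].
    exact: continuous_gexp.
  move=> j; exists (fun x => (- m%:R * gexp m.+1 s (c * x ord0 i + b) +
     s * gexp m.+2 s (c * x ord0 i + b)) * (c * ('e_j : 'rV[R]_n) ord0 i)); split.
    apply: sa_mul; last exact: sa_cst.
    by apply: sa_add; apply: (sa_mul (sa_cst _)); exact: sa_flat.
  by move=> x; apply: is_derive_comp1 => //; exact: is_derive_gexp.
- move=> f g af [cf df] ag [cg dg]; split.
    by move=> x; apply: continuousD; [exact: cf|exact: cg].
  move=> i; have [f' [af' df']] := df i; have [g' [ag' dg']] := dg i.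
  exists (fun x => f' x + g' x); split; first exact: sa_add.
  by move=> x; exact: is_derive_add.
- move=> f g af [cf df] ag [cg dg]; split.
    by move=> x; apply: continuousM; [exact: cf|exact: cg].
  move=> i; have [f' [af' df']] := df i; have [g' [ag' dg']] := dg i.
  exists (fun x => f' x * g x + f x * g' x); split.
    by apply: sa_add; exact: sa_mul.
  by move=> x; exact: is_derive_mul.
Qed.

Lemma smooth_alg_Cinf f : smooth_alg f -> Cinf f.
Proof. by apply: Cinf_coind => {}f /smooth_alg_step. Qed.

Lemma sa_gen f : B f -> smooth_alg f.
Proof.
move=> cf; have := @sa_aff f 1 0 cf.
by under eq_fun do rewrite scale1r addr0.
Qed.

Lemma smooth_alg_pder f i : smooth_alg f -> smooth_alg (pder [:: i] f).
Proof.
move=> /smooth_alg_step[_ /(_ i)[g [sg dg]]].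
by rewrite (_ : pder [:: i] f = g)//; apply/funext => x; have [] := dg x.
Qed.

End closure.

Lemma Cinf_stable f : Cinf f -> Cinf f /\ forall i, Cinf (pder [:: i] f).
Proof. by move=> cf; split; [exact: cf|move=> i; exact: (Cinf_pder [:: i] cf)]. Qed.

Lemma CinfD f g : Cinf f -> Cinf g -> Cinf (fun x => f x + g x).
Proof.
by move=> cf cg; apply: (smooth_alg_Cinf Cinf_stable); apply: sa_add; exact: sa_gen.
Qed.

Lemma CinfM f g : Cinf f -> Cinf g -> Cinf (fun x => f x * g x).
Proof.
by move=> cf cg; apply: (smooth_alg_Cinf Cinf_stable); apply: sa_mul; exact: sa_gen.
Qed.

Lemma Cinf_cst c : Cinf (fun=> c).
Proof. by apply: (smooth_alg_Cinf Cinf_stable); exact: sa_cst. Qed.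

Lemma Cinf_aff f (c : R) b : Cinf f -> Cinf (fun x => f (c *: x + b)).
Proof. by move=> cf; apply: (smooth_alg_Cinf Cinf_stable); exact: sa_aff. Qed.

Lemma Cinf_sum (I : Type) (r : seq I) (P : pred I) (F : I -> 'rV[R]_n -> R) :
  (forall i, Cinf (F i)) -> Cinf (fun x => \sum_(i <- r | P i) F i x).
Proof.
move=> cF; elim: r => [|i r IH].
  by under eq_fun do rewrite big_nil; exact: Cinf_cst.
by under eq_fun do rewrite big_cons; case: (P i); [exact: (CinfD (cF i) IH)|exact: IH].
Qed.

Lemma Cinf_prod (I : Type) (r : seq I) (P : pred I) (F : I -> 'rV[R]_n -> R) :
  (forall i, Cinf (F i)) -> Cinf (fun x => \prod_(i <- r | P i) F i x).
Proof.
move=> cF; elim: r => [|i r IH].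
  by under eq_fun do rewrite big_nil; exact: Cinf_cst.
by under eq_fun do rewrite big_cons; case: (P i); [exact: (CinfM (cF i) IH)|exact: IH].
Qed.

Lemma pderD f g i x : Cinf f -> Cinf g ->
  pder [:: i] (fun x => f x + g x) x = pder [:: i] f x + pder [:: i] g x.
Proof.
move=> cf cg; have [] // := is_derive_add (Cinf_derive i x cf) (Cinf_derive i x cg).
Qed.

Lemma pderM f g i x : Cinf f -> Cinf g ->
  pder [:: i] (fun x => f x * g x) x = pder [:: i] f x * g x + f x * pder [:: i] g x.
Proof.
move=> cf cg; have [] // := is_derive_mul (Cinf_derive i x cf) (Cinf_derive i x cg).
Qed.

Lemma pder_aff f (c : R) b i x : Cinf f ->
  pder [:: i] (fun x => f (c *: x + b)) x = c * pder [:: i] f (c *: x + b).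
Proof. by move=> cf; have [] // := is_derive_aff (Cinf_derive i (c *: x + b) cf). Qed.

Lemma pderZ f (a : R) i x : Cinf f ->
  pder [:: i] (fun x => a * f x) x = a * pder [:: i] f x.
Proof.
move=> cf; rewrite pderM//; last exact: Cinf_cst.
by rewrite [X in X * _](_ : _ = 0) ?mul0r ?add0r//; exact: derive_cst.
Qed.

(** Schwarz's theorem by induction on the generators. With [B] empty all of them are explicit, so
    that mixed derivatives can be computed and compared. *)
Lemma flat_alg_sym f i j : smooth_alg (fun=> False) f ->
  pder [:: i; j] f = pder [:: j; i] f.
Proof.
have FP : forall g : 'rV[R]_n -> R, False -> Cinf g /\ forall i : 'I_n, False by move=> ? [].

have pcst (c : R) k : pder [:: k] (fun _ : 'rV[R]_n => c) = fun=> 0.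
  by apply/funext => x; exact: derive_cst.
elim => {f}.
- move=> c; rewrite -[LHS]/(pder [:: i] (pder [:: j] _)).
  by rewrite -[RHS]/(pder [:: j] (pder [:: i] _)) !pcst.
- move=> k; have h l : pder [:: l] (fun x : 'rV[R]_n => x ord0 k) = fun=> ('e_l : 'rV[R]_n) ord0 k.
    by apply/funext => x; have [] := is_derive_coord x ('e_l) k.
  by rewrite -[LHS]/(pder [:: i] (pder [:: j] _)) -[RHS]/(pder [:: j] (pder [:: i] _)) !h !pcst.
- by move=> ? ? ? [].
- move=> m s k c b s0; pose g m (x : 'rV[R]_n) := gexp m s (c * x ord0 k + b).
  have cg l : Cinf (g l).
    by apply: (smooth_alg_Cinf FP); exact: sa_flat.
  (* A partial derivative of [g m'] is a combination of [g m'.+1] and [g m'.+2] times a constant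
     that carries all the dependence on the direction; these constants commute. *)
  have h l m' : pder [:: l] (g m') = fun x => (c * ('e_l : 'rV[R]_n) ord0 k) *
      (- m'%:R * g m'.+1 x + s * g m'.+2 x).
    apply/funext => x; rewrite mulrC.
    have dl : is_derive x ('e_l : 'rV[R]_n) (fun y : 'rV[R]_n => c * y ord0 k + b)
        (c * ('e_l : 'rV[R]_n) ord0 k).
      apply: (is_derive_eq (is_derive_add (is_derive_mul (is_derive_cst c x _)
        (is_derive_coord x _ k)) (is_derive_cst b x _))).
      by rewrite mul0r add0r addr0.
    by have [] := @is_derive_comp1 _ _ (gexp m' s) (fun y : 'rV[R]_n => c * y ord0 k + b)
      x _ _ _ (is_derive_gexp m' (c * x ord0 k + b) s0) dl.
  rewrite -[LHS]/(pder [:: i] (pder [:: j] (g m))) -[RHS]/(pder [:: j] (pder [:: i] (g m))).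
  rewrite !h; apply/funext => x.
  have cc : Cinf (fun x => - m%:R * g m.+1 x + s * g m.+2 x).
    exact: (CinfD (CinfM (Cinf_cst _) (cg _)) (CinfM (Cinf_cst _) (cg _))).
  have cz a l : Cinf (fun x => a * g l x) by exact: (CinfM (Cinf_cst a) (cg l)).
  rewrite (pderZ _ i x cc) (pderZ _ j x cc) !(pderD _ _ (cz _ _) (cz _ _)).
  rewrite !(pderZ _ _ _ (cg _)) !h.
  by rewrite -!/(g _ _); ring.
- move=> f g sf hf sg hg; have cf := smooth_alg_Cinf FP sf; have cg := smooth_alg_Cinf FP sg.
  have h l : pder [:: l] (fun x => f x + g x) = fun x => pder [:: l] f x + pder [:: l] g x.
    by apply/funext => x; rewrite pderD.
  rewrite -[LHS]/(pder [:: i] (pder [:: j] _)) -[RHS]/(pder [:: j] (pder [:: i] _)) !h.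
  have cd k := Cinf_pder [:: k] cf; have ce k := Cinf_pder [:: k] cg.
  apply/funext => x; rewrite !(pderD _ _ (cd _) (ce _)).
  have hf' : pder [:: i] (pder [:: j] f) = pder [:: j] (pder [:: i] f) := hf.
  have hg' : pder [:: i] (pder [:: j] g) = pder [:: j] (pder [:: i] g) := hg.
  by rewrite hf' hg'.
- move=> f g sf hf sg hg; have cf := smooth_alg_Cinf FP sf; have cg := smooth_alg_Cinf FP sg.
  have h l : pder [:: l] (fun x => f x * g x) =
      fun x => pder [:: l] f x * g x + f x * pder [:: l] g x.
    by apply/funext => x; rewrite pderM.
  rewrite -[LHS]/(pder [:: i] (pder [:: j] _)) -[RHS]/(pder [:: j] (pder [:: i] _)) !h.
  have cd k := Cinf_pder [:: k] cf; have ce k := Cinf_pder [:: k] cg.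
  have cm k : Cinf (fun x => pder [:: k] f x * g x) := CinfM (cd k) cg.
  have cn k : Cinf (fun x => f x * pder [:: k] g x) := CinfM cf (ce k).
  apply/funext => x; rewrite (pderD _ _ (cm _) (cn _)) (pderD _ _ (cm _) (cn _)).
  have hf' : pder [:: i] (pder [:: j] f) = pder [:: j] (pder [:: i] f) := hf.
  have hg' : pder [:: i] (pder [:: j] g) = pder [:: j] (pder [:: i] g) := hg.
  rewrite !(pderM _ _ (cd _) cg) !(pderM _ _ cf (ce _)) hf' hg'.
  move: (pder [:: j] (pder [:: i] f)) (pder [:: j] (pder [:: i] g)) => u w.
  by move: (pder [:: i] f) (pder [:: j] f) (pder [:: i] g) (pder [:: j] g) => *; ring.
Qed.

End smooth_functions.

Section lipschitz_estimates.
Variables (R : realType) (n : nat).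
Implicit Types (f g : 'rV[R]_n -> R) (x y v : 'rV[R]_n).

Lemma MVT_line f x v (t : R) : (forall s : R, derivable f (s *: v + x) v) ->
  exists2 s : R, `|s| <= `|t| & f (t *: v + x) - f x = t * 'D_v f (s *: v + x).
Proof.
move=> df.
pose g (s : R) := f (s *: v + x); pose dg (s : R) := 'D_v f (s *: v + x).
have dgP s : is_derive s (1 : R) g (dg s).
  by apply: is_derive_line_at; exact: derivableP.
have cg A : {within A, continuous g}.
  by apply: continuous_subspaceT; exact: derivable_line_continuous.
have gx : f x = g 0 by rewrite /g scale0r add0r.
rewrite gx; have [t0|t0|->] := ltgtP t 0.
- have [s + sE] := MVT t0 (fun s _ => dgP s) (cg _).
  rewrite in_itv /= => /andP[ts s0]; exists s.
    by rewrite !ltr0_norm// lerN2 ltW.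
  by rewrite -[LHS]opprB sE sub0r mulrN opprK mulrC.
- have [s + sE] := MVT t0 (fun s _ => dgP s) (cg _).
  rewrite in_itv /= => /andP[s0 ts]; exists s.
    by rewrite !gtr0_norm// ltW.
  by rewrite sE subr0 mulrC.
- by exists 0; rewrite // subrr mul0r.
Qed.

Lemma bounded_pder_lipschitz f (M : R) : 0 <= M ->
  (forall i x, derivable f x 'e_i) -> (forall i x, `|pder [:: i] f x| <= M) ->
  forall x y, `|f x - f y| <= n%:R * M * `|x - y|.
Proof.
move=> M0 df fM x y.
(* [z k] takes its first k coordinates from x and the others from y. Consecutive points differ along
   one axis only, so that partial derivatives suffice. *)
pose z (k : nat) : 'rV[R]_n := \row_(j < n) if (j < k)%N then x ord0 j else y ord0 j.
have z0 : z 0%N = y by apply/rowP => j; rewrite mxE.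
have zn : z n = x by apply/rowP => j; rewrite mxE ltn_ord.
have step (k : 'I_n) : `|f (z k.+1) - f (z k)| <= M * `|x - y|.
  have -> : z k.+1 = (x - y) ord0 k *: 'e_k + z k.
    apply/rowP => j; rewrite !mxE eqxx /= ltnS leq_eqVlt.
    have [->|jk] := eqVneq j k; first by rewrite eqxx /= ltnn mulr1 subrK.
    by rewrite (_ : (j == k :> nat) = false) ?mulr0 ?add0r//; exact/negbTE.
  have [s _ ->] := MVT_line ((x - y) ord0 k) (fun s => df k (s *: 'e_k + z k)).
  by rewrite normrM mulrC ler_pM// ?fM// coord_norm_le.
rewrite -{1}zn -{1}z0 -(telescope_sumr (fun k => f (z k)))// big_mkord.
apply: (le_trans (ler_norm_sum _ _ _)).
rewrite -mulrA mulr_natl.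
rewrite [leRHS](_ : _ = \sum_(k < n) M * `|x - y|); last by rewrite sumr_const card_ord.
by apply: ler_sum => k _; exact: step.
Qed.

Definition test f := Cinf f /\ exists r : R, forall x, r <= `|x| -> f x = 0.

Lemma cinf_supp_bounded f : continuous f -> (exists r : R, forall x, r <= `|x| -> f x = 0) ->
  exists2 M, 0 <= M & forall x, `|f x| <= M.
Proof.
move=> cf [r fr]; pose K := [set x : 'rV[R]_n | `|x| <= `|r|].
have cK : compact K.
  apply: bounded_closed_compact.
    exists `|r|; split; first exact: num_real.
    by move=> M rM x /= xr; rewrite (le_trans xr)// ltW.
  apply: (closed_comp (f := fun x : 'rV[R]_n => `|x|) (D := [set t | t <= `|r|])).
    by move=> x _; exact: norm_continuous.
  exact: closed_le.
have K0 : K !=set0 by exists 0; rewrite /K /= normr0.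
have [c _ cM] : exists2 c, c \in K & forall t, t \in K -> `|f t| <= `|f c|.
  apply: (@EVT_max_rV _ _ (fun x => `|f x|)) => //.
  apply: continuous_subspaceT => x.
  by apply: (@continuous_comp _ _ _ f (fun t : R => `|t|)); [exact: cf|exact: norm_continuous].
exists `|f c| => // x; have [xK|xK] := pselect (K x); first by apply: cM; rewrite inE.
rewrite fr ?normr0//; move/negP: xK; rewrite /K /= -ltNge => /ltW.
exact/le_trans/ler_norm.
Qed.

Lemma test_bmeas f : test f -> bmeas f.
Proof.
move=> [cf [r fr]]; split.
  by apply: continuous_rV_measurable; exact: Cinf_continuous.
have [M M0 fM] := cinf_supp_bounded (Cinf_continuous cf) (ex_intro _ r fr).
by exists M, r.
Qed.

Lemma pder_eq0 f s (x : 'rV[R]_n) : (\forall y \near x, f y = 0) -> pder s f x = 0.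
Proof.
move=> f0; suff : \forall y \near x, pder s f y = 0 by exact: nbhs_singleton.
elim: s => [//|i s IH] /=.
near=> y; rewrite (@near_eq_derive _ _ _ _ (cst 0)) ?derive_cst//.
by near: y; apply: (near_join IH).
Unshelve. all: by end_near. Qed.

Lemma test_pder f s : test f -> test (pder s f).
Proof.
move=> [cf [r fr]]; split; first exact: Cinf_pder.
exists (r + 1) => x rx; apply: pder_eq0.
have /cvgr_ge h : `|y| @[y --> x] --> `|x| by exact: norm_continuous.
near=> y; apply: fr; near: y; apply: h.
by rewrite (lt_le_trans _ rx)// ltrDl.
Unshelve. all: by end_near. Qed.

Lemma test_lipschitz f : test f -> exists2 L, 0 <= L & forall x y, `|f x - f y| <= L * `|x - y|.
Proof.
move=> tf.
have /choice[M hM] : forall i : 'I_n, exists M, 0 <= M /\ forall x, `|pder [:: i] f x| <= M.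
  move=> i; have [cf sf] := test_pder [:: i] tf.
  have [M M0 hM] := cinf_supp_bounded (Cinf_continuous cf) sf.
  by exists M.
have M0 : 0 <= \sum_i M i by apply: sumr_ge0 => i _; exact: (hM i).1.
exists (n%:R * \sum_i M i); first by rewrite mulr_ge0.
apply: bounded_pder_lipschitz => //.
  by move=> i x; exact: (CinfP tf.1 [::]).2.
move=> i x; apply: (le_trans ((hM i).2 x)).
by rewrite (bigD1 i)//= lerDl; apply: sumr_ge0 => j _; exact: (hM j).1.
Qed.

Lemma testM f g : test f -> Cinf g -> test (fun x => f x * g x).
Proof.
move=> [cf [r fr]] cg; split; first exact: CinfM.
by exists r => x /fr ->; rewrite mul0r.
Qed.

Lemma test_aff f (c : R) (b : 'rV[R]_n) : c != 0 -> test f -> test (fun x => f (c *: x + b)).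
Proof.
move=> c0 [cf [r fr]]; split; first exact: Cinf_aff.
exists ((r + `|b|) / `|c|) => x; rewrite ler_pdivrMr ?normr_gt0// => h.
apply: fr; rewrite -lerBrDr in h; apply: (le_trans h).
by rewrite mulrC -normrZ lerBlDr -{1}(addrK b (c *: x)) ler_normB.
Qed.

End lipschitz_estimates.

Section integration_by_parts.
Variables (R : realType) (n : nat).
Implicit Types (f g : 'rV[R]_n -> R) (x y v : 'rV[R]_n).
Local Notation mu := (lebesgue_rV R n).
Local Notation Int f := (Rintegral mu setT f).

(* Translation invariance makes the integrals of the difference quotients of
   W vanish. *)
Lemma Int_derive_eq0 (W D : 'rV[R]_n -> R) (v : 'rV[R]_n) (L : R) N :
  bmeas W -> (forall x (t : R), `|W (t *: v + x) - W x| <= L * `|t|) ->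
  measurable_fun setT D -> measurable N -> mu N = 0%E ->
  (forall x, ~ N x -> is_derive x v W (D x)) -> Int D = 0.
Proof.
move=> bW WL mD mN N0 dW.
pose h (k : nat) : R := k.+1%:R^-1.
have h0 k : 0 < h k by rewrite invr_gt0.
have [mW [M [r [WM Wr]]]] := bW.
pose q k x := (h k)^-1 * (W (x + h k *: v) - W x).
have bs k : bmeas (fun x => W (x + h k *: v)) by exact: bmeas_shift.
have bq k : bmeas (q k) by apply: bmeasZ; exact: bmeasB.
have : Int (q k) @[k --> \oo] --> Int D.
  apply: (@Int_dominated _ _ q D N L (r + `|v|)) => //.
  - by move=> k; have [] := bq k.
  - move=> k x; rewrite /q normrM gtr0_norm ?invr_gt0// ler_pdivrMl// mulrC [x + _]addrC.
    by have := WL x (h k); rewrite (gtr0_norm (h0 k)).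
  - move=> k x rx; rewrite /q (Wr x); last by rewrite (le_trans _ rx)// lerDl.
    rewrite Wr ?subrr ?mulr0// -(lerD2r `|v|) (le_trans rx)//.
    rewrite -{1}(addrK (h k *: v) x) (le_trans (ler_normB _ _))// lerD2l normrZ.
    by rewrite (ger0_norm (ltW (h0 k))) mulrC ler_piMr// /h invf_le1// ler1n.
  - move=> x /dW [dWx <-]; rewrite /q.
    have hh : h k @[k --> \oo] --> 0^'.
      move=> A hA; have [m _ hm] := @cvg_harmonic R _ hA; exists m => // k mk.
      by apply: (hm k mk); rewrite /= gt_eqF.
    under eq_fun do rewrite [x + _]addrC.
    exact: (cvg_comp _ _ hh dWx).
rewrite (_ : (fun k => _) = fun=> 0).
  by move/cvg_lim => <-//; rewrite lim_cst.
apply/funext => k; rewrite /q IntZ; last exact: bmeasB.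
by rewrite IntB// Int_shift// subrr mulr0.
Qed.

End integration_by_parts.

Section test_functions.
Variables (R : realType) (n : nat).
Implicit Types (f : 'rV[R]_n -> R) (U K : set 'rV[R]_n).

Lemma compact_rV_bounded K : compact K -> exists r : R, forall x, K x -> `|x| < r.
Proof.
move=> /compact_bounded[M [_ h]]; exists (M + 1 + 1) => x Kx.
by rewrite (@le_lt_trans _ _ (M + 1))// ?ltrDl//; apply: (h (M + 1)); rewrite ?ltrDl.
Qed.

Lemma test_functionP U f : test_function U f <->
  Cinf f /\ exists K, [/\ compact K, K `<=` U & forall x, ~ K x -> f x = 0].
Proof. by rewrite /test_function; split=> -[/smooth_setTP ? ?]; split => //; apply/smooth_setTP. Qed.

Lemma test_function_test U f : test_function U f -> test f.
Proof.
move=> /test_functionP[cf [K [cK _ fK]]]; split => //.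
have [r Kr] := compact_rV_bounded cK; exists r => x rx; apply: fK => /Kr.
by rewrite ltNge rx.
Qed.

Lemma test_test_function f : test f -> test_function setT f.
Proof.
move=> [cf [r fr]]; apply/test_functionP; split => //.
exists [set x | `|x| <= `|r|]; split => //; last first.
  move=> x /= /negP; rewrite -ltNge => /ltW h; apply: fr.
  by apply: (le_trans _ h); exact: ler_norm.
apply: bounded_closed_compact.
  exists `|r|; split; first exact: num_real.
  by move=> M rM x /= xr; rewrite (le_trans xr)// ltW.
apply: (closed_comp (f := fun x : 'rV[R]_n => `|x|) (D := [set t | t <= `|r|])).
  by move=> x _; exact: norm_continuous.
exact: closed_le.
Qed.

Lemma test_functionM U f g : test_function U f -> Cinf g ->
  test_function U (fun x => f x * g x).
Proof.
move=> /test_functionP[cf [K [cK KU fK]]] cg; apply/test_functionP; split.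
  exact: CinfM.
by exists K; split => // x /fK ->; rewrite mul0r.
Qed.

Lemma test_function_pder U f s : test_function U f -> test_function U (pder s f).
Proof.
move=> /test_functionP[cf [K [cK KU fK]]]; apply/test_functionP; split.
  exact: Cinf_pder.
exists K; split => // x xK; apply: pder_eq0.
have oK : open (~` K) by apply: closed_openC; apply: compact_closed => //; exact: norm_hausdorff.
by apply: filterS (open_nbhs_nbhs (conj oK xK)) => y; exact: fK.
Qed.

End test_functions.

Section bumps.
Variables (R : realType) (n : nat).
Implicit Types (a b x y : 'rV[R]_n) (s : R).
Local Notation mu := (lebesgue_rV R n).
Local Notation Int f := (Rintegral mu setT f).

Definition box a b : set 'rV[R]_n := [set x | forall i, a ord0 i < x ord0 i < b ord0 i].
Definition cbox a b : set 'rV[R]_n := [set x | forall i, a ord0 i <= x ord0 i <= b ord0 i].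

Lemma box_cbox a b : box a b `<=` cbox a b.
Proof. by move=> x h i; have /andP[/ltW -> /ltW ->] := h i. Qed.

Lemma cbox_compact a b : compact (cbox a b).
Proof.
have := @rV_compact _ _ (fun i => `[a ord0 i, b ord0 i]%classic) (fun i => segment_compact (a:=a ord0 i) (b:=b ord0 i)).
by rewrite (_ : [set v : 'rV[R]_n | _] = cbox a b).
Qed.

(** Positive exactly on the open box, and convergent to its indicator function as s tends to 0; this
    is why the exponent s is a parameter. *)
Definition bump s a b x : R := \prod_(i < n)
  (gexp 0 s (1 * x ord0 i + - a ord0 i) * gexp 0 s (-1 * x ord0 i + b ord0 i)).

Lemma bump_flat s a b : 0 < s -> smooth_alg (fun=> False) (bump s a b).
Proof.
move=> s0; rewrite /bump.
elim: (index_enum _) => [|i r IH].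
  by under [X in smooth_alg _ X]eq_fun do rewrite big_nil; exact: sa_cst.
under [X in smooth_alg _ X]eq_fun do rewrite big_cons.
apply: sa_mul; last exact: IH.
by apply: sa_mul; exact: sa_flat.
Qed.

Lemma Cinf_flat (f : 'rV[R]_n -> R) : smooth_alg (fun=> False) f -> Cinf f.
Proof. by apply: smooth_alg_Cinf => ? []. Qed.

Lemma bump_ge0 s a b x : 0 <= bump s a b x.
Proof. by apply: prodr_ge0 => i _; rewrite mulr_ge0 ?gexp_ge0. Qed.

Lemma bump_gt0 s a b x : box a b x -> 0 < bump s a b x.
Proof.
move=> h; apply: prodr_gt0 => i _; have /andP[h1 h2] := h i.
by rewrite mulr_gt0// gexp_gt0// ?mul1r ?mulN1r ?subr_gt0// addrC subr_gt0.
Qed.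

Lemma bump_eq0 s a b x : ~ box a b x -> bump s a b x = 0.
Proof.
move=> h; have [i hi] : exists i, ~~ (a ord0 i < x ord0 i < b ord0 i).
  by apply/existsP; apply: contra_notT h => /existsPn h i; have := h i; rewrite negbK.
rewrite /bump (bigD1 i)//=; apply/eqP; rewrite mulf_eq0; apply/orP; left.
rewrite mulf_eq0; move: hi; rewrite negb_and -!leNgt => /orP[hi|hi]; apply/orP; [left|right].
  by rewrite gexp_eq0// mul1r subr_le0.
by rewrite gexp_eq0// mulN1r addrC subr_le0.
Qed.

Lemma bump_le1 s a b x : 0 < s -> bump s a b x <= 1.
Proof.
move=> s0; apply: prodr_ile1 => i _; rewrite mulr_ge0 ?gexp_ge0//=.
by apply: mulr_ile1; rewrite ?gexp_ge0 ?gexp0_le1.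
Qed.

Lemma bump_test_function s a b U : 0 < s -> cbox a b `<=` U -> test_function U (bump s a b).
Proof.
move=> s0 U0; apply/test_functionP; split; first exact/Cinf_flat/bump_flat.
exists (cbox a b); split => //; first exact: cbox_compact.
by move=> x h; apply: bump_eq0 => /box_cbox.
Qed.

Lemma bump_cvg a b x : bump (k.+1%:R^-1) a b x @[k --> \oo] --> (\1_(box a b) x : R).
Proof.
rewrite indicE; have [xB|xB] := pselect (box a b x); last first.
  by rewrite memNset//; under eq_fun do rewrite bump_eq0//; exact: cvg_cst.
rewrite mem_set//= /bump.
have h t : 0 < t -> gexp 0 k.+1%:R^-1 t @[k --> \oo] --> (1 : R).
  move=> t0; rewrite /gexp t0; under eq_fun do rewrite expr0 mul1r.
  have := @continuous_expR R 0; rewrite /continuous_at expR0 => ce.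
  have h0 : - (k.+1%:R^-1 / t) @[k --> \oo] --> - (0 * t^-1 : R).
    by apply: cvgN; apply: cvgMl; exact: cvg_harmonic.
  by rewrite mul0r oppr0 in h0; exact: (cvg_comp _ _ h0 ce).
rewrite (_ : true%:R = \prod_(i < n) (1 : R)); last by rewrite prodr_const expr1n.
apply: cvg_big => [|i _]; first exact: mul_continuous.
have /andP[h1 h2] := xB i; rewrite -[X in _ --> X]mulr1.
by apply: cvgM; apply: h; rewrite ?mul1r ?mulN1r ?subr_gt0// addrC subr_gt0.
Qed.

Lemma box_open a b : open (box a b).
Proof.
rewrite (_ : box a b = bump 1 a b @^-1` [set t : R | 0 < t]).
  apply: open_comp; last exact: open_gt.
  by move=> x _; apply: Cinf_continuous; exact/Cinf_flat/bump_flat.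
apply/seteqP; split => x /=; first exact: bump_gt0.
by apply: contraPP => /(bump_eq0 1) ->; rewrite ltxx.
Qed.

Lemma box_setI a b c d : box a b `&` box c d =
  box (\row_i Num.max (a ord0 i) (c ord0 i)) (\row_i Num.min (b ord0 i) (d ord0 i)).
Proof.
apply/seteqP; split => x /=.
  by move=> [h1 h2] i; have := h1 i; have := h2 i; rewrite !mxE gt_max lt_min => /andP[-> ->] /andP[-> ->].
move=> h; split => i; have := h i; rewrite !mxE gt_max lt_min.
  by move=> /andP[/andP[-> _] /andP[-> _]].
by move=> /andP[/andP[_ ->] /andP[_ ->]].
Qed.

(** A slab $p < x_i < q$ is the union of the boxes whose other sides are ]-k, k[, so that the
    coordinates are measurable for the sigma-algebra generated by boxes. *)
Lemma measurable_sub_boxes A : measurable A ->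
  <<s [set B | exists a b, B = box a b] >> A.
Proof.
set G := [set B | _].
have cG (i : 'I_n) : measurable_fun setT
    ((fun x : 'rV[R]_n => x ord0 i) : g_sigma_algebraType G -> R).
  apply: (measurability _ (RGenOpens.measurableE R)).
  move=> _ [_ [p [q ->]] <-]; rewrite setTI.
  rewrite (_ : _ @^-1` _ = \bigcup_k box (\row_j (if j == i then p else - k%:R))
                                     (\row_j (if j == i then q else k%:R))).
    apply: bigcupT_measurable => k; apply: sub_sigma_algebra.
    by eexists; eexists; reflexivity.
  apply/seteqP; split=> x /=; rewrite in_itv /=.
    move=> h; exists (Num.truncn `|x|).+1 => // j; rewrite !mxE; case: eqP => [->//|_].
    by rewrite -ltr_norml (le_lt_trans (coord_norm_le x j))// truncnS_gt.
  by move=> [k _ /(_ i)]; rewrite !mxE eqxx.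
move=> mA.
have sub : sigma_algebra [set: 'rV[R]_n] [set A | <<s G >> A] by exact: smallest_sigma_algebra.
apply: (@smallest_sub _ _ _ _ sub _ A mA) => B /=.
rewrite -bigcup_seq => -[i _ [C mC <-]].
by have := cG i measurableT C mC.
Qed.

End bumps.

(** * Mollification *)

Section fundamental_lemma.
Variables (R : realType) (n : nat).
Implicit Types (a b x y : 'rV[R]_n) (U A : set 'rV[R]_n).
Local Notation mu := (lebesgue_rV R n).

(** The pi-lambda theorem: boxes are stable under intersection, and the sets over which v integrates
    to 0 form a Dynkin system. The second hypothesis puts the whole space into this system. *)
Lemma integral_boxes_eq0 (v : 'rV[R]_n -> \bar R) : mu.-integrable setT v ->
  (exists a b, (\int[mu]_x v x = \int[mu]_(x in box a b) v x)%E) ->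
  (forall a b, (\int[mu]_(x in box a b) v x = 0)%E) ->
  forall A, measurable A -> (\int[mu]_(x in A) v x = 0)%E.
Proof.
move=> iv [a0 [b0 vT]] vB A mA.
have mv := measurable_int _ iv.
pose D : set (set 'rV[R]_n) := [set A | measurable A /\ (\int[mu]_(x in A) v x = 0)%E].
have dD : dynkin D.
  split.
  - by split; [exact: measurableT|rewrite vT vB].
  - move=> B [mB B0]; split; first exact: measurableC.
    have mvU : measurable_fun (B `|` ~` B) v by rewrite setUv.
    have dB : [disjoint B & ~` B] by rewrite disj_set2E setICr.
    have := integral_setU mu mB (measurableC mB) mvU dB.
    by rewrite setUv vT vB B0 add0e => <-.
  - move=> F tF DF; have mF k : measurable (F k) by have [] := DF k.
    split; first exact: bigcupT_measurable.
    rewrite integral_bigcup//; last first.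
      by apply: integrableS iv => //; exact: bigcupT_measurable.
    by rewrite eseries0// => k _ _; have [] := DF k.
pose G : set (set 'rV[R]_n) := [set B | exists a b, B = box a b].
have GI : setI_closed G.
  by move=> _ _ [a [b ->]] [c [d ->]]; rewrite box_setI; eexists; eexists; reflexivity.
have GD : G `<=` D.
  move=> _ [a [b ->]]; split; last exact: vB.
  by apply: open_rV_measurable; exact: box_open.
have [] // : D A.
apply: (@lambda_system_subset _ G GI setT D) => //; first exact/dynkin_lambda_system.
exact: measurable_sub_boxes.
Qed.

(* The bump functions with exponent 1/k converge to the indicator functions of
   boxes, and boxes generate the sigma-algebra. *)
Lemma test_orthogonal_ae0 U (w : 'rV[R]_n -> R) : open U -> measurable_fun U w ->
  (forall K, compact K -> K `<=` U -> (\int[mu]_(x in K) `|w x|%:E < +oo)%E) ->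
  (forall phi, test_function U phi -> \int[mu]_(x in U) (w x * phi x) = 0) ->
  exists N, [/\ measurable N, mu N = 0%E & forall x, U x -> ~ N x -> w x = 0].
Proof.
move=> oU mw wK wphi.
have mU := open_rV_measurable oU.
(* On a box whose closure lies in U the function w is integrable, and the bump functions of smaller
   boxes are admissible. *)
have local a b : cbox a b `<=` U -> mu.-negligible [set x | box a b x /\ w x != 0].
  move=> abU; have bU : box a b `<=` U by exact: subset_trans (@box_cbox _ _ a b) abU.
  have mb c d : measurable (@box R n c d) by apply: open_rV_measurable; exact: box_open.
  pose v := w \_ (box a b).
  have mv : measurable_fun setT v.
    by apply/(measurable_restrictT _ (mb a b)); exact: measurable_funS bU mw.
  have iv : mu.-integrable setT (EFin \o v).
    apply/integrableP; split; first exact/measurable_EFinP.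
    apply: le_lt_trans (wK _ (@cbox_compact _ _ a b) abU).
    rewrite [leRHS]integral_mkcond.
    have mc : measurable (cbox a b).
      apply: closed_rV_measurable; apply: compact_closed; last exact: cbox_compact.
      exact: norm_hausdorff.
    apply: ge0_le_integral => //=.
    - by apply/measurable_EFinP; apply: measurableT_comp => //; exact: normr_measurable.
    - apply/(measurable_restrictT _ mc); apply/measurable_EFinP.
      by apply: measurableT_comp; [exact: normr_measurable|exact: measurable_funS abU mw].
    - move=> x _; rewrite /v !patchE; case: ifPn => [|_]; last first.
        by rewrite normr0; case: ifP; rewrite // lee_fin.
      by rewrite inE => /box_cbox xc; rewrite mem_set// lee_fin.
  have vbox c d : (\int[mu]_(x in box c d) (v x)%:E = 0)%E.
    (* The part of [box c d] that meets the support of v is again a box, and its closure is still in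
       U. *)
    pose e := \row_i Num.max (a ord0 i) (c ord0 i); pose f := \row_i Num.min (b ord0 i) (d ord0 i).
    have ef : box e f = box a b `&` box c d by rewrite box_setI.
    have efU : cbox e f `<=` U.
      apply: subset_trans abU => x h i; have := h i.
      by rewrite !mxE ge_max le_min => /andP[/andP[-> _] /andP[-> _]].
    have mbump k : measurable_fun setT (bump (k.+1%:R^-1 : R) e f).
      apply: continuous_rV_measurable; apply: Cinf_continuous; apply: Cinf_flat.
      exact: bump_flat.
    have h : (\int[mu]_x (v x * bump k.+1%:R^-1 e f x)%:E)%E @[k --> \oo] -->
        (\int[mu]_x (v x * \1_(box e f) x)%:E)%E.
      have [|||||_ _ h] := @dominated_convergence _ _ _ mu setT measurableT
        (fun k x => (v x * bump (k.+1%:R^-1) e f x)%:E)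
        (fun x => (v x * \1_(box e f) x)%:E) (fun x => `|v x|%:E).
      - by move=> k; apply/measurable_EFinP; exact: measurable_funM.
      - by apply/measurable_EFinP; apply: measurable_funM => //; exact: measurable_indic.
      - apply: aeW => x _; apply: cvg_EFin; first exact: nearW.
        by apply: cvgMr; exact: bump_cvg.
      - exact: integrable_norm.
      - apply: aeW => x k _; rewrite lee_fin normrM ler_piMr//.
        by rewrite ger0_norm ?bump_ge0 ?bump_le1.
      - exact: h.
    transitivity (\int[mu]_x (v x * \1_(box e f) x)%:E)%E.
      rewrite integral_mkcond; apply: eq_integral => x _.
      rewrite patchE indicE ef /v patchE in_setI.
      by case: (x \in box a b); case: (x \in box c d); rewrite /= ?mulr1 ?mulr0 ?mul0r.
    move: h; rewrite (_ : (fun k => _) = fun=> 0%E); last first.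
      apply/funext => k; pose be := bump (k.+1%:R^-1 : R) e f.
      have tb : test_function U be by apply: bump_test_function.
      have vb x : v x * be x = ((fun x => w x * be x) \_ U) x.
        rewrite /v !patchE; have [xb|xb] := boolP (x \in box a b).
          by rewrite mem_set//; apply: bU; rewrite inE in xb.
        rewrite mul0r; case: ifP => // _; rewrite /be bump_eq0 ?mulr0// ef => -[xa _].
        by move: xb; rewrite mem_set.
      have ib : mu.-integrable setT (fun x => (v x * be x)%:E).
        apply: le_integrable iv => //.
          by apply/measurable_EFinP; apply: measurable_funM => //; exact: mbump.
        move=> x _; rewrite /= lee_fin normrM ler_piMr//.
        by rewrite ger0_norm ?bump_ge0 ?bump_le1.
      rewrite -[LHS]fineK; last exact: integrable_fin_num.
      have := wphi _ tb; rewrite Rintegral_mkcond /Rintegral => h; congr EFin.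
      by rewrite -[RHS]h; congr fine; apply: eq_integral => x _; rewrite vb.
    by move/cvg_lim => <-//; rewrite lim_cst.
  have v0 A : measurable A -> (\int[mu]_(x in A) (EFin \o v) x = 0)%E.
    apply: integral_boxes_eq0 => //.
    exists a, b; rewrite [RHS]integral_mkcond; apply: eq_integral => x _.
    by rewrite [RHS]patchE /= /v patchE; case: ifP.
  have [N [mN N0 hN]] : ae_eq mu setT (EFin \o v) (cst 0%E).
    apply: integral_ae_eq => // E _ mE; rewrite v0// integral0_eq//.
  exists N; split => // x [xb wx]; apply: hN => /= /(_ I).
  by rewrite /v patchE mem_set// => -[/eqP]; rewrite (negbTE wx).
(* Countably many rational cubes with closure in U cover U, so that the local null sets add up to
   one null set. *)
pose c (p : 'rV[rat]_n) : 'rV[R]_n := map_mx (@ratr R) p.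
pose lo (p : 'rV[rat]_n * nat) : 'rV[R]_n := \row_i (c p.1 ord0 i - p.2.+1%:R^-1).
pose hi (p : 'rV[rat]_n * nat) : 'rV[R]_n := \row_i (c p.1 ord0 i + p.2.+1%:R^-1).
pose F (m : nat) := if unpickle m is Some p then
   (if `[< cbox (lo p) (hi p) `<=` U >] then [set x | box (lo p) (hi p) x /\ w x != 0] else set0)
   else set0.
have [N [mN N0 hN]] : mu.-negligible (\bigcup_m F m).
  apply: negligible_bigcup => m; rewrite /F.
  case: unpickle => [p|]; last exact: negligible_set0.
  case: ifP => [/asboolP|_]; [exact: local|exact: negligible_set0].
exists N; split => // x Ux; apply: contra_notP => wx; apply: hN.
have [p [xp pU]] := rational_ball_cover oU Ux.
have r0 : 0 < p.2.+1%:R^-1 :> R by [].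
exists (pickle p) => //; rewrite /F pickleK asboolT.
  split; last exact/eqP.
  move=> i; have := (rV_norm_ltP _ r0).1 xp i; rewrite !mxE.
  by rewrite ltr_distl.
move=> y h; apply: pU; apply/(rV_norm_leP _ (ltW r0)) => i; have := h i; rewrite !mxE.
by rewrite ler_distl.
Qed.

End fundamental_lemma.

Lemma lipschitz_rV_continuous (R : realType) n (f : 'rV[R]_n -> R) (L : R) : 0 <= L ->
  (forall x z, `|f x - f z| <= L * `|x - z|) -> continuous f.
Proof.
move=> L0 fL x A /nbhs_ballP[e /= e0 he].
have L1 : 0 < L + 1 by rewrite ltr_wpDl.
apply/nbhs_ballP; exists (e / (L + 1)); first by rewrite /= divr_gt0.
move=> z; rewrite -ball_normE /= => xz; apply: he; rewrite -ball_normE /=.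
apply: (le_lt_trans (fL _ _)); apply: (@le_lt_trans _ _ ((L + 1) * `|x - z|)).
  by rewrite ler_wpM2r// lerDl.
by rewrite mulrC -ltr_pdivlMr.
Qed.

(** * Convolution and mollifiers *)

Section convolution.
Variables (R : realType) (n : nat).
Implicit Types (F G rho : 'rV[R]_n -> R) (x y : 'rV[R]_n) (U : set 'rV[R]_n).
Local Notation mu := (lebesgue_rV R n).
Local Notation Int f := (Rintegral mu setT f).

Lemma Int_mul_le F (g : 'rV[R]_n -> R) (e : R) : bmeas F -> measurable_fun setT g ->
  (forall y, `|g y| <= e) -> `|Int (fun y => F y * g y)| <= e * Int (fun y => `|F y|).
Proof.
move=> bF mg ge.
have bFg : bmeas (fun y => F y * g y) by apply: bmeasM => //; exists e.
apply: (le_trans (Int_norm bFg)); rewrite -IntZ; last exact: bmeas_norm.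
apply: le_Int; [exact: bmeas_norm|exact/bmeasZ/bmeas_norm|].
by move=> y; rewrite normrM mulrC ler_wpM2r.
Qed.

Definition conv F rho x := Int (fun y => F y * rho (x - y)).

Lemma refl_aff (h : 'rV[R]_n -> R) x : (fun y => h (x - y)) = (fun y => h (-1 *: y + x)).
Proof. by apply/funext => y; rewrite scaleN1r addrC. Qed.

Lemma test_refl rho x : test rho -> test (fun y => rho (x - y)).
Proof. by move=> tr; rewrite refl_aff; apply: test_aff => //; rewrite oppr_eq0 oner_eq0. Qed.

Lemma pder_refl rho i x y : test rho ->
  pder [:: i] (fun y => rho (x - y)) y = - pder [:: i] rho (x - y).
Proof. by move=> [cr _]; rewrite refl_aff pder_aff// mulN1r scaleN1r addrC. Qed.

Lemma conv_bmeas F rho x : bmeas F -> test rho -> bmeas (fun y => F y * rho (x - y)).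
Proof. by move=> bF tr; apply: bmeasMM => //; apply: test_bmeas; exact: test_refl. Qed.

Lemma conv_lipschitz F rho : bmeas F -> test rho ->
  exists2 L, 0 <= L & forall x z, `|conv F rho x - conv F rho z| <= L * `|x - z|.
Proof.
move=> bF tr; have [L L0 rL] := test_lipschitz tr.
exists (L * Int (fun y => `|F y|)).
  by rewrite mulr_ge0//; apply: Rintegral_ge0.
move=> x z; rewrite /conv -IntB; try exact: conv_bmeas.
under eq_Rintegral do rewrite -mulrBr.
rewrite mulrAC; apply: Int_mul_le => //.
  have [m1 _] := test_bmeas (test_refl x tr); have [m2 _] := test_bmeas (test_refl z tr).
  exact: measurable_funB.
move=> y; apply: (le_trans (rL _ _)).
by rewrite opprB addrA subrK.
Qed.

Lemma conv_derive F rho i x : bmeas F -> test rho ->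
  is_derive x 'e_i (conv F rho) (conv F (pder [:: i] rho) x).
Proof.
move=> bF tr; have tdr := test_pder [:: i] tr.
have [L L0 dL] := test_lipschitz tdr.
pose M := L * Int (fun y => `|F y|).
have M0 : 0 <= M by rewrite mulr_ge0//; apply: Rintegral_ge0.
pose q (h : R) := h^-1 *: ((conv F rho \o shift x) (h *: 'e_i) - conv F rho x).
(* By the mean value theorem the difference quotient of rho is its derivative at a point within
   [|h|], and that derivative is L-Lipschitz. *)
have qM h : h != 0 -> `|conv F (pder [:: i] rho) x - q h| <= M * `|h|.
  move=> h0.
  have -> : conv F (pder [:: i] rho) x - q h =
     Int (fun y => F y * (pder [:: i] rho (x - y) -
       h^-1 * (rho (h *: 'e_i + x - y) - rho (x - y)))).
    have b1 := conv_bmeas (h *: 'e_i + x) bF tr; have b2 := conv_bmeas x bF tr.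
    have b3 := conv_bmeas x bF tdr.
    rewrite /q /conv /= -[_ *: _]/(_ * _) -IntB// -IntZ; last exact: bmeasB.
    rewrite -IntB//; last by apply: bmeasZ; exact: bmeasB.
    by apply: eq_Rintegral => y _; ring.
  rewrite /M mulrAC; apply: Int_mul_le => //.
    have [m1 _] := test_bmeas (test_refl x tdr); have [m2 _] := test_bmeas (test_refl x tr).
    have [m3 _] := test_bmeas (test_refl (h *: 'e_i + x) tr).
    by apply: measurable_funB => //; apply: measurable_funM => //; exact: measurable_funB.
  move=> y.
  have [s sh] := MVT_line h (fun s => (CinfP tr.1 [::]).2 i (s *: 'e_i + (x - y))).
  rewrite /= addrA => ->; rewrite mulrA mulVf// mul1r.
  apply: (le_trans (dL _ _)); rewrite ler_wpM2l//.
  rewrite opprD addrCA subrr addr0 normrN normrZ.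
  rewrite (le_trans _ sh)// ler_piMr//; apply/rV_norm_leP => // j.
  by rewrite mxE; case: (_ && _); rewrite ?normr1 ?normr0.
have qc : q h @[h --> 0^'] --> conv F (pder [:: i] rho) x.
  apply/cvgrPdist_le => e e0.
  have M1 : 0 < M + 1 by rewrite ltr_wpDl.
  exists (e / (M + 1)); first by rewrite /= divr_gt0.
  move=> h; rewrite /ball_ /= sub0r normrN => he h0.
  apply: (le_trans (qM h h0)); apply: (@le_trans _ _ ((M + 1) * `|h|)).
    by rewrite ler_wpM2r// lerDl.
  by rewrite mulrC -ler_pdivlMr// ltW.
by apply: DeriveDef; [apply/cvg_ex; eexists; exact: qc|exact/cvg_lim].
Qed.

Lemma conv_Cinf F rho : bmeas F -> test rho -> Cinf (conv F rho).
Proof.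
move=> bF tr; apply: (@Cinf_coind _ _ (fun f => exists2 r, test r & f = conv F r)).
  move=> _ [r tr' ->]; split.
    by have [L L0 cL] := conv_lipschitz bF tr'; exact: lipschitz_rV_continuous cL.
  move=> i; exists (conv F (pder [:: i] r)); split.
    by exists (pder [:: i] r) => //; exact: test_pder.
  by move=> x; exact: conv_derive.
by exists rho.
Qed.

Lemma pder_conv F rho s : bmeas F -> test rho -> pder s (conv F rho) = conv F (pder s rho).
Proof.
move=> bF tr; elim: s => [//|i s IH].
rewrite -[LHS]/(pder [:: i] (pder s _)) IH; apply/funext => x.
by have [] := conv_derive i x bF (test_pder s tr).
Qed.

(** G is the weak derivative of F along the i-th axis in U. Both are functions on the whole space,
    so that all integrals are taken there and only the test functions see U. *)
Definition wder_on U F i G := forall z, test_function U z ->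
  Int (fun y => F y * pder [:: i] z y) = - Int (fun y => G y * z y).

(** As a function of y, the kernel rho(x - y) is itself a test function of U; its derivative in y
    brings the sign that cancels the one of integration by parts. *)
Lemma conv_wder U F G rho i x : bmeas F -> bmeas G -> wder_on U F i G -> test rho ->
  (exists K, [/\ compact K, K `<=` U & forall y, ~ K y -> rho (x - y) = 0]) ->
  conv F (pder [:: i] rho) x = conv G rho x.
Proof.
move=> bF bG FG tr xU.
have tz : test_function U (fun y => rho (x - y)).
  by apply/test_functionP; split => //; have [] := test_refl x tr.
have := FG _ tz; under eq_Rintegral do rewrite pder_refl// mulrN.
rewrite IntN; last by apply: conv_bmeas => //; exact: test_pder.
by move/oppr_inj.
Qed.

Definition mol (d : R) : 'rV[R]_n -> R :=
  let b := bump 1 (const_mx (- d)) (const_mx d) in fun x => (Int b)^-1 * b x.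

Section mollifier.
Variable d : R.
Hypothesis d0 : 0 < d.
Let b := @bump R n 1 (const_mx (- d)) (const_mx d).

Let boxE x : box (const_mx (- d)) (const_mx d) x <-> `|x| < d.
Proof.
split=> [h|/(rV_norm_ltP _ d0) h i]; last first.
  by have := h i; rewrite !mxE ltr_norml.
by apply/rV_norm_ltP => // i; have := h i; rewrite !mxE ltr_norml.
Qed.

Let b_eq0 x : d <= `|x| -> b x = 0.
Proof. by move=> dx; apply: bump_eq0; rewrite boxE; apply/negP; rewrite -leNgt. Qed.

Let b_test : test b.
Proof. by split; [exact/Cinf_flat/bump_flat|exists d]. Qed.

Let b_gt0 : 0 < Int b.
Proof.
apply: (@Int_gt0 _ _ b 0); first exact: test_bmeas.
- by move=> x; exact: bump_ge0.
- by apply: bump_gt0; rewrite boxE normr0.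
- exact: (Cinf_continuous b_test.1).
Qed.

Lemma mol_flat : smooth_alg (fun=> False) (mol d).
Proof. by apply: sa_mul; [exact: sa_cst|exact: bump_flat]. Qed.

Lemma mol_eq0 x : d <= `|x| -> mol d x = 0.
Proof. by move=> dx; rewrite /mol -/b b_eq0// mulr0. Qed.

Lemma mol_test : test (mol d).
Proof. by split; [exact/Cinf_flat/mol_flat|exists d => x; exact: mol_eq0]. Qed.

Lemma mol_ge0 x : 0 <= mol d x.
Proof. by rewrite mulr_ge0 ?bump_ge0// invr_ge0 ltW. Qed.

Lemma mol_even x : mol d (- x) = mol d x.
Proof.
rewrite /mol /bump; congr (_ * _); apply: eq_bigr => i _; rewrite !mxE opprK.
by rewrite mulrC !mulrN !mulNr !opprK.
Qed.

Lemma Int_mol x : Int (fun y => mol d (x - y)) = 1.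
Proof.
under eq_Rintegral do rewrite -mol_even opprB.
rewrite Int_shift; last exact/test_bmeas/mol_test.
by rewrite /mol -/b IntZ ?mulVf ?gt_eqF//; exact: test_bmeas.
Qed.

(** The convolution is an average of F over the cube of radius d about x, the kernel being
    nonnegative with integral 1. *)
Lemma conv_mol_close F x (c e : R) : bmeas F ->
  (forall y, `|y - x| < d -> `|F y - c| <= e) -> `|conv F (mol d) x - c| <= e.
Proof.
move=> bF Fc; have tx := test_refl x mol_test; have bm := test_bmeas tx.
have -> : conv F (mol d) x - c = Int (fun y => (F y - c) * mol d (x - y)).
  rewrite -[X in _ - X]mulr1 -(Int_mol x) /conv -IntZ// -IntB.
  - by apply: eq_Rintegral => y _; rewrite mulrBl.
  - by apply: conv_bmeas => //; exact: mol_test.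
  - exact: bmeasZ.
have bi : bmeas (fun y => (F y - c) * mol d (x - y)).
  rewrite (_ : (fun y => _) = (fun y => F y * mol d (x - y) - c * mol d (x - y))).
    by apply: bmeasB; [apply: conv_bmeas => //; exact: mol_test|exact: bmeasZ].
  by apply/funext => y; rewrite mulrBl.
apply: (le_trans (Int_norm bi)).
rewrite -[leRHS]mulr1 -(Int_mol x) -IntZ//.
apply: le_Int; [exact: bmeas_norm|exact: bmeasZ|move=> y].
rewrite normrM [X in _ * X]ger0_norm ?mol_ge0//.
have [xy|xy] := ltP `|y - x| d; first by rewrite ler_wpM2r ?mol_ge0// Fc.
by rewrite mol_eq0 ?mulr0// distrC.
Qed.

Lemma conv_mol_bound F x (M : R) : bmeas F -> (forall y, `|F y| <= M) ->
  `|conv F (mol d) x| <= M.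
Proof.
move=> bF FM; rewrite -[X in `|X|]subr0; apply: conv_mol_close => // y _.
by rewrite subr0.
Qed.

End mollifier.

(* Points of continuity of F are recovered in the limit. *)
Lemma conv_mol_cvg F x (d : nat -> R) (z : nat -> 'rV[R]_n) : bmeas F ->
  (forall k, 0 < d k) -> d @ \oo --> 0 -> z @ \oo --> x -> {for x, continuous F} ->
  conv F (mol (d k)) (z k) @[k --> \oo] --> F x.
Proof.
move=> bF d0 dc zx cF; apply/cvgrPdist_le => e e0.
have /nbhs_ballP[r /= r0 hr] : \forall y \near x, `|F x - F y| <= e.
  by move/cvgrPdist_le : cF; apply.
near=> k; rewrite distrC; apply: conv_mol_close => // y yz.
rewrite distrC; apply: hr; rewrite ball_rVE /=.
rewrite -(subrK (z k) y) -addrA (le_lt_trans (ler_normD _ _))// (splitr r) ltrD//.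
  apply: (lt_trans yz); near: k.
  by apply: (cvgr_lt _ dc); rewrite divr_gt0.
rewrite distrC; near: k.
by move/cvgrPdist_lt : zx; apply; rewrite divr_gt0.
Unshelve. all: by end_near. Qed.

(** The symmetry of third derivatives that the Piola identity asks of mollified functions. *)
Lemma bump_sym (d : R) s i j : 0 < d -> pder [:: i, j & s] (mol d) = pder [:: j, i & s] (mol d).
Proof.
move=> d0; apply: flat_alg_sym.
elim: s => [|k s IH]; first exact: mol_flat.
by apply: smooth_alg_pder IH => ? [].
Qed.

End convolution.

(** * Lipschitz functions glued from finitely many closed pieces *)

Section gluing.
Variable R : realType.

(** Induction on the number of pieces. Let c be the last point of [a, b] in a piece that contains a.
    The other pieces cover ]c, b] and, their union being closed, also c; so the estimate on [a, c]
    comes from one piece and that on [c, b] from the induction hypothesis. *)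
Lemma lipschitz_glue_itv (I : choiceType) (g : R -> R) (L : R) (F : I -> set R) :
  (forall i, closed (F i)) ->
  (forall i x y, F i x -> F i y -> `|g x - g y| <= L * `|x - y|) ->
  forall (s : seq I) (a b : R), a <= b ->
  (forall x, a <= x <= b -> exists2 i, i \in s & F i x) ->
  `|g a - g b| <= L * (b - a).
Proof.
move=> cF FL s; move: {2}(size s) (leqnn (size s)) => m; elim: m s => [|m IH] s.
  rewrite leqn0 => /nilP -> a b ab /(_ a); rewrite lexx ab => /(_ isT)[] //.
move=> sm a b ab cov.
have [|i is_ Fa] := cov a; first by rewrite lexx.
pose S := F i `&` `[a, b]%classic.
have Sa : S a by split => //=; rewrite in_itv /= lexx.
have supS : has_sup S.
  split; first by exists a.
  by exists b => x [_ /=]; rewrite in_itv /= => /andP[].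
have cS : closed S by apply: closedI => //; exact: interval_closed.
pose c := sup S.
have Sc : S c by apply: cS; apply: closure_sup; [exact: supS.1|exact: supS.2].
have [Fc] := Sc; rewrite /= in_itv /= => /andP[ac cb].
have Lac : `|g a - g c| <= L * (c - a).
  by rewrite (le_trans (FL i _ _ Fa Fc))// distrC ger0_norm// subr_ge0.
have [cbE|cneb] := eqVneq c b; first by rewrite -cbE.
have cltb : c < b by rewrite lt_neqAle cneb.
have cov' x : c < x <= b -> exists2 j, j \in rem i s & F j x.
  move=> /andP[cx xb].
  have [|j js Fx] := cov x; first by rewrite (le_trans ac (ltW cx)).
  have [ji|ji] := eqVneq j i.
    have : x <= c.
      apply: ub_le_sup; first exact: (supS.2).
      by rewrite ji in Fx; split => //=; rewrite in_itv /= xb (le_trans ac (ltW cx)).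
    by rewrite leNgt cx.
  by exists j => //; move: js; rewrite (perm_mem (perm_to_rem is_)) inE (negbTE ji).
pose Fs := \bigcup_(j in [set` rem i s]) F j.
have cFs : closed Fs by rewrite /Fs bigcup_seq; apply: closed_bigsetU => j _; exact: cF.
have Fsc : Fs c.
  apply: cFs; move=> B /nbhs_ballP[e /= e0 eB].
  pose x := Num.min b (c + e / 2).
  have cx : c < x by rewrite lt_min cltb ltrDl divr_gt0.
  have xb : x <= b by rewrite ge_min lexx.
  have [|j js Fx] := cov' x; first by rewrite cx.
  exists x; split; first by exists j.
  apply: eB; rewrite /ball /= ltr_distlC.
  have xe : x <= c + e / 2 by rewrite ge_min lexx orbT.
  apply/andP; split; first by rewrite (lt_trans _ cx)// ltrBlDr ltrDl.
  by rewrite (le_lt_trans xe)// ltrD2l ltr_pdivrMr// mulr_natr mulr2n ltrDl.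
have cov'' x : c <= x <= b -> exists2 j, j \in rem i s & F j x.
  move=> /andP[]; rewrite le_eqVlt => /orP[/eqP <- _|cx xb]; last by apply: cov'; rewrite cx.
  by have [j js Fj] := Fsc; exists j.
have sz : (size (rem i s) <= m)%N.
  by rewrite size_rem// -ltnS prednK//; case: (s) is_.
have Lcb := IH _ sz _ _ (ltW cltb) cov''.
rewrite -(subrKA (g c) (g a)) (le_trans (ler_normD _ _))//.
rewrite (le_trans (lerD Lac Lcb))// -mulrDr.
by rewrite addrC subrKA.
Qed.

(** Restricted to a line this is the previous lemma. The constant does not grow with the number of
    pieces, which [energy_eq0] exploits with L = 0. *)
Lemma lipschitz_glue (V : normedModType R) (I : finType) (W : V -> R) (F : I -> set V) (v : V) (L : R) :
  (forall i, closed (F i)) -> (forall x, exists i, F i x) ->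
  (forall i x (t : R), F i x -> F i (t *: v + x) -> `|W (t *: v + x) - W x| <= L * `|t|) ->
  forall x (t : R), `|W (t *: v + x) - W x| <= L * `|t|.
Proof.
move=> cF cov FL.
have pos x (t : R) : 0 <= t -> `|W (t *: v + x) - W x| <= L * t.
  move=> t0; pose g (s : R) := W (s *: v + x).
  pose G i : set R := (fun s => s *: v + x) @^-1` F i.
  have cl : continuous (fun s : R => s *: v + x).
    by move=> s; apply: cvgD; [exact: scalel_continuous|exact: cvg_cst].
  have cG i : closed (G i) by apply: closed_comp => // s _; exact: cl.
  have GL i s u : G i s -> G i u -> `|g s - g u| <= L * `|s - u|.
    move=> Gs Gu; have E : s *: v + x = (s - u) *: v + (u *: v + x).
      by rewrite addrA -scalerDl subrK.
    by rewrite /g E; apply: (FL i) => //; rewrite -E.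
  have := lipschitz_glue_itv cG GL (s := enum I) t0.
  rewrite /g scale0r add0r subr0 distrC; apply => s _.
  by have [i Fi] := cov (s *: v + x); exists i; rewrite ?mem_enum.
move=> x t; have [t0|/ltW t0] := leP 0 t;   first by rewrite (ger0_norm t0); exact: pos.
have := pos (t *: v + x) (- t); rewrite oppr_ge0 => /(_ t0).
by rewrite addrA -scalerDl addNr scale0r add0r distrC (ler0_norm t0).
Qed.

End gluing.

Section glued_integration_by_parts.
Variables (R : realType) (n : nat).
Local Notation mu := (lebesgue_rV R n).
Local Notation Int f := (Rintegral mu setT f).

(* c coincides on finitely many closed sets with smooth functions q; no
   boundary terms appear because c * z is Lipschitz. *)
Lemma glued_wder (I : finType) (F : I -> set 'rV[R]_n) (q : I -> 'rV[R]_n -> R)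
    (c dc z : 'rV[R]_n -> R) (k : 'I_n) N :
  bmeas c -> bmeas dc -> test z -> (forall i, Cinf (q i)) ->
  (forall i, closed (F i)) -> (forall x, exists i, F i x) ->
  (forall i x, F i x -> c x * z x = q i x * z x) ->
  measurable N -> mu N = 0%E -> (forall x, ~ N x -> is_derive x 'e_k c (dc x)) ->
  Int (fun y => c y * pder [:: k] z y) = - Int (fun y => dc y * z y).
Proof.
move=> bc bdc tz cq cF cov cE mN N0 dN.
have bz := test_bmeas tz; have bdz := test_bmeas (test_pder [:: k] tz).
have /choice[L hL] : forall i : I, exists L, 0 <= L /\ forall x y,
    `|q i x * z x - q i y * z y| <= L * `|x - y|.
  move=> i; have tqz : test (fun x => q i x * z x).
    by under eq_fun do rewrite mulrC; exact: testM.
  by have [L L0 h] := test_lipschitz tqz; exists L.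
pose D y := dc y * z y + c y * pder [:: k] z y.
have bD1 : bmeas (fun y => dc y * z y) by exact: bmeasMM.
have bD2 : bmeas (fun y => c y * pder [:: k] z y) by exact: bmeasMM.
have D0 : Int D = 0.
  apply: (@Int_derive_eq0 _ _ (fun y => c y * z y) D 'e_k (\sum_i L i) N) => //.
  - exact: bmeasMM.
  - apply: (@lipschitz_glue _ _ I _ F) => // i x t Fx Fy.
    rewrite (cE i)// (cE i)//; apply: (le_trans ((hL i).2 _ _)).
    rewrite addrK normrZ; apply: ler_pM => //.
    - exact: (hL i).1.
    - by rewrite (bigD1 i)//= lerDl; apply: sumr_ge0 => j _; exact: (hL j).1.
    - rewrite ler_piMr//; apply/rV_norm_leP => // j.
      by rewrite mxE; case: (_ && _); rewrite ?normr1 ?normr0.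
  - by have [] := bmeasD bD1 bD2.
  - by move=> x Nx; apply: is_derive_mul; [exact: dN|exact: Cinf_derive tz.1].
by apply/eqP; rewrite -addr_eq0 addrC -IntD//; apply/eqP.
Qed.

End glued_integration_by_parts.

Section flat_functions_along_lines.
Variables (R : realType) (n : nat).
Implicit Types (f : 'rV[R]_n -> R) (x v : 'rV[R]_n).
Local Notation flat := (@smooth_alg R n (fun=> False)).

(** The chain rule in an arbitrary direction, by induction on the generators; the polynomials on the
    elements are covered through [is_poly_flat]. *)
Lemma flat_derive_dir f x v : flat f ->
  is_derive x v f (\sum_i v ord0 i * pder [:: i] f x).
Proof.
move=> sf; elim: sf x v => {f}.
- move=> c x v; rewrite big1; first exact: is_derive_cst.
  by move=> i _; rewrite [pder _ _ _](_ : _ = 0) ?mulr0//; exact: derive_cst.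
- move=> i x v; apply: (is_derive_eq (is_derive_coord x v i)).
  rewrite (bigD1 i)//= big1 ?addr0.
    by have [_ ->] := is_derive_coord x ('e_i : 'rV[R]_n) i; rewrite mxE !eqxx mulr1.
  move=> j ji; have [_ ->] := is_derive_coord x ('e_j : 'rV[R]_n) i.
  by rewrite mxE eqxx /= eq_sym (negbTE ji) mulr0.
- by move=> ? ? ? [].
- move=> m s i c b s0 x v.
  have dl w : is_derive x w (fun y : 'rV[R]_n => c * y ord0 i + b) (c * w ord0 i).
    apply: (is_derive_eq (is_derive_add (is_derive_mul (is_derive_cst c x w)
      (is_derive_coord x w i)) (is_derive_cst b x w))).
    by rewrite mul0r add0r addr0.
  have dg w := @is_derive_comp1 _ _ (gexp m s) (fun y : 'rV[R]_n => c * y ord0 i + b)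
      x _ _ _ (is_derive_gexp m (c * x ord0 i + b) s0) (dl w).
  apply: (is_derive_eq (dg v)).
  rewrite (eq_bigr (fun j => v ord0 j * ((- m%:R * gexp m.+1 s (c * x ord0 i + b) +
        s * gexp m.+2 s (c * x ord0 i + b)) * (c * ('e_j : 'rV[R]_n) ord0 i)))); last first.
    by move=> j _; congr (_ * _); have [_ <-] := dg ('e_j : 'rV[R]_n).
  rewrite (bigD1 i)//= big1 ?addr0.
    by rewrite mxE !eqxx /= mulr1; ring.
  by move=> j ji; rewrite mxE eqxx /= eq_sym (negbTE ji) !mulr0.
- move=> f g sf hf sg hg x v.
  apply: (is_derive_eq (is_derive_add (hf x v) (hg x v))).
  rewrite -big_split; apply: eq_bigr => i _.
  rewrite -[RHS]/(v ord0 i * pder [:: i] (fun x => f x + g x) x).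
  by rewrite pderD ?mulrDr//; exact: Cinf_flat.
- move=> f g sf hf sg hg x v.
  apply: (is_derive_eq (is_derive_mul (hf x v) (hg x v))).
  rewrite mulr_suml mulr_sumr -big_split; apply: eq_bigr => i _.
  rewrite -[RHS]/(v ord0 i * pder [:: i] (fun x => f x * g x) x).
  rewrite -[LHS]/(v ord0 i * pder [:: i] f x * g x + f x * (v ord0 i * pder [:: i] g x)).
  by rewrite pderM; [ring|exact: Cinf_flat|exact: Cinf_flat].
Qed.

Lemma flat_pder f s : flat f -> flat (pder s f).
Proof.
by move=> sf; elim: s => [//|i s IH]; apply: smooth_alg_pder IH => ? [].
Qed.

Lemma is_poly_flat d (p : 'rV[R]_n -> R) : is_poly d p -> flat p.
Proof.
have fX (i : 'I_n) (m : nat) : flat (fun x => x ord0 i ^+ m).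
  elim: m => [|m IH]; first by under [X in smooth_alg _ X]eq_fun do rewrite expr0; exact: sa_cst.
  under [X in smooth_alg _ X]eq_fun do rewrite exprS.
  by apply: sa_mul => //; exact: sa_coord.
have fprod (r : seq 'I_n) (a : mindex n d) : flat (fun x => \prod_(i <- r) x ord0 i ^+ a i).
  elim: r => [|i r IH].
    by under [X in smooth_alg _ X]eq_fun do rewrite big_nil; exact: sa_cst.
  under [X in smooth_alg _ X]eq_fun do rewrite big_cons.
  by apply: sa_mul.
move=> [c pE]; rewrite (_ : p = fun x => \sum_(a : mindex n d | (mdeg a <= d)%N)
    c a * \prod_i x ord0 i ^+ a i); last exact/funext.
elim: (index_enum _) => [|a r IH].
  by under [X in smooth_alg _ X]eq_fun do rewrite big_nil; exact: sa_cst.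
under [X in smooth_alg _ X]eq_fun do rewrite big_cons.
case: (_ <= _)%N; last exact: IH.
by apply: sa_add => //; apply: sa_mul => //; exact: sa_cst.
Qed.

Lemma Cinf_bounded_on f (r : R) : Cinf f ->
  exists2 M, 0 <= M & forall x, `|x| <= r -> `|f x| <= M.
Proof.
move=> cf; have [r0|r0] := leP 0 r; last first.
  by exists 0 => // x /le_lt_trans/(_ r0); rewrite ltNge normr_ge0.
pose K := [set x : 'rV[R]_n | `|x| <= r].
have cK : compact K.
  apply: bounded_closed_compact.
    exists r; split; first exact: num_real.
    by move=> M rM x /= xr; rewrite (le_trans xr)// ltW.
  apply: (closed_comp (f := fun x : 'rV[R]_n => `|x|) (D := [set t | t <= r])).
    by move=> x _; exact: norm_continuous.
  exact: closed_le.
have K0 : K !=set0 by exists 0; rewrite /K /= normr0.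
have [c _ cM] : exists2 c, c \in K & forall t, t \in K -> `|f t| <= `|f c|.
  apply: (@EVT_max_rV _ _ (fun x => `|f x|)) => //.
  apply: continuous_subspaceT => x.
  by apply: (@continuous_comp _ _ _ f (fun t : R => `|t|));
    [exact: Cinf_continuous|exact: norm_continuous].
by exists `|f c| => // x xK; apply: cM; rewrite inE.
Qed.

End flat_functions_along_lines.

(** * Triangulations and piecewise polynomials *)

Section simplices.
Variables (R : realType) (n : nat).
Variable A : 'M[R]_(n.+1, n).
Local Notation mu := (lebesgue_rV R n).
Local Notation flat := (@smooth_alg R n (fun=> False)).

(** A row of barycentric coordinates times this matrix is (1, x); affine independence of the
    vertices makes it invertible. *)
Definition bary_mx : 'M[R]_n.+1 := row_mx (const_mx 1 : 'cV[R]_n.+1) A.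

(* Barycentric coordinates with respect to the rows of A. *)
Definition bary (x : 'rV[R]_n) : 'rV[R]_n.+1 := rV_cons (1 : measurableTypeR R, x) *m invmx bary_mx.

Lemma baryE x a : bary x ord0 a =
  invmx bary_mx ord0 a + \sum_j x ord0 j * invmx bary_mx (lift ord0 j) a.
Proof.
rewrite mxE big_ord_recl rV_cons_ord0 mul1r; congr (_ + _).
by apply: eq_bigr => j _; rewrite rV_cons_lift.
Qed.

Lemma bary_flat a : flat (fun x => bary x ord0 a).
Proof.
rewrite [X in smooth_alg _ X](_ : _ = fun x : 'rV[R]_n => invmx bary_mx ord0 a +
    \sum_j x ord0 j * invmx bary_mx (lift ord0 j) a); last by apply/funext => x; rewrite baryE.
apply: sa_add; first exact: sa_cst.
elim: (index_enum _) => [|j r IH].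
  by under [X in smooth_alg _ X]eq_fun do rewrite big_nil; exact: sa_cst.
under [X in smooth_alg _ X]eq_fun do rewrite big_cons.
by apply: sa_add => //; apply: sa_mul; [exact: sa_coord|exact: sa_cst].
Qed.

Lemma bary_continuous a : continuous (fun x => bary x ord0 a).
Proof. exact/Cinf_continuous/Cinf_flat/bary_flat. Qed.

Hypothesis freeA : row_free (row_mx (const_mx 1 : 'cV[R]_n.+1) A).

Let unitA : bary_mx \in unitmx.
Proof. by rewrite -row_free_unit. Qed.

Lemma bary_unique (lam : 'rV[R]_n.+1) x : \sum_a lam ord0 a = 1 -> x = lam *m A -> lam = bary x.
Proof.
move=> s1 xE; rewrite /bary (_ : rV_cons _ = lam *m bary_mx) ?mulmxK//.
have -> : lam *m bary_mx = (row_mx (lam *m const_mx 1 : 'M[R]_(1, 1)) (lam *m A) : 'rV_(1 + n)).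
  exact: (@mul_mx_row _ 1 n.+1 1 n lam (const_mx 1) A).
rewrite -xE; suff -> : lam *m const_mx 1 = 1%:M :> 'M[R]_(1, 1) by [].
apply/matrixP => i j; rewrite !ord1 !mxE eqxx mulr1n -[RHS]s1.
by apply: eq_bigr => a _; rewrite mxE mulr1.
Qed.

Lemma barycentric x : \sum_a bary x ord0 a = 1 /\ bary x *m A = x.
Proof.
have : bary x *m bary_mx = rV_cons (1 : measurableTypeR R, x) by rewrite mulmxKV.
have -> : bary x *m bary_mx =
    (row_mx (bary x *m const_mx 1 : 'M[R]_(1, 1)) (bary x *m A) : 'rV_(1 + n)).
  exact: (@mul_mx_row _ 1 n.+1 1 n (bary x) (const_mx 1) A).
move=> /(@eq_row_mx _ 1 1 n _ _ (1%:M) x)[h ->]; split => //.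
move/matrixP : h => /(_ ord0 ord0); rewrite !mxE eqxx mulr1n => <-.
by apply: eq_bigr => a _; rewrite [const_mx _ _ _]mxE mulr1.
Qed.

Lemma hullE : hull A setT = [set x | forall a, 0 <= bary x ord0 a].
Proof.
apply/seteqP; split=> x /=.
  by move=> [lam [l0 s1 _ xE]] a; rewrite -(bary_unique s1 xE).
move=> h; have [s1 xE] := barycentric x.
by exists (bary x); split => // a /(_ I).
Qed.

Lemma hull_closed : closed (hull A setT).
Proof.
rewrite hullE (_ : [set x | _] = \bigcap_(a in [set: 'I_n.+1])
    ((fun x => bary x ord0 a) @^-1` [set t | 0 <= t])).
  apply: closed_bigI => a _; apply: closed_comp; last exact: closed_ge.
  by move=> x _; exact: bary_continuous.
by apply/seteqP; split => x /= h a => [_|]; exact: h.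
Qed.

Lemma bary_gt0_interior x : (forall a, 0 < bary x ord0 a) -> (hull A setT)° x.
Proof.
move=> h; rewrite hullE /interior.
have nb a : nbhs x [set y | 0 < bary y ord0 a].
  by apply: (cvgr_gt _ (@bary_continuous a x)).
have := @filter_forall _ _ (fun a => [set y | 0 < bary y ord0 a]) (nbhs x) (nbhs_filter x) nb.
by apply: filterS => y hy a; exact: (ltW (hy a)).
Qed.

(** Moving from x towards the barycentre g, all of whose coordinates are 1/(n+1), makes every
    barycentric coordinate positive. *)
Lemma hull_sub_closure_interior : hull A setT `<=` closure (hull A setT)°.
Proof.
move=> x; rewrite hullE /= => x0.
pose g : 'rV[R]_n := const_mx (n.+1%:R^-1) *m A.
have gE a : bary g ord0 a = n.+1%:R^-1.
  rewrite -(@bary_unique (const_mx n.+1%:R^-1) g)// ?mxE//.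
  rewrite (eq_bigr (fun=> n.+1%:R^-1)); last by move=> b _; rewrite mxE.
  by rewrite sumr_const card_ord -[_ *+ _]mulr_natl divff.
pose z (t : R) := (1 - t) *: x + t *: g.
have zE t a : bary (z t) ord0 a = (1 - t) * bary x ord0 a + t * n.+1%:R^-1.
  have [sx xE] := barycentric x; have [sg g'E] := barycentric g.
  rewrite -(@bary_unique ((1 - t) *: bary x + t *: bary g) (z t)).
  - by rewrite [LHS]mxE [X in X + _]mxE [X in _ + X]mxE gE.
  - rewrite (eq_bigr (fun b => (1 - t) * bary x ord0 b + t * bary g ord0 b)); last first.
      by move=> b _; rewrite [LHS]mxE [X in X + _]mxE [X in _ + X]mxE.
    by rewrite big_split /= -!mulr_sumr sx sg !mulr1 subrK.
  - by rewrite mulmxDl -!scalemxAl xE g'E.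
move=> V Vx.
have zc : z t @[t --> (0:R)] --> x.
  rewrite [X in _ --> X](_ : _ = (1 - 0) *: x + 0 *: g); last first.
    by rewrite subr0 scale1r scale0r addr0.
  apply: cvgD; apply: cvgZl; last exact: cvg_id.
  by apply: cvgB; [exact: cvg_cst|exact: cvg_id].
have /nbhs_ballP[e /= e0 he] := zc _ Vx.
pose t := Num.min (e / 2) (1 / 2).
have t0 : 0 < t by rewrite lt_min !divr_gt0.
have t1 : t < 1 by rewrite gt_min; apply/orP; right; rewrite ltr_pdivrMr// mul1r ltr1n.
have te : t < e by rewrite gt_min; apply/orP; left; rewrite ltr_pdivrMr// mulr_natr mulr2n ltrDl.
exists (z t); split; last by apply: he; rewrite -ball_normE /= sub0r normrN gtr0_norm.
rewrite -hullE; apply: bary_gt0_interior => a; rewrite zE.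
by rewrite ltr_wpDl ?mulr_gt0// mulr_ge0// subr_ge0 ltW.
Qed.

(** A point of the simplex outside its interior has a vanishing barycentric coordinate, hence lies
    in one of n+1 hyperplanes. These are proper: a barycentric coordinate with zero linear part
    would take the same value at all vertices, and there are at least two because n > 0. *)
Lemma hull_interior_null : (0 < n)%N -> exists N, [/\ measurable N, mu N = 0%E &
  forall x, hull A setT x -> ~ N x -> (hull A setT)° x].
Proof.
move=> n0.
pose H (a : 'I_n.+1) : set 'rV[R]_n :=
  [set x | \sum_j (\row_j invmx bary_mx (lift ord0 j) a) ord0 j * x ord0 j = - invmx bary_mx ord0 a].
have HE a x : H a x <-> bary x ord0 a = 0.
  rewrite baryE /H /= (eq_bigr (fun j => x ord0 j * invmx bary_mx (lift ord0 j) a)).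
    by split=> [->|/eqP]; [rewrite subrr|rewrite addrC addr_eq0 => /eqP].
  by move=> j _; rewrite mxE mulrC.
have mH a : measurable (H a).
  rewrite (_ : H a = (fun x => bary x ord0 a) @^-1` [set 0]).
    apply: closed_rV_measurable; apply: closed_comp; last exact: closed_eq.
    by move=> x _; exact: bary_continuous.
  by apply/seteqP; split => x /HE.
have H0 a : mu (H a) = 0%E.
  apply: hyperplane_null; apply/eqP => c0.
  have h k : (bary_mx *m invmx bary_mx) k a = invmx bary_mx ord0 a.
    rewrite mxE big_ord_recl big1 ?addr0.
      rewrite [bary_mx k ord0](_ : _ = 1) ?mul1r//.
      transitivity (row_mx (const_mx 1 : 'cV[R]_n.+1) A k (lshift n ord0)).
        by congr fun_of_matrix; apply/val_inj.
      by rewrite row_mxEl mxE.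
    by move=> j _; move/rowP : c0 => /(_ j); rewrite !mxE => ->; rewrite mulr0.
  have [k ka] : exists k : 'I_n.+1, k != a.
    have [->|a0] := eqVneq a ord0; last by exists ord0; rewrite eq_sym.
    by exists (lift ord0 (Ordinal n0)).
  have := h a; have := h k; rewrite mulmxV// !mxE eqxx (negbTE ka) => <- /eqP.
  by rewrite oner_eq0.
exists (\bigcup_(a in [set: 'I_n.+1]) H a); split.
- by apply: fin_bigcup_measurable => // a _; exact: mH.
- apply: measure_negligible; first by apply: fin_bigcup_measurable => // a _; exact: mH.
  rewrite -bigsetU_fset_set//=.
  apply: (big_ind (fun X => mu.-negligible X)).
  + exact: negligible_set0.
  + by move=> X Y; exact: negligibleU.
  + by move=> a _; apply/negligibleP; [exact: mH|exact: H0].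
- move=> x xK xN; apply: bary_gt0_interior => a.
  move: xK; rewrite hullE /= => /(_ a); rewrite le_eqVlt => /orP[/eqP xa|//].
  by exfalso; apply: xN; exists a => //; apply/HE.
Qed.

End simplices.

Record meshed (R : realType) (n : nat) (Omega : set 'rV[R]_n) (T : mesh R n) : Prop :=
  Meshed {
    meshed_dim : (0 < n)%N;
    meshed_open : open Omega;
    meshed_bounded : bounded_set Omega;
    meshed_convex : convex_set (Omega : set (convex_lmodType 'rV[R]_n));
    meshed_neq0 : Omega !=set0;
    meshed_triangulation : triangulation Omega T }.

Section triangulated_domain.
Variables (R : realType) (n : nat) (Omega : set 'rV[R]_n) (T : mesh R n).
Hypothesis OmegaT : meshed Omega T.
Let n0 : (0 < n)%N := meshed_dim OmegaT.
Let oO : open Omega := meshed_open OmegaT.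
Let bO : bounded_set Omega := meshed_bounded OmegaT.
Let cO : convex_set (Omega : set (convex_lmodType 'rV[R]_n)) := meshed_convex OmegaT.
Let Ox0 : Omega !=set0 := meshed_neq0 OmegaT.
Let OT : triangulation Omega T := meshed_triangulation OmegaT.
Local Notation mu := (lebesgue_rV R n).
Local Notation E := (elem_interiors T).

Lemma domain_convex x y (t : R) : Omega x -> Omega y -> 0 <= t <= 1 ->
  Omega (t *: x + (1 - t) *: y).
Proof.
move=> Ox Oy /andP[t0 t1].
have := cO (Itv01 t0 t1) (mem_set Ox) (mem_set Oy).
by rewrite inE.
Qed.

Lemma domain_bounded : exists2 r : R, 0 < r & forall x, closure Omega x -> `|x| < r.
Proof.
have [M [_ h]] := bO; pose r := Num.max 0 (M + 1).
have r0 : 0 <= r by rewrite le_max lexx.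
have hr x : Omega x -> `|x| <= r.
  by apply: h; rewrite lt_max ltrDl ltr01 orbT.
exists (r + 1); first by rewrite ltr_wpDl.
move=> x cx; rewrite (@le_lt_trans _ _ r)// ?ltrDl//.
have : closed [set y : 'rV[R]_n | `|y| <= r].
  apply: (closed_comp (f := fun x : 'rV[R]_n => `|x|) (D := [set t | t <= r])).
    by move=> y _; exact: norm_continuous.
  exact: closed_le.
move=> /closure_id cE; have : closure [set y : 'rV[R]_n | `|y| <= r] x.
  by apply: (closure_subset _ cx) => y /hr.
by rewrite -cE.
Qed.

(** The point y is replaced by a nearby y' of Omega, and x is moved by (1-t)/t times (y - y'), which
    leaves the combination unchanged and keeps x in a ball inside Omega. *)
Lemma convex_open_closure x y (t : R) : Omega x -> closure Omega y -> 0 < t <= 1 ->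
  Omega (t *: x + (1 - t) *: y).
Proof.
move=> Ox cy /andP[t0 t1].
have [e e0 xe] : exists2 e, 0 < e & ball x e `<=` Omega.
  by move: oO; rewrite openE => /(_ _ Ox)/nbhs_ballP[e /= e0 ?]; exists e.
have [y' [Oy' yy']] := cy _ (nbhsx_ballx y _ (mulr_gt0 e0 t0)).
pose x' := x + ((1 - t) / t) *: (y - y').
have -> : t *: x + (1 - t) *: y = t *: x' + (1 - t) *: y'.
  rewrite /x' scalerDr scalerA mulrCA divff ?gt_eqF// mulr1 scalerBr.
  by rewrite -addrA subrK.
apply: domain_convex => //; last by rewrite ltW.
apply: xe; rewrite ball_rVE /= /x' addrC addKr normrZ.
rewrite ger0_norm; last by rewrite divr_ge0 ?subr_ge0 ?(ltW t0).
move: yy'; rewrite -ball_normE /= => yy'.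
rewrite mulrAC ltr_pdivrMr//; apply: le_lt_trans yy'.
by rewrite ler_piMl// lerBlDr lerDl ltW.
Qed.



(** A point of the interior of the closure lies strictly between [x0] and a point of the closure
    slightly beyond it. Hence the elements have their interiors in Omega, and every boundary point
    is a limit of exterior points. *)
Lemma interior_closure_convex : (closure Omega)° `<=` Omega.
Proof.
move=> x; have [x0 Ox0'] := Ox0.
move=> /nbhs_ballP[e /= e0 xe].
have [->//|xx0] := eqVneq x x0.
have d0 : 0 < `|x - x0| by rewrite normr_gt0 subr_eq0.
pose s := e / 2 / `|x - x0|; have s0 : 0 < s by rewrite !divr_gt0.
have cy : closure Omega (x + s *: (x - x0)).
  apply: xe; rewrite ball_rVE /= addrC addKr normrZ gtr0_norm// divfK ?gt_eqF//.
  by rewrite ltr_pdivrMr// mulr_natr mulr2n ltrDl.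
have s1 : 0 < 1 + s by rewrite addr_gt0.
have := @convex_open_closure x0 _ (s / (1 + s)) Ox0' cy.
rewrite divr_gt0//= ler_pdivrMr// mul1r lerDr ler01 => /(_ isT).
congr Omega; apply/rowP => i; rewrite !mxE; field.
by rewrite gt_eqF.
Qed.

Lemma elem_closure i : elem T i `<=` closure Omega.
Proof. by have [_ -> _ _] := OT => x xi; exists i. Qed.

Lemma elem_cover x : closure Omega x -> exists i, elem T i x.
Proof. by have [_ -> _ _] := OT => -[i _ xi]; exists i. Qed.

Lemma elem_closed i : closed (elem T i).
Proof. by have [h _ _ _] := OT; exact: hull_closed. Qed.

Lemma elem_dense i : elem T i `<=` closure (elem T i)°.
Proof. by have [h _ _ _] := OT; exact: hull_sub_closure_interior. Qed.

Lemma elem_interior_sub i : (elem T i)° `<=` Omega.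
Proof.
move=> x xi; apply: interior_closure_convex.
by apply: (filterS _ xi); exact: elem_closure.
Qed.

Lemma elem_interiors_open : open E.
Proof. by apply: bigcup_open => i _; exact: open_interior. Qed.

Lemma elem_interiors_sub : E `<=` Omega.
Proof. by move=> x [i _]; exact: elem_interior_sub. Qed.

Lemma measurable_elem_interiors : measurable E.
Proof. by apply: open_rV_measurable; exact: elem_interiors_open. Qed.

Lemma elem_interiors_conull : exists N, [/\ measurable N, mu N = 0%E &
  forall x, closure Omega x -> ~ N x -> E x].
Proof.
have [h _ _ _] := OT.
have /choice[N hN] : forall i : 'I_(nelem T), exists N, [/\ measurable N, mu N = 0%E &
    forall x, elem T i x -> ~ N x -> (elem T i)° x].
  by move=> i; exact: hull_interior_null.
have mN i : measurable (N i) by have [] := hN i.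
exists (\bigcup_(i in [set: 'I_(nelem T)]) N i); split.
- by apply: fin_bigcup_measurable => // i _; exact: mN.
- apply: measure_negligible; first by apply: fin_bigcup_measurable => // i _; exact: mN.
  rewrite -bigsetU_fset_set//=.
  apply: (big_ind (fun X => mu.-negligible X)).
  + exact: negligible_set0.
  + by move=> X Y; exact: negligibleU.
  + by move=> i _; have [? ? _] := hN i; apply/negligibleP.
- move=> x /elem_cover[i xi] xN; exists i => //; have [_ _] := hN i; apply => // Nx.
  by apply: xN; exists i.
Qed.

End triangulated_domain.

Section locality.
Variables (R : realType) (n : nat).
Implicit Types (f g : 'rV[R]_n -> R) (x : 'rV[R]_n).

Lemma near_eq_pder f g s x : (\forall y \near x, f y = g y) ->
  \forall y \near x, pder s f y = pder s g y.
Proof.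
move=> fg; elim: s => [//|i s IH] /=.
have := near_join IH; apply: filterS => y fgy.
exact: near_eq_derive.
Qed.

Lemma closure_continuous_eq0 (A : set 'rV[R]_n) f x : closure A x ->
  {for x, continuous f} -> (forall y, A y -> f y = 0) -> f x = 0.
Proof.
move=> Ax cf fA; apply/eqP; apply: contraT => fx.
have : \forall y \near x, f y != 0.
  by move/(cvgr_neq0 (f x)): cf; apply.
by move=> /Ax[y [Ay /eqP]]; case; exact: fA.
Qed.

End locality.

(** * Weak derivatives of piecewise polynomials *)

Section piecewise_polynomials.
Variables (R : realType) (n : nat) (Omega : set 'rV[R]_n) (T : mesh R n).
Hypothesis OmegaT : meshed Omega T.
Local Notation mu := (lebesgue_rV R n).
Local Notation Int f := (Rintegral mu setT f).
Local Notation E := (elem_interiors T).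
Local Notation flat := (@smooth_alg R n (fun=> False)).
Implicit Types (c s v z : 'rV[R]_n -> R) (q p : 'I_(nelem T) -> 'rV[R]_n -> R).

(** Membership in the flat algebra takes the place of polynomials: it is stable under derivatives
    and provides smoothness and the chain rule along lines. *)
Record pw s p : Prop := Pw {
  pw_C1 : Ck 1 Omega s;
  pw_flat : forall i, flat (p i);
  pw_eq : forall i x, elem T i x -> s x = p i x }.

Lemma spline_pw d s : spline Omega T d s -> exists p, pw s p.
Proof.
move=> [sC sp]; have /choice[p hp] : forall i : 'I_(nelem T),
    exists p0 : 'rV[R]_n -> R, is_poly d p0 /\ forall x, elem T i x -> s x = p0 x.
  by move=> i; have [p] := sp i; exists p.
by exists p; split => // i; [apply: is_poly_flat (hp i).1|exact: (hp i).2].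
Qed.

Let rO := domain_bounded OmegaT.

Lemma measurable_domain : measurable Omega.
Proof. exact: open_rV_measurable (meshed_open OmegaT). Qed.

Lemma near_interior i x : (elem T i)° x -> \forall y \near x, (elem T i)° y.
Proof. by move=> xi; apply: open_nbhs_nbhs; split => //; exact: open_interior. Qed.

Section one_function.
Variables (s : 'rV[R]_n -> R) (p : 'I_(nelem T) -> 'rV[R]_n -> R).
Hypothesis sp : pw s p.

Let cp i l : Cinf (pder l (p i)).
Proof. by apply: Cinf_flat; apply: flat_pder; exact: (pw_flat sp). Qed.

Lemma pder_interior i l x : (elem T i)° x -> pder l s x = pder l (p i) x.
Proof.
move=> xi; have h : \forall y \near x, s y = p i y.
  by apply: filterS (near_interior xi) => y /interior_subset; exact: (pw_eq sp).
exact: (nbhs_singleton (near_eq_pder l h)).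
Qed.

Lemma continuous_domain x : Omega x -> {for x, continuous s}.
Proof. by move=> Ox; have [] := pw_C1 sp (isT : (size ([::] : seq 'I_n) <= 1)%N) Ox. Qed.

Lemma continuous_pder1 j x : Omega x -> {for x, continuous (pder [:: j] s)}.
Proof. by move=> Ox; have [] := pw_C1 sp (isT : (size [:: j] <= 1)%N) Ox. Qed.

Lemma derive_domain j x : Omega x -> is_derive x 'e_j s (pder [:: j] s x).
Proof. by move=> Ox; have [_ /(_ isT j)/derivableP] := pw_C1 sp (isT : (size ([::] : seq 'I_n) <= 1)%N) Ox. Qed.

Lemma continuous_interiors l x : E x -> {for x, continuous (pder l s)}.
Proof.
move=> [i _ xi]; have h : \forall y \near x, p i y = s y.
  apply: filterS (near_interior xi) => y /interior_subset yi.
  exact/esym/(pw_eq sp).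
have cx := Cinf_continuous (cp i l) (x:=x).
rewrite /prop_for /continuous_at (pder_interior l xi).
exact: cvg_trans (near_eq_cvg (near_eq_pder l h)) cx.
Qed.

(** Here the $C^1$ condition enters: both sides are continuous at x and agree in the interior of the
    element, which is dense in it. *)
Lemma pder1_elem i j x : elem T i x -> Omega x -> pder [:: j] s x = pder [:: j] (p i) x.
Proof.
move=> xi Ox; apply/eqP; rewrite -subr_eq0; apply/eqP.
apply: (@closure_continuous_eq0 _ _ (elem T i)° (fun x => pder [:: j] s x - pder [:: j] (p i) x)).
- exact: (elem_dense OmegaT).
- by apply: continuousB; [exact: continuous_pder1|exact: Cinf_continuous].
- by move=> y /(pder_interior [:: j]) ->; rewrite subrr.
Qed.

Lemma bounded_interiors l : exists2 M, 0 <= M & forall x, E x -> `|pder l s x| <= M.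
Proof.
have [r r0 hr] := rO.
have /choice[M hM] : forall i, exists M, 0 <= M /\ forall x, `|x| <= r -> `|pder l (p i) x| <= M.
  by move=> i; have [M M0 h] := Cinf_bounded_on r (cp i l); exists M.
exists (\sum_i M i); first by apply: sumr_ge0 => i _; exact: (hM i).1.
move=> x [i _ xi]; rewrite (pder_interior l xi).
apply: (@le_trans _ _ (M i)).
  apply: (hM i).2; apply/ltW/hr/subset_closure.
  exact: (elem_interior_sub OmegaT xi).
by rewrite (bigD1 i)//= lerDl; apply: sumr_ge0 => j _; exact: (hM j).1.
Qed.

Lemma bounded_domain : exists2 M, 0 <= M & forall x, closure Omega x -> `|s x| <= M.
Proof.
have [r r0 hr] := rO.
have /choice[M hM] : forall i, exists M, 0 <= M /\ forall x, `|x| <= r -> `|p i x| <= M.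
  by move=> i; have [M M0 h] := Cinf_bounded_on r (cp i [::]); exists M.
exists (\sum_i M i); first by apply: sumr_ge0 => i _; exact: (hM i).1.
move=> x cx; have [i xi] := elem_cover OmegaT cx; rewrite (pw_eq sp xi).
apply: (@le_trans _ _ (M i)).
  by apply: (hM i).2; exact/ltW/hr.
by rewrite (bigD1 i)//= lerDl; apply: sumr_ge0 => j _; exact: (hM j).1.
Qed.

Lemma bounded_pder1 : exists2 M, 0 <= M & forall j x, Omega x -> `|pder [:: j] s x| <= M.
Proof.
have [r r0 hr] := rO.
have /choice[M hM] : forall ij : 'I_(nelem T) * 'I_n, exists M, 0 <= M /\
    forall x, `|x| <= r -> `|pder [:: ij.2] (p ij.1) x| <= M.
  by move=> i; have [M M0 h] := Cinf_bounded_on r (cp i.1 [:: i.2]); exists M.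
exists (\sum_i M i); first by apply: sumr_ge0 => i _; exact: (hM i).1.
move=> j x Ox; have cx := subset_closure Ox.
have [i xi] := elem_cover OmegaT cx; rewrite (pder1_elem j xi)//.
apply: (@le_trans _ _ (M (i, j))).
  by apply: (hM (i, j)).2; exact/ltW/hr.
by rewrite (bigD1 (i, j))//= lerDl; apply: sumr_ge0 => k _; exact: (hM k).1.
Qed.

Lemma bmeas_domain : bmeas (s \_ Omega).
Proof.
have [r r0 hr] := rO; have [M M0 hM] := bounded_domain.
apply: (@bmeas_patch _ _ _ _ M r) => //.
- exact: measurable_domain.
- apply: continuous_on_open_measurable; first exact: (meshed_open OmegaT).
  by move=> x; exact: continuous_domain.
- by move=> x /subset_closure; exact: hM.
- by move=> x /subset_closure; exact: hr.
Qed.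

Lemma bmeas_pder1 j : bmeas (pder [:: j] s \_ Omega).
Proof.
have [r r0 hr] := rO; have [M M0 hM] := bounded_pder1.
apply: (@bmeas_patch _ _ _ _ M r) => //.
- exact: measurable_domain.
- apply: continuous_on_open_measurable; first exact: (meshed_open OmegaT).
  by move=> x; exact: continuous_pder1.
- by move=> x; exact: hM.
- by move=> x /subset_closure; exact: hr.
Qed.

Lemma bmeas_interiors l : bmeas (pder l s \_ E).
Proof.
have [r r0 hr] := rO; have [M M0 hM] := bounded_interiors l.
apply: (@bmeas_patch _ _ _ _ M r) => //.
- exact: measurable_elem_interiors.
- apply: continuous_on_open_measurable; first exact: elem_interiors_open.
  by move=> x; exact: continuous_interiors.
- by move=> x /(elem_interiors_sub OmegaT)/subset_closure; exact: hr.
Qed.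

End one_function.

(** The closed pieces are the elements cut with the support K of the test function, and the zero set
    of that function. As K lies in Omega, c and q are compared at points of Omega only. *)
Lemma pw_wder_local c q k : (forall i, Cinf (q i)) ->
  (forall i x, elem T i x -> Omega x -> c x = q i x) ->
  bmeas (c \_ Omega) -> bmeas (pder [:: k] c \_ E) ->
  wder_on Omega (c \_ Omega) k (pder [:: k] c \_ E).
Proof.
move=> cq cE b1 b2 z tz.
have [N [mN N0 hN]] := elem_interiors_conull OmegaT.
have tz' := test_function_test tz.
have /test_functionP[cz [K [cK KO zK]]] := tz.
have clK : closed K by apply: compact_closed => //; exact: norm_hausdorff.
apply: (@glued_wder _ _ (option 'I_(nelem T))
   (fun o => if o is Some i then elem T i `&` K else [set x | z x = 0])
   (fun o => if o is Some i then q i else fun=> 0) _ _ _ _ N) => //.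
- by move=> [i|] //; exact: Cinf_cst.
- move=> [i|]; first by apply: closedI => //; exact: (elem_closed OmegaT).
  apply: (closed_comp (f := z) (D := [set 0])); last exact: closed_eq.
  by move=> x _; exact: Cinf_continuous.
- move=> x; have [xK|/zK] := pselect (K x); last by exists None.
  by have [i xi] := elem_cover OmegaT (subset_closure (KO _ xK)); exists (Some i).
- move=> [i|] x /=; last by move=> ->; rewrite !mulr0.
  by move=> [xi /KO Ox]; rewrite patchE mem_set// (cE i).
- move=> x xN; have [cx|cx] := pselect (closure Omega x).
    have Ex := hN x cx xN; have [i _ xi] := Ex.
    rewrite patchE mem_set//.
    have dq := Cinf_derive k x (cq i).
    have cqi y : (elem T i)° y -> c y = q i y.
      by move=> yi; apply: cE (interior_subset yi) _; exact: (elem_interior_sub OmegaT yi).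
    have -> : pder [:: k] c x = pder [:: k] (q i) x.
      have h : \forall y \near x, c y = q i y.
        by apply: filterS (near_interior xi) => y; exact: cqi.
      exact: (nbhs_singleton (near_eq_pder [:: k] h)).
    apply: near_eq_is_derive dq => //.
    apply: filterS (near_interior xi) => y yi.
    by rewrite patchE mem_set ?cqi//; exact: (elem_interior_sub OmegaT yi).
  rewrite patchE memNset; last first.
    by move=> /(elem_interiors_sub OmegaT)/subset_closure.
  apply: (@near_eq_is_derive _ _ _ (cst 0)) => //.
  have h : nbhs x (~` closure Omega).
    by apply: open_nbhs_nbhs; split => //; apply: closed_openC; exact: closed_closure.
  by apply: filterS h => y yc; rewrite patchE memNset//= => /subset_closure.
Qed.

Lemma pw_wder s p k : pw s p -> wder_on Omega (s \_ Omega) k (pder [:: k] s \_ E).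
Proof.
move=> sp; apply: (pw_wder_local (q := p)).
- by move=> i; apply: Cinf_flat; exact: (pw_flat sp).
- by move=> i x xi _; exact: (pw_eq sp).
- exact: bmeas_domain sp.
- exact: (bmeas_interiors sp [:: k]).
Qed.

(** The second weak derivatives have no singular part on the faces, since the first derivatives
    match there by [pder1_elem]. *)
Lemma pw_wder2 s p j k : pw s p ->
  wder_on Omega (pder [:: j] s \_ Omega) k (pder [:: k; j] s \_ E).
Proof.
move=> sp; apply: (pw_wder_local (q := fun i => pder [:: j] (p i))).
- by move=> i; apply: Cinf_pder; apply: Cinf_flat; exact: (pw_flat sp).
- by move=> i x xi Ox; exact: (pder1_elem sp).
- exact: (bmeas_pder1 sp).
- exact: (bmeas_interiors sp [:: k; j]).
Qed.

(** With zero boundary values the complement of Omega serves as one more closed piece, carrying the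
    function 0, and test functions may cross the boundary. *)
Lemma pw_wder_global s p k : pw s p -> (forall x, boundary Omega x -> s x = 0) ->
  wder_on setT (s \_ Omega) k (pder [:: k] s \_ E).
Proof.
move=> sp s0 z /test_function_test tz.
have [N [mN N0 hN]] := elem_interiors_conull OmegaT.
apply: (@glued_wder _ _ (option 'I_(nelem T))
   (fun o => if o is Some i then elem T i else ~` Omega)
   (fun o => if o is Some i then p i else fun=> 0) _ _ _ _ N) => //.
- exact: bmeas_domain sp.
- exact: bmeas_interiors sp [:: k].
- by move=> [i|]; [apply: Cinf_flat; exact: (pw_flat sp)|exact: Cinf_cst].
- move=> [i|]; first exact: (elem_closed OmegaT).
  exact: open_closedC (meshed_open OmegaT).
- move=> x; have [Ox|Ox] := pselect (Omega x); last by exists None.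
  by have [i xi] := elem_cover OmegaT (subset_closure Ox); exists (Some i).
- move=> [i|] x /=; last by move=> Ox; rewrite patchE memNset.
  move=> xi; rewrite patchE; have [Ox|Ox] := pselect (Omega x).
    by rewrite mem_set// (pw_eq sp xi).
  rewrite memNset// -(pw_eq sp xi) s0//; split => //.
  exact: (elem_closure OmegaT xi).
- move=> x xN; have [cx|cx] := pselect (closure Omega x).
    have Ex := hN x cx xN; have [i _ xi] := Ex.
    have Ox := elem_interiors_sub OmegaT Ex.
    rewrite patchE mem_set//; apply: near_eq_is_derive (derive_domain sp k Ox) => //.
    have : nbhs x Omega by apply: open_nbhs_nbhs; split => //; exact: (meshed_open OmegaT).
    by apply: filterS => y Oy; rewrite patchE mem_set.
  rewrite patchE memNset; last first.
    by move=> /(elem_interiors_sub OmegaT)/subset_closure.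
  apply: (@near_eq_is_derive _ _ _ (cst 0)) => //.
  have h : nbhs x (~` closure Omega).
    by apply: open_nbhs_nbhs; split => //; apply: closed_openC; exact: closed_closure.
  by apply: filterS h => y yc; rewrite patchE memNset//= => /subset_closure.
Qed.

End piecewise_polynomials.

(** * The space H^1 and boundary values *)

Section multi_indices.
Variable n : nat.

Definition mi0 : mindex n 1 := [ffun=> ord0].
Definition mi1 (j : 'I_n) : mindex n 1 := [ffun i => inord (i == j)].

Lemma mi1E j i : mi1 j i = (i == j) :> nat.
Proof. by rewrite ffunE inordK// ltnS leq_b1. Qed.

Lemma mdeg_mi0 : mdeg mi0 = 0%N.
Proof. by rewrite /mdeg big1// => i _; rewrite ffunE. Qed.

Lemma mdeg_mi1 j : mdeg (mi1 j) = 1%N.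
Proof.
rewrite /mdeg (bigD1 j)//= mi1E eqxx big1 ?addn0// => i ij.
by rewrite mi1E (negbTE ij).
Qed.

Lemma mder_mi0 : mder mi0 = [::].
Proof.
rewrite /mder; elim: (enum _) => [//|i s IH] /=.
by rewrite IH ffunE.
Qed.

Lemma mder_mi1 j : mder (mi1 j) = [:: j].
Proof.
rewrite /mder; have := mem_enum 'I_n j; have := enum_uniq 'I_n.
elim: (enum 'I_n) => [_|i s IH] /=; first by rewrite in_nil.
move=> /andP[iS uS]; rewrite inE mi1E => /orP[/eqP ji|js]; last first.
  have /negbTE -> : i != j by apply: contraNneq iS => ->.
  exact: IH.
rewrite -ji eqxx /=; congr cons; rewrite {}ji in iS *.
elim: s iS {IH uS} => [//|k s IH] /=; rewrite inE negb_or => /andP[ik ks].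
by rewrite mi1E eq_sym (negbTE ik) /=; exact: IH.
Qed.

Lemma mindex1P (a : mindex n 1) :
  reflect (a = mi0 \/ exists j, a = mi1 j) (mdeg a <= 1)%N.
Proof.
apply: (iffP idP) => [|[->|[j ->]]]; rewrite ?mdeg_mi0 ?mdeg_mi1//.
move=> a1; have [->|a0] := eqVneq a mi0; [by left|right].
have [j aj] : exists j, a j != ord0 :> 'I_2.
  apply/existsP; apply: contraT => /existsPn h; case/eqP: a0.
  by apply/ffunP => i; rewrite ffunE; apply/eqP; rewrite -[_ == _]negbK.
have {}aj : (a j = 1 :> nat)%N.
  by move: aj; rewrite -val_eqE /=; case: (a j) => -[|[]].
exists j; apply/ffunP => i; apply/val_inj; rewrite /= mi1E.
have [->|ij] := eqVneq i j; first by rewrite aj.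
move: a1; rewrite /mdeg (bigD1 j)//= (bigD1 i)//= aj.
by rewrite add1n ltnS leqn0 addn_eq0 => /andP[/eqP -> _].
Qed.

Lemma mi1_inj : injective mi1.
Proof.
move=> i j ij; apply/eqP; have := mi1E i i; rewrite ij mi1E eqxx.
by case: eqP.
Qed.

Lemma big_mindex1 (V : nmodType) (F : mindex n 1 -> V) :
  \sum_(a | (mdeg a <= 1)%N) F a = F mi0 + \sum_j F (mi1 j).
Proof.
rewrite (bigD1 mi0) ?mdeg_mi0//=; congr (_ + _).
transitivity (\sum_(j in [set: 'I_n]%SET) F (mi1 j)); last first.
  by apply: eq_bigl => j; rewrite inE.
rewrite -(big_imset F (h := mi1)); last by move=> ? ? _ _; exact: mi1_inj.
apply: eq_bigl => a; apply/andP/imsetP => [[/mindex1P[->|[j ->]]]|[j _ ->]].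
- by rewrite eqxx.
- by move=> _; exists j.
split; first by rewrite mdeg_mi1.
by apply/eqP => /(congr1 (@mdeg _ _)); rewrite mdeg_mi0 mdeg_mi1.
Qed.

End multi_indices.

Section first_order_sobolev.
Variables (R : realType) (n : nat) (Omega : set 'rV[R]_n).
Hypothesis oO : open Omega.
Local Notation mu := (lebesgue_rV R n).
Local Notation Int f := (Rintegral mu setT f).
Implicit Types (v w f g : 'rV[R]_n -> R) (D : 'I_n -> 'rV[R]_n -> R).

Let mO : measurable Omega := open_rV_measurable oO.

(** The discriminant of the nonnegative quadratic polynomial t -> Int (f + t g)^2. *)
Lemma Int_CS f g : bmeas f -> bmeas g ->
  (Int (fun x => f x * g x)) ^+ 2 <= Int (fun x => f x ^+ 2) * Int (fun x => g x ^+ 2).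
Proof.
move=> bf bg; set B := Int _; set A := Int _; set C := Int _.
have b1 := bmeasMM bf bf; have b2 := bmeasMM bf bg; have b3 := bmeasMM bg bg.
have h t : 0 <= A + 2 * t * B + t ^+ 2 * C.
  have <- : Int (fun x => f x * f x + (2 * t * (f x * g x) + t ^+ 2 * (g x * g x))) =
            A + 2 * t * B + t ^+ 2 * C.
    rewrite IntD ?IntD ?IntZ ?addrA//; [exact: bmeasZ|exact: bmeasZ|].
    by apply: bmeasD; exact: bmeasZ.
  rewrite -[leLHS](Int0 R n); apply: le_Int; first exact: bmeas0.
    by apply: bmeasD => //; apply: bmeasD; exact: bmeasZ.
  move=> x; rewrite [leRHS](_ : _ = (f x + t * g x) ^+ 2) ?sqr_ge0//; ring.
have C0 : 0 <= C.
  rewrite -[leLHS](Int0 R n); apply: le_Int => //; first exact: bmeas0.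
  by move=> x; exact: sqr_ge0.
have [C00|Cn0] := eqVneq C 0; last first.
  have Cp : 0 < C by rewrite lt_neqAle eq_sym Cn0.
  have := h (- B / C); rewrite (_ : _ + _ = (A * C - B ^+ 2) / C); last by field.
  by rewrite pmulr_lge0 ?invr_gt0// subr_ge0.
have [->|B0] := eqVneq B 0; first by rewrite C00 mulr0 expr0n.
(* If C = 0 the polynomial is affine in t, and this t gives it the value -1. *)
have := h (- (A + 1) / (2 * B)); rewrite C00 mulr0 addr0.
rewrite (_ : _ + _ = -1); first by rewrite oppr_ge0 ler10.
by field.
Qed.

(** D is an explicit bounded representative of the weak gradient, equal to 0 outside Omega. It makes
    [Wnorm] computable although [wder] is obtained by choice. *)
Record weak1 v D : Prop := Weak1 {
  weak1_bmeas : bmeas (v \_ Omega);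
  weak1_bmeas_der : forall k, bmeas (D k);
  weak1_supp : forall k x, ~ Omega x -> D k x = 0;
  weak1_wder : forall k, wder_on Omega (v \_ Omega) k (D k) }.

Definition h1norm2 v D : R :=
  Int (fun x => (v \_ Omega) x ^+ 2) + \sum_k Int (fun x => D k x ^+ 2).

Lemma Rintegral_patch f : \int[mu]_(x in Omega) f x = Int (f \_ Omega).
Proof. by rewrite Rintegral_mkcond. Qed.

Lemma bmeas_loc f : bmeas (f \_ Omega) -> locally_integrable_on Omega f.
Proof.
move=> bf; split; first by apply/(measurable_restrictT _ mO); exact: bf.1.
move=> K cK KO.
have mK : measurable K.
  by apply: closed_rV_measurable; apply: compact_closed => //; exact: norm_hausdorff.
have /integrableP[_] := integrableS measurableT mK (@subsetT _ K) (bmeas_integrable bf).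
congr (_ < _)%E; apply: eq_integral => x /set_mem/KO Ox /=.
by rewrite patchE mem_set.
Qed.

Lemma weak_derP (a : mindex n 1) v w : bmeas (v \_ Omega) -> bmeas (w \_ Omega) ->
  weak_der Omega a v w <-> forall phi, test_function Omega phi ->
    Int (fun x => (v \_ Omega) x * pder (mder a) phi x) =
    (-1) ^+ mdeg a * Int (fun x => (w \_ Omega) x * phi x).
Proof.
move=> bv bw; have e f g : Int (fun x => (f \_ Omega) x * g x) =
    \int[mu]_(x in Omega) (f x * g x).
  rewrite Rintegral_patch; apply: eq_Rintegral => x _; rewrite !patchE.
  by case: ifPn => _; rewrite ?mul0r.
split=> [[_ _ h] phi tphi|h]; first by rewrite !e h.
by split; [exact: bmeas_loc|exact: bmeas_loc|move=> phi tphi; rewrite -!e h].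
Qed.

Lemma test_locally_integrable f phi : locally_integrable_on Omega f ->
  test_function Omega phi -> mu.-integrable Omega (EFin \o (fun x => f x * phi x)).
Proof.
move=> [mf fK] tphi; have bphi := test_bmeas (test_function_test tphi).
have [M [_ [hM _]]] := bphi.2.
have /test_functionP[_ [K [cK KO phiK]]] := tphi.
have mK : measurable K.
  by apply: closed_rV_measurable; apply: compact_closed => //; exact: norm_hausdorff.
have mphi A : measurable A -> measurable_fun A phi by move=> mA; exact: measurable_funS bphi.1.
apply/integrableP; split; first by apply/measurable_EFinP; apply: measurable_funM => //; exact: mphi.
apply: (@le_lt_trans _ _ (\int[mu]_(x in K) (`|M|%:E * `|f x|%:E))%E); last first.
  rewrite ge0_integralZl//; first by rewrite lte_mul_pinfty//; exact: fK.
  by apply/measurable_EFinP; apply: measurableT_comp => //; exact: measurable_funS mf.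
rewrite [leLHS]integral_mkcond [leRHS]integral_mkcond; apply: ge0_le_integral => //.
- by move=> x _; rewrite patchE; case: ifPn.
- apply/(measurable_restrictT _ mO); apply/measurable_EFinP; apply: measurableT_comp => //.
  by apply: measurable_funM => //; exact: mphi.
- apply/(measurable_restrictT _ mK); apply: emeasurable_funM => //.
  by apply/measurable_EFinP; apply: measurableT_comp => //; exact: measurable_funS mf.
move=> x _; rewrite !patchE; have [xK|xK] := pselect (K x).
  rewrite !mem_set//=; last exact: KO.
  rewrite -EFinM lee_fin normrM mulrC ler_wpM2r//.
  exact: le_trans (hM x) (ler_norm _).
rewrite [in leRHS]memNset//; case: ifPn => // _.
by rewrite /= phiK// mulr0 normr0.
Qed.

(** The fundamental lemma applied to the difference. It makes the norms independent of the
    representative picked by [wder]. *)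
Lemma weak_der_unique (a : mindex n 1) v w w' : weak_der Omega a v w ->
  weak_der Omega a v w' ->
  exists N, [/\ measurable N, mu N = 0%E & forall x, Omega x -> ~ N x -> w x = w' x].
Proof.
move=> [_ lw hw] [_ lw' hw'].
have [||phi tphi|N [mN N0 hN]] := @test_orthogonal_ae0 _ _ Omega (w \- w') oO.
- by apply: measurable_funB; [exact: lw.1|exact: lw'.1].
- move=> K cK KO; have mK : measurable K.
    by apply: closed_rV_measurable; apply: compact_closed => //; exact: norm_hausdorff.
  have mf g : locally_integrable_on Omega g -> measurable_fun K (fun x => `|g x|%:E).
    move=> [mg _]; apply/measurable_EFinP; apply: measurableT_comp => //.
    exact: measurable_funS mg.
  apply: (@le_lt_trans _ _ (\int[mu]_(x in K) (`|w x|%:E + `|w' x|%:E))%E).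
    apply: ge0_le_integral => //.
    + apply/measurable_EFinP; apply: measurableT_comp => //; apply: measurable_funB.
        exact: measurable_funS lw.1.
      exact: measurable_funS lw'.1.
    + by apply: emeasurable_funD; exact: mf.
    + by move=> x _; rewrite -EFinD lee_fin ler_normB.
  by rewrite ge0_integralD//; [apply: lte_add_pinfty; [exact: lw.2|exact: lw'.2]|exact: mf|exact: mf].
- under eq_Rintegral do rewrite mulrBl.
  rewrite RintegralB//; [|exact: test_locally_integrable..].
  apply/eqP; rewrite subr_eq0; apply/eqP.
  have s0 : (-1) ^+ mdeg a != 0 :> R by rewrite signr_eq0.
  by have := hw _ tphi; rewrite (hw' _ tphi) => /(mulfI s0) ->.
by exists N; split => // x Ox /(hN x Ox)/eqP; rewrite subr_eq0 => /eqP.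
Qed.

Section weak_gradient.
Variables (v : 'rV[R]_n -> R) (D : 'I_n -> 'rV[R]_n -> R).
Hypothesis vD : weak1 v D.

Let patchD k : D k \_ Omega = D k.
Proof.
apply/funext => x; rewrite patchE; case: ifPn => //; rewrite notin_setE => xO.
by rewrite (weak1_supp vD).
Qed.

Lemma weak1_weak_der0 : weak_der Omega (mi0 n) v v.
Proof.
apply/weak_derP; [exact: (weak1_bmeas vD)|exact: (weak1_bmeas vD)|] => phi _.
by rewrite mder_mi0 mdeg_mi0 expr0 mul1r.
Qed.

Lemma weak1_weak_der k : weak_der Omega (mi1 k) v (D k).
Proof.
apply/weak_derP; [exact: (weak1_bmeas vD)| |] => [|phi tphi].
  by rewrite patchD; exact: (weak1_bmeas_der vD).
by rewrite mder_mi1 mdeg_mi1 expr1 mulN1r patchD; exact: (weak1_wder vD).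
Qed.

Lemma Lpnorm2 (a : mindex n 1) w : bmeas (w \_ Omega) -> weak_der Omega a v w ->
  (Lpnorm 2%:E Omega (wder Omega a v) `^ 2 = (Int (fun x => (w \_ Omega) x ^+ 2))%:E)%E.
Proof.
move=> bw vw; have vw' : weak_der Omega a v (wder Omega a v) by apply: xgetPex; exists w.
have [N [mN N0 hN]] := weak_der_unique vw' vw.
have [_ lw' _] := vw'.
rewrite /Lpnorm poweR_Lnorm//.
have -> : (\int[mu]_x (`|(EFin \o (wder Omega a v \_ Omega)) x| `^ 2))%E =
    (\int[mu]_x ((w \_ Omega) x ^+ 2)%:E)%E.
  apply: ae_eq_integral => //.
  - under eq_fun do rewrite abse_EFin poweR_EFin powR_mulrn//.
    apply/measurable_EFinP/measurable_funX/measurableT_comp => //.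
    by apply/(measurable_restrictT _ mO); exact: lw'.1.
  - by apply/measurable_EFinP/measurable_funX; exact: bw.1.
  exists N; split => // x /= h; apply: contrapT => Nx; apply: h => _.
  rewrite powR_mulrn// real_normK ?num_real//; congr (_ ^+ 2)%:E.
  by rewrite !patchE; case: ifPn => // /set_mem Ox; rewrite hN.
rewrite /Rintegral fineK//; apply: integrable_fin_num => //.
by apply: bmeas_integrable; exact: bmeasMM.
Qed.

Lemma Lpnorm_lty (a : mindex n 1) w : bmeas (w \_ Omega) ->
  (Lpnorm 2%:E Omega w < +oo)%E.
Proof.
move=> bw; suff : (Lpnorm 2%:E Omega w `^ 2 < +oo)%E.
  rewrite !ltey; apply: contraNN => /eqP ->.
  by rewrite poweRyr ?eqxx ?pnatr_eq0.
rewrite /Lpnorm poweR_Lnorm//.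
have /integrableP[_] := bmeas_integrable (bmeasMM bw bw).
congr (_ < _)%E; apply: eq_integral => x _ /=.
by rewrite powR_mulrn// normrM.
Qed.

Lemma weak1_sobolev : sobolev 1 2%:E Omega v.
Proof.
move=> a /mindex1P[->|[k ->]].
  exists v; split; first exact: weak1_weak_der0.
  exact: (Lpnorm_lty a (weak1_bmeas vD)).
exists (D k); split; first exact: weak1_weak_der.
by apply: (Lpnorm_lty a); rewrite patchD; exact: (weak1_bmeas_der vD).
Qed.

Lemma h1norm2_ge0 : 0 <= h1norm2 v D.
Proof.
have h g : bmeas g -> 0 <= Int (fun x => g x ^+ 2).
  move=> bg; rewrite -[leLHS](Int0 R n); apply: le_Int; [exact: bmeas0|exact: bmeasMM|].
  by move=> x; exact: sqr_ge0.
apply: addr_ge0; first exact: h (weak1_bmeas vD).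
by apply: sumr_ge0 => k _; exact: h (weak1_bmeas_der vD k).
Qed.

Lemma Wnorm_weak1 : Wnorm 1 2%:E Omega v = (Num.sqrt (h1norm2 v D))%:E.
Proof.
rewrite /Wnorm /lpsum big_mindex1 (Lpnorm2 (weak1_bmeas vD) weak1_weak_der0).
have -> : ((\sum_j (Lpnorm 2%:E Omega (wder Omega (mi1 j) v) `^ 2)) =
    (\sum_j Int (fun x => D j x ^+ 2))%:E)%E.
  rewrite -sumEFin; apply: eq_bigr => k _.
  by rewrite (Lpnorm2 _ (weak1_weak_der k)) patchD//; exact: (weak1_bmeas_der vD).
by rewrite -EFinD poweR_EFin powR12_sqrt// h1norm2_ge0.
Qed.

End weak_gradient.

Lemma weak1B v D w G : weak1 v D -> weak1 w G ->
  weak1 (v \- w) (fun k x => D k x - G k x).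
Proof.
move=> vD wG; have e : (v \- w) \_ Omega = fun x => (v \_ Omega) x - (w \_ Omega) x.
  by apply/funext => x; rewrite !patchE; case: ifPn => _ //; rewrite subr0.
split; rewrite ?e.
- by apply: bmeasB; [exact: (weak1_bmeas vD)|exact: (weak1_bmeas wG)].
- by move=> k; apply: bmeasB; [exact: (weak1_bmeas_der vD)|exact: (weak1_bmeas_der wG)].
- by move=> k x xO; rewrite (weak1_supp vD)// (weak1_supp wG)// subrr.
move=> k z tz; have bz := test_bmeas (test_function_test tz).
have bdz := test_bmeas (test_pder [:: k] (test_function_test tz)).
under eq_Rintegral do rewrite mulrBl.
rewrite IntB ?(weak1_wder vD)// ?(weak1_wder wG)//; last 2 first.
- by apply: bmeasMM => //; exact: (weak1_bmeas vD).
- by apply: bmeasMM => //; exact: (weak1_bmeas wG).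
under [in RHS]eq_Rintegral do rewrite mulrBl.
rewrite IntB ?opprB ?opprK 1?addrC//.
- by apply: bmeasMM => //; exact: (weak1_bmeas_der vD).
- by apply: bmeasMM => //; exact: (weak1_bmeas_der wG).
Qed.

Lemma test_patch phi : test_function Omega phi -> phi \_ Omega = phi.
Proof.
move=> /test_functionP[_ [K [_ KO h]]]; apply/funext => x; rewrite patchE.
by case: ifPn => //; rewrite notin_setE => xO; rewrite h// => /KO.
Qed.

Lemma test_wder (phi : 'rV[R]_n -> R) (k : 'I_n) : test phi -> wder_on setT phi k (pder [:: k] phi).
Proof.
move=> tphi z /test_function_test tz.
apply: (@glued_wder _ _ unit (fun=> setT) (fun=> phi) _ _ _ _ set0) => //.
- exact: test_bmeas.
- exact: test_bmeas (test_pder [:: k] tphi).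
- by move=> _; exact: tphi.1.
- by move=> x _; exact: Cinf_derive tphi.1.
Qed.

Lemma test_weak1 phi : test_function Omega phi -> weak1 phi (fun k => pder [:: k] phi).
Proof.
move=> tphi; have t := test_function_test tphi; split; rewrite ?test_patch//.
- exact: test_bmeas.
- by move=> k; exact: test_bmeas (test_pder [:: k] t).
- move=> k x xO; have /test_patch <- := test_function_pder [:: k] tphi.
  by rewrite patchE memNset.
move=> k z tz; apply: test_wder => //; apply: test_test_function.
exact: test_function_test tz.
Qed.

End first_order_sobolev.

Lemma cvg_sqr (R : realType) (u : nat -> R) (l : R) :
  u @ \oo --> l -> u k ^+ 2 @[k --> \oo] --> l ^+ 2.
Proof. by move=> ul; rewrite expr2; under eq_fun do rewrite expr2; exact: cvgM. Qed.

(** * Zero boundary values and $H^1_0$ *)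

Section boundary_values.
Variables (R : realType) (n : nat) (Omega : set 'rV[R]_n) (T : mesh R n).
Hypothesis OmegaT : meshed Omega T.
Local Notation mu := (lebesgue_rV R n).
Local Notation Int f := (Rintegral mu setT f).
Local Notation E := (elem_interiors T).
Implicit Types (s phi : 'rV[R]_n -> R) (p : 'I_(nelem T) -> 'rV[R]_n -> R).

Let oO := meshed_open OmegaT.

Lemma pw_weak1 s p : pw Omega s p -> weak1 Omega s (fun k => pder [:: k] s \_ E).
Proof.
move=> sp; split.
- exact (bmeas_domain OmegaT sp).
- by move=> k; exact: (bmeas_interiors OmegaT sp [:: k]).
- by move=> k x xO; rewrite patchE memNset// => /(elem_interiors_sub OmegaT).
- by move=> k; exact: (pw_wder OmegaT k sp).
Qed.

Lemma le_h1norm2 v D : weak1 Omega v D ->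
  Int (fun x => (v \_ Omega) x ^+ 2) <= h1norm2 Omega v D /\
  forall k, Int (fun x => D k x ^+ 2) <= h1norm2 Omega v D.
Proof.
move=> vD; have h g : bmeas g -> 0 <= Int (fun x => g x ^+ 2).
  move=> bg; rewrite -[leLHS](Int0 R n); apply: le_Int; [exact: bmeas0|exact: bmeasMM|].
  by move=> x; exact: sqr_ge0.
have h0 := h _ (weak1_bmeas vD); have hk k := h _ (weak1_bmeas_der vD k).
split; first by rewrite lerDl sumr_ge0.
move=> k; rewrite /h1norm2 (bigD1 k)//= addrCA lerDl addr_ge0// sumr_ge0//.
Qed.

Lemma Int_mul_sqrt_le (f g : 'rV[R]_n -> R) (e : R) : bmeas f -> bmeas g ->
  Int (fun x => g x ^+ 2) <= e ^+ 2 -> 0 <= e ->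
  `|Int (fun x => f x * g x)| <= Num.sqrt (Int (fun x => f x ^+ 2)) * e.
Proof.
move=> bf bg ge e0; have f0 : 0 <= Int (fun x => f x ^+ 2).
  rewrite -[leLHS](Int0 R n); apply: le_Int; [exact: bmeas0|exact: bmeasMM|].
  by move=> x; exact: sqr_ge0.
rewrite -(ler_pXn2r (n := 2))//; last by rewrite nnegrE mulr_ge0// sqrtr_ge0.
rewrite real_normK ?num_real// exprMn sqr_sqrtr//.
by apply: le_trans (Int_CS bf bg) _; exact: ler_wpM2l.
Qed.

Lemma H10_approx s p (e : R) : pw Omega s p -> H10 Omega s -> 0 < e ->
  exists phi, [/\ test_function Omega phi,
    Int (fun x => ((s \_ Omega) x - phi x) ^+ 2) <= e ^+ 2 &
    forall k, Int (fun x => ((pder [:: k] s \_ E) x - pder [:: k] phi x) ^+ 2) <= e ^+ 2].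
Proof.
move=> sp [_ h] e0; have [phi [tphi]] := h _ e0.
have sw := weak1B (pw_weak1 sp) (test_weak1 tphi).
rewrite (Wnorm_weak1 oO sw) lte_fin => he.
have {}he : h1norm2 Omega (s \- phi) (fun k x => (pder [:: k] s \_ E) x - pder [:: k] phi x) <= e ^+ 2.
  rewrite -(sqr_sqrtr (h1norm2_ge0 sw)) ler_pXn2r ?nnegrE ?sqrtr_ge0//; exact: ltW.
have [h0 hk] := le_h1norm2 sw.
exists phi; split => //; last by move=> k; exact: le_trans (hk k) he.
apply: le_trans he; apply: le_trans h0.
rewrite le_eqVlt; apply/orP; left; apply/eqP; apply: eq_Rintegral => x _; congr (_ ^+ 2).
rewrite -[in LHS](test_patch tphi) !patchE; case: ifPn => // _.
by rewrite subr0.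
Qed.

(** The identity holds for test functions of Omega, even against z on the whole space, and the
    defect X is continuous for the $H^1$ norm by Cauchy-Schwarz. So the extension by 0 of a member
    of $H^1_0$ is weakly differentiable across the boundary. *)
Lemma H10_wder_global s p k : pw Omega s p -> H10 Omega s ->
  wder_on setT (s \_ Omega) k (pder [:: k] s \_ E).
Proof.
move=> sp s0 z /test_function_test tz.
have bz := test_bmeas tz; have bdz := test_bmeas (test_pder [:: k] tz).
have bs := bmeas_domain OmegaT sp; have bds := bmeas_interiors OmegaT sp [:: k].
apply/eqP; rewrite -subr_eq0 opprK; set X := _ + _.
pose C := Num.sqrt (Int (fun x => pder [:: k] z x ^+ 2)) + Num.sqrt (Int (fun x => z x ^+ 2)).
have C0 : 0 <= C by rewrite addr_ge0// sqrtr_ge0.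
suff h e : 0 < e -> `|X| <= C * e.
  rewrite -normr_le0; apply/ler_addgt0Pl => e e0; rewrite addr0.
  have C1 : 0 < C + 1 by rewrite ltr_wpDl.
  apply: (le_trans (h (e / (C + 1)) _)); first by rewrite divr_gt0.
  rewrite mulrCA ler_piMr ?(ltW e0)// ler_pdivrMr// mul1r lerDl//.
move=> e0; have [phi [tphi h0 hk]] := H10_approx sp s0 e0.
have t := test_function_test tphi.
have bp := test_bmeas t; have bdp := test_bmeas (test_pder [:: k] t).
have -> : X = Int (fun x => pder [:: k] z x * ((s \_ Omega) x - phi x)) +
    Int (fun x => z x * ((pder [:: k] s \_ E) x - pder [:: k] phi x)).
  under eq_Rintegral do rewrite mulrC mulrBl.
  under [X in _ = _ + X]eq_Rintegral do rewrite mulrC mulrBl.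
  rewrite !IntB//; [|exact: bmeasMM..].
  rewrite (test_wder k t (test_test_function tz)) /X; lra.
rewrite mulrDl (le_trans (ler_normD _ _))// lerD//.
  by apply: Int_mul_sqrt_le => //; [exact: bmeasB|exact: ltW].
by apply: Int_mul_sqrt_le => //; [exact: bmeasB|exact: ltW].
Qed.

(** The bound is the same for all mollification radii d. *)
Lemma conv_pder_bound (F G rho : 'rV[R]_n -> R) k (M d : R) : 0 < d -> bmeas F -> bmeas G ->
  wder_on setT F k G -> (forall x, `|G x| <= M) ->
  forall x, `|pder [:: k] (conv F (mol d)) x| <= M.
Proof.
move=> d0 bF bG FG GM x; have tm := @mol_test R n _ d0.
rewrite pder_conv// (conv_wder (U := setT) (G := G))//; first exact: conv_mol_bound.
have /test_test_function/test_functionP[_ [K [cK _ hK]]] := test_refl x tm.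
by exists K.
Qed.

(** The mollifications of the extension by 0 are Lipschitz with one common constant, because its
    weak gradient is bounded. In the limit this compares s at a point of Omega with the value 0 at
    an exterior point, and both kinds of points occur arbitrarily close to x. *)
Lemma H10_boundary s p x : pw Omega s p -> H10 Omega s -> boundary Omega x -> s x = 0.
Proof.
move=> sp s0 [cx xO].
have bs := bmeas_domain OmegaT sp.
have [M M0 hM] := bounded_pder1 OmegaT sp.
have GM k y : `|(pder [:: k] s \_ E) y| <= M.
  rewrite patchE; case: ifPn => [/set_mem/(elem_interiors_sub OmegaT)|_]; first exact: hM.
  by rewrite normr0.
pose d (k : nat) : R := k.+1%:R^-1.
have d0 k : 0 < d k by rewrite invr_gt0.
have dc : d @ \oo --> 0 by exact: cvg_harmonic.
have lip k y z : `|conv (s \_ Omega) (mol (d k)) y - conv (s \_ Omega) (mol (d k)) z| <=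
    n%:R * M * `|y - z|.
  apply: bounded_pder_lipschitz => //.
    have tm := mol_test n (d0 k).
    by move=> i w; have [] := Cinf_derive i w (conv_Cinf bs tm).
  move=> i w; apply: (conv_pder_bound (G := pder [:: i] s \_ E)) => //.
    exact: (bmeas_interiors OmegaT sp [:: i]).
  exact: (H10_wder_global i sp s0).
have cvgO y : Omega y -> conv (s \_ Omega) (mol (d k)) y @[k --> \oo] --> s y.
  move=> Oy; have -> : s y = (s \_ Omega) y by rewrite patchE mem_set.
  apply: (conv_mol_cvg (z := fun=> y)) => //; first exact: cvg_cst.
  have h : \forall w \near y, s w = (s \_ Omega) w.
    by apply: filterS (open_nbhs_nbhs (conj oO Oy)) => w Ow; rewrite patchE mem_set.
  rewrite /prop_for /continuous_at patchE mem_set//.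
  exact: cvg_trans (near_eq_cvg h) (continuous_domain sp Oy).
have cvgC y : ~ closure Omega y -> conv (s \_ Omega) (mol (d k)) y @[k --> \oo] --> (0 : R).
  move=> Oy; have <- : (s \_ Omega) y = 0 by rewrite patchE memNset// => /subset_closure.
  apply: (conv_mol_cvg (z := fun=> y)) => //; first exact: cvg_cst.
  have h : \forall w \near y, 0 = (s \_ Omega) w.
    have h : nbhs y (~` closure Omega).
      by apply: open_nbhs_nbhs; split => //; apply: closed_openC; exact: closed_closure.
    by apply: filterS h => w Ow; rewrite patchE memNset// => /subset_closure.
  rewrite /prop_for /continuous_at patchE memNset; last by move=> /subset_closure.
  apply: cvg_trans (near_eq_cvg h) _; exact: cvg_cst.
have key y z : Omega y -> ~ closure Omega z -> `|s y| <= n%:R * M * `|y - z|.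
  move=> Oy Oz; have h : `|conv (s \_ Omega) (mol (d k)) y - conv (s \_ Omega) (mol (d k)) z|
      @[k --> \oo] --> `|s y - 0|.
    by apply: cvg_norm; apply: cvgB; [exact: cvgO|exact: cvgC].
  rewrite -[s y]subr0 -(cvg_lim _ h)//; apply: limr_le; first by apply/cvg_ex; eexists; exact: h.
  by apply: nearW => k; exact: lip.
have [i xi] := elem_cover OmegaT cx.
have cp := Cinf_flat (pw_flat sp i).
apply/eqP; rewrite -normr_le0; apply/ler_addgt0Pl => e e0; rewrite addr0.
pose K := n%:R * M; have K1 : 0 < K + 1 by rewrite ltr_wpDl// mulr_ge0.
have K0 : 0 <= K by rewrite mulr_ge0.
(* Points y and z within eta of x are at most 2 eta apart, and K * (2 eta) <= e / 2; the [+ 1]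
   covers the case K = 0. *)
pose eta := e / (4 * (K + 1)).
have eta0 : 0 < eta by rewrite divr_gt0// mulr_gt0.
have [y [yi [xy py]]] : exists y, (elem T i)° y /\ `|x - y| < eta /\ `|p i x - p i y| <= e / 2.
  have h1 : \forall y \near x, `|p i x - p i y| <= e / 2.
    by have /cvgrPdist_le := Cinf_continuous cp (x:=x); apply; rewrite divr_gt0.
  have h2 : \forall y \near x, `|x - y| < eta.
    by apply/nbhs_ballP; exists eta => // y; rewrite ball_rVE /= distrC.
  by have [y [yi [? ?]]] := elem_dense OmegaT xi (filterI h2 h1); exists y.
have Oy := elem_interior_sub OmegaT yi.
have [z [zO xz]] : exists z, ~ closure Omega z /\ `|x - z| < eta.
  apply: contrapT => h; apply: xO; apply: (interior_closure_convex OmegaT).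
  apply/nbhs_ballP; exists eta => // z; rewrite ball_rVE /= distrC => xz.
  by apply: contrapT => zO; apply: h; exists z.
rewrite (pw_eq sp xi); apply: (@le_trans _ _ (e / 2 + `|p i y|)).
  by rewrite -lerBlDr (le_trans (lerB_dist _ _))//.
rewrite [leRHS](splitr e) lerD2l -(pw_eq sp (interior_subset yi)).
apply: (le_trans (key _ _ Oy zO)).
apply: (@le_trans _ _ (n%:R * M * (2 * eta))).
  rewrite ler_wpM2l ?mulr_ge0// mulr_natl mulr2n -(subrK x y) -addrA.
  by rewrite (le_trans (ler_normD _ _))// lerD// ltW// distrC.
have -> : n%:R * M * (2 * eta) = e / 2 * (K / (K + 1)).
  by rewrite -/K /eta; field; rewrite gt_eqF.
by rewrite ler_piMr ?divr_ge0 ?(ltW e0)// ler_pdivrMr// mul1r lerDl.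
Qed.

(** * Approximation by dilation and mollification *)

Section shrinking.
Variables (s : 'rV[R]_n -> R) (p : 'I_(nelem T) -> 'rV[R]_n -> R).
Hypotheses (sp : pw Omega s p) (s0 : forall x, boundary Omega x -> s x = 0).
Variables (x0 : 'rV[R]_n) (r : R).
Hypotheses (r0 : 0 < r) (x0O : forall y, `|x0 - y| < r -> Omega y).

Let F := s \_ Omega.
Let G k := pder [:: k] s \_ E.
Let bF : bmeas F := bmeas_domain OmegaT sp.
Let bG k : bmeas (G k) := bmeas_interiors OmegaT sp [:: k].

(* Each factor [1 + eta] of the dilation contracts the support towards x0: one
   takes the closure of Omega into Omega, the other makes room for the
   mollification. *)
Definition shrink (eta : R) x := (1 + eta) ^+ 2 *: x + (x0 - (1 + eta) ^+ 2 *: x0).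
Definition shrunk eta x := conv F (mol (eta * r)) (shrink eta x).

(** If the mollification does not vanish at y = [shrink eta x], some w of Omega is within eta * r of
    y. The point in question is a convex combination, with weights 1/(1+eta) and eta/(1+eta), of w
    and of [x0 + eta^-1 *: (y - w)], which lies in the ball about [x0]. *)
Lemma shrink_supp eta x : 0 < eta -> shrunk eta x != 0 ->
  closure Omega ((1 + eta) *: x + (x0 - (1 + eta) *: x0)).
Proof.
move=> eta0; have er : 0 < eta * r by rewrite mulr_gt0.
apply: contra_neqP => h.
set y := shrink eta x.
rewrite /shrunk /conv -[RHS](Int0 R n); apply: eq_Rintegral => w _.
rewrite /F patchE; case: ifPn => [/set_mem Ow|_]; last by rewrite mul0r.
have [yw|yw] := leP (eta * r) `|y - w|; first by rewrite mol_eq0// mulr0.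
exfalso; apply: h; apply: subset_closure.
have e1 : 0 < 1 + eta by rewrite ltr_wpDr// ltW.
have zO : Omega (x0 + eta^-1 *: (y - w)).
  apply: x0O; rewrite opprD addNKr normrN normrZ gtr0_norm ?invr_gt0//.
  by rewrite mulrC ltr_pdivrMr// mulrC.
have := domain_convex OmegaT (t := (1 + eta)^-1) Ow zO.
rewrite invr_ge0 (ltW e1)/= invf_le1// lerDl (ltW eta0) => /(_ isT).
congr Omega; apply/rowP => i; rewrite /y /shrink !mxE; field.
by rewrite !gt_eqF.
Qed.

(** The support lies in the preimage of the closure of Omega under A, the dilation by 1 + eta about
    [x0]. A point x of this compact set is a combination of A x and [x0] with positive weight on
    [x0], hence is in Omega. *)
Lemma shrunk_test eta : 0 < eta -> test_function Omega (shrunk eta).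
Proof.
move=> eta0; have er : 0 < eta * r by rewrite mulr_gt0.
have e1 : 1 < 1 + eta by rewrite ltrDl.
apply/test_functionP; split.
  by apply: Cinf_aff; apply: conv_Cinf => //; exact: mol_test.
pose A (x : 'rV[R]_n) := (1 + eta) *: x + (x0 - (1 + eta) *: x0).
have [q q0 hq] := domain_bounded OmegaT.
exists (A @^-1` closure Omega); split.
- apply: bounded_closed_compact.
    exists (q + `|x0| + `|x0|); split; first exact: num_real.
    move=> M hM x /= /hq Ax; apply: le_trans (ltW hM).
    rewrite -lerBlDr; apply: (@le_trans _ _ `|x - x0|); first exact: lerB_dist.
    apply: (@le_trans _ _ `|A x - x0|); last first.
      by apply: le_trans (ler_normB _ _) _; rewrite lerD2r ltW.
    have -> : A x - x0 = (1 + eta) *: (x - x0).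
      by rewrite /A scalerBr; apply/rowP => i; rewrite !mxE; ring.
    by rewrite normrZ ler_peMl// gtr0_norm ?ltW// (lt_trans _ e1).
  apply: closed_comp; last exact: closed_closure.
  move=> x _; apply: continuousD; last exact: cst_continuous.
  exact: scaler_continuous.
- move=> x /= xA; have i0 : 0 < (1 + eta)^-1 by rewrite invr_gt0 (lt_trans _ e1).
  have i1 : (1 + eta)^-1 < 1 by rewrite invf_lt1// (lt_trans _ e1).
  have x0O' : Omega x0 by apply: x0O; rewrite subrr normr0.
  have := convex_open_closure OmegaT (t := 1 - (1 + eta)^-1) x0O' xA.
  rewrite subr_gt0 i1 lerBlDr lerDl (ltW i0) => /(_ isT); congr Omega.
  apply/rowP => i; rewrite /A !mxE; field; rewrite gt_eqF// (lt_trans _ e1)//.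
move=> x /= xA; apply/eqP; apply: contraT => /(shrink_supp eta0)//.
Qed.

Lemma pder_shrunk eta k x : 0 < eta ->
  pder [:: k] (shrunk eta) x = (1 + eta) ^+ 2 * conv (G k) (mol (eta * r)) (shrink eta x).
Proof.
move=> eta0; have er : 0 < eta * r by rewrite mulr_gt0.
have tm := mol_test n er.
rewrite /shrunk /shrink pder_aff; last exact: conv_Cinf.
congr (_ * _); rewrite pder_conv//; apply: (conv_wder (U := setT)) => //.
  exact: (pw_wder_global OmegaT k sp s0).
have /test_test_function/test_functionP[_ [K [cK _ hK]]] := test_refl (shrink eta x) tm.
by exists K.
Qed.

Lemma shrunk_cvg : exists phi : nat -> 'rV[R]_n -> R,
  [/\ forall m, test_function Omega (phi m),
      Int (fun x => (F x - phi m x) ^+ 2) @[m --> \oo] --> (0 : R) &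
      forall k, Int (fun x => (G k x - pder [:: k] (phi m) x) ^+ 2) @[m --> \oo] --> (0 : R)].
Proof.
pose eta (k : nat) : R := k.+1%:R^-1.
have eta0 k : 0 < eta k by rewrite invr_gt0.
have eta1 k : eta k <= 1 by rewrite invf_le1// ler1n.
have etac : eta @ \oo --> 0 by exact: cvg_harmonic.
have er k : 0 < eta k * r by rewrite mulr_gt0.
have erc : (fun k => eta k * r) @ \oo --> 0.
  by rewrite -[X in _ --> X](mul0r r); apply: cvgM => //; exact: cvg_cst.
have e2c : (1 + eta k) ^+ 2 @[k --> \oo] --> (1 : R).
  rewrite -[X in _ --> X](expr1n _ 2) -[X in X ^+ 2](addr0 1).
  by apply: cvg_sqr; apply: cvgD => //; exact: cvg_cst.
have shc x : shrink (eta k) x @[k --> \oo] --> x.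
  rewrite [X in _ --> X](_ : _ = 1 *: x + (x0 - 1 *: x0)); last by rewrite !scale1r subrr addr0.
  by apply: cvgD; [exact: cvgZr_tmp|apply: cvgB; [exact: cvg_cst|exact: cvgZr_tmp]].
have [q q0 hq] := domain_bounded OmegaT.
have [N [mN N0 hN]] := elem_interiors_conull OmegaT.
have t m := shrunk_test (eta0 m).
have supp0 f : test_function Omega f -> forall x, q <= `|x| -> f x = 0.
  move=> /test_patch <- x qx; rewrite patchE memNset// => /subset_closure/hq.
  by rewrite ltNge qx.
(* Off N a point is either interior to an element or outside the closure of Omega; F and G are
   continuous in both cases, and mollification converges there. *)
have contF x : ~ N x -> {for x, continuous F} /\ forall k, {for x, continuous (G k)}.
  move=> xN; have [cx|cx] := pselect (closure Omega x).
    have Ex := hN x cx xN; have Ox := elem_interiors_sub OmegaT Ex; split=> [|k].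
      have h : \forall w \near x, s w = F w.
        by apply: filterS (open_nbhs_nbhs (conj oO Ox)) => w Ow; rewrite /F patchE mem_set.
      rewrite /prop_for /continuous_at {2}/F patchE mem_set//.
      exact: cvg_trans (near_eq_cvg h) (continuous_domain sp Ox).
    have h : \forall w \near x, pder [:: k] s w = G k w.
      apply: filterS (open_nbhs_nbhs (conj (@elem_interiors_open _ _ T) Ex)) => w Ow.
      by rewrite /G patchE mem_set.
    rewrite /prop_for /continuous_at {2}/G patchE mem_set//.
    exact: cvg_trans (near_eq_cvg h) (@continuous_interiors _ _ _ _ _ _ sp [:: k] _ Ex).
  have h : nbhs x (~` closure Omega).
    by apply: open_nbhs_nbhs; split => //; apply: closed_openC; exact: closed_closure.
  have aux (f : 'rV[R]_n -> R) A : A `<=` Omega -> {for x, continuous (f \_ A)}.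
    move=> AO; have {}h : \forall w \near x, 0 = (f \_ A) w.
      by apply: filterS h => w Ow; rewrite patchE memNset// => /AO/subset_closure.
    rewrite /prop_for /continuous_at patchE memNset; last by move=> /AO/subset_closure.
    apply: cvg_trans (near_eq_cvg h) _; exact: cvg_cst.
  by split=> [|k]; apply: aux => //; exact: (elem_interiors_sub OmegaT).
(* The factor 4 leaves room for $(1+\eta)^2 \le 4$ in the derivatives of [shrunk]; differences are
   then at most 5 M. *)
have dom f (g : nat -> 'rV[R]_n -> R) M : bmeas f -> (forall x, `|f x| <= M) ->
    (forall x, q <= `|x| -> f x = 0) ->
    (forall m, bmeas (g m)) -> (forall m x, `|g m x| <= 4 * M) ->
    (forall m x, q <= `|x| -> g m x = 0) ->
    (forall x, ~ N x -> g m x @[m --> \oo] --> f x) ->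
    Int (fun x => (f x - g m x) ^+ 2) @[m --> \oo] --> (0 : R).
  move=> bf fM f0 bg gM g0 fg; rewrite -[X in _ --> X](Int0 R n).
  apply: (@Int_dominated _ _ (fun m x => (f x - g m x) ^+ 2) _ N ((5 * M) ^+ 2) q) => //.
  - by move=> m; have [] := bmeasMM (bmeasB bf (bg m)) (bmeasB bf (bg m)).
  - move=> m x; rewrite normrX ler_pXn2r ?nnegrE//.
      by apply: le_trans (ler_normB _ _) _; have := fM x; have := gM m x; lra.
    by rewrite mulr_ge0// (le_trans _ (fM x)).
  - by move=> m x qx; rewrite f0// g0// subrr expr0n.
  move=> x xN; have h : f x - g m x @[m --> \oo] --> (0 : R).
    by rewrite -(subrr (f x)); apply: cvgB; [exact: cvg_cst|exact: fg].
  rewrite -[X in _ --> X](expr0n _ 2).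
  exact: cvg_sqr h.
have F0 x : q <= `|x| -> F x = 0.
  by move=> qx; rewrite /F patchE memNset// => /subset_closure/hq; rewrite ltNge qx.
have G0 k x : q <= `|x| -> G k x = 0.
  move=> qx; rewrite /G patchE memNset// => /(elem_interiors_sub OmegaT)/subset_closure/hq.
  by rewrite ltNge qx.
exists (fun m => shrunk (eta m)); split => //.
  have [M [_ [hM _]]] := bF.2.
  have M0 : 0 <= M by apply: le_trans (hM 0).
  apply: (dom _ _ M) => //.
  - by move=> m; exact/test_bmeas/test_function_test/t.
  - move=> m x; apply: (@le_trans _ _ M); first exact: conv_mol_bound.
    by rewrite ler_peMl// ler1n.
  - by move=> m x; exact: supp0.
  by move=> x xN; apply: conv_mol_cvg => //; exact: (contF x xN).1.
move=> k; have [M [_ [hM _]]] := (bG k).2.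
have M0 : 0 <= M by apply: le_trans (hM 0).
apply: (dom _ _ M) => //.
- exact: G0.
- by move=> m; exact: test_bmeas (test_function_test (test_function_pder [:: k] (t m))).
- move=> m x; rewrite pder_shrunk// normrM ler_pM//; last exact: conv_mol_bound.
  rewrite ger0_norm ?sqr_ge0// (_ : 4 = 2 ^+ 2); last by ring.
  by rewrite ler_pXn2r ?nnegrE//; have := eta0 m; have := eta1 m; lra.
- by move=> m x; apply: supp0; exact: test_function_pder.
move=> x xN; rewrite (_ : (fun m => _) = fun m => (1 + eta m) ^+ 2 * conv (G k) (mol (eta m * r)) (shrink (eta m) x)).
  rewrite -[X in _ --> X]mul1r; apply: cvgM => //.
  by apply: conv_mol_cvg => //; exact: (contF x xN).2.
by apply/funext => m; rewrite pder_shrunk.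
Qed.

End shrinking.

Lemma boundary_H10 s p : pw Omega s p -> (forall x, boundary Omega x -> s x = 0) -> H10 Omega s.
Proof.
move=> sp s0; have sw := pw_weak1 sp; split; first exact: (weak1_sobolev oO sw).
move=> e e0; have [x0 Ox0] := meshed_neq0 OmegaT.
have /nbhs_ballP[r /= r0 hr] := open_nbhs_nbhs (conj oO Ox0).
have [|phi [tphi h0 hk]] := @shrunk_cvg s p sp s0 x0 r r0.
  by move=> y xy; apply: hr; rewrite ball_rVE /= distrC.
have : h1norm2 Omega (s \- phi m) (fun k x => (pder [:: k] s \_ E) x - pder [:: k] (phi m) x)
    @[m --> \oo] --> (0 : R).
  rewrite [X in _ --> X](_ : 0 = 0 + \sum_(k < n) (0 : R)); last by rewrite big1// addr0.
  apply: cvgD; last by apply: cvg_big => //; exact: add_continuous.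
  apply: cvg_trans h0; apply: near_eq_cvg; apply: nearW => m.
  apply: eq_Rintegral => x _; congr (_ ^+ 2).
  rewrite -[in LHS](test_patch (tphi m)) !patchE; case: ifPn => // _.
  by rewrite subr0.
move=> /cvgr_lt/(_ (e ^+ 2)); rewrite exprn_gt0// => /(_ isT)[m _ /(_ m (leqnn m)) hm].
suff W : (Wnorm 1 2%:E Omega (s \- phi m)%R < e%:E)%E by exists (phi m); split; [exact: tphi|exact: W].
rewrite (Wnorm_weak1 oO (weak1B sw (test_weak1 (tphi m)))) lte_fin.
by rewrite -[ltRHS](gtr0_norm e0) -sqrtr_sqr ltr_sqrt ?exprn_gt0.
Qed.

End boundary_values.

(** * Determinants and the divergence form *)

Section cofactors.
Variable R : realType.

Lemma cofactor2E (A : 'M[R]_2) (i j : 'I_2) :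
  cofactor A i j = (-1) ^+ (i + j) * A (i + 1) (j + 1).
Proof.
rewrite /cofactor det_mx11 !mxE; congr (_ * A _ _); apply/val_inj.
  by case: i => -[|[|]].
by case: j => -[|[|]].
Qed.

Lemma det2E (A : 'M[R]_2) : \det A = A 0 0 * A 1 1 - A 0 1 * A 1 0.
Proof.
pose a (k l : nat) := A (inord k) (inord l).
have aE (k l : 'I_2) : A k l = a k l by rewrite /a !inord_val.
rewrite (expand_det_row _ 0) !(big_ord_recl, big_ord0) !cofactor2E !aE /=; ring.
Qed.

(** Indices are added modulo 3: taking rows and columns in cyclic order absorbs the sign. *)
Lemma cofactor3E (A : 'M[R]_3) (i j : 'I_3) :
  cofactor A i j = A (i + 1) (j + 1) * A (i + 2) (j + 2) - A (i + 1) (j + 2) * A (i + 2) (j + 1).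
Proof.
pose a (k l : nat) := A (inord k) (inord l).
have aE (k l : 'I_3) : A k l = a k l by rewrite /a !inord_val.
rewrite /cofactor det2E !mxE !aE.
by case: i => -[|[|[|//]]] i3; case: j => -[|[|[|//]]] j3; rewrite /= /bump /=; ring.
Qed.

Lemma big_ord3 (V : nmodType) (F : 'I_3 -> V) : \sum_i F i = F 0 + F 1 + F 2.
Proof.
rewrite !big_ord_recl big_ord0 addr0 addrA.
by congr (F _ + F _ + F _); apply/val_inj.
Qed.

Lemma big_ord2 (V : nmodType) (F : 'I_2 -> V) : \sum_i F i = F 0 + F 1.
Proof.
rewrite !big_ord_recl big_ord0 addr0.
by congr (F _ + F _); apply/val_inj.
Qed.

Lemma I3_add : [/\ 0 + 1 = 1 :> 'I_3, 0 + 2 = 2 :> 'I_3, 1 + 1 = 2 :> 'I_3, 1 + 2 = 0 :> 'I_3 &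
  2 + 1 = 0 :> 'I_3 /\ 2 + 2 = 1 :> 'I_3].
Proof. by split; try split; apply/val_inj. Qed.

Lemma det3E (A : 'M[R]_3) : \det A = A 0 0 * (A 1 1 * A 2 2 - A 1 2 * A 2 1) +
  A 0 1 * (A 1 2 * A 2 0 - A 1 0 * A 2 2) + A 0 2 * (A 1 0 * A 2 1 - A 1 1 * A 2 0).
Proof.
have [e1 e2 e3 e4 [e5 e6]] := I3_add.
by rewrite (expand_det_row _ 0) big_ord3 !cofactor3E !(e1, e2, e3, e4, e5, e6).
Qed.

(** The Frobenius product A : B. *)
Definition ddot n (A B : 'M[R]_n) : R := \sum_i \sum_j A i j * B i j.

(** The Taylor expansion of det at A in the direction -B; in dimension 2 it stops at second
    order. *)
Lemma det_taylor2 (A B : 'M[R]_2) : \det (A - B) - \det A + ddot (cof A) B = \det B.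
Proof.
have e : 1 + 1 = 0 :> 'I_2 by apply/val_inj.
rewrite /ddot !big_ord2 !mxE !cofactor2E !det2E !mxE !(add0r, e) /=; ring.
Qed.

(** In dimension 3 the remainder has a quadratic and a cubic part in B. *)
Lemma det_taylor3 (A B : 'M[R]_3) :
  \det (A - B) - \det A + ddot (cof A) B = ddot A (cof B) - \det B.
Proof.
have [e1 e2 e3 e4 [e5 e6]] := I3_add.
rewrite /ddot !big_ord3 !mxE !cofactor3E !det3E !mxE !(e1, e2, e3, e4, e5, e6); ring.
Qed.

End cofactors.

Section entrywise_bounds.
Variables (R : realType).

Lemma mul2_bound (a b K L : R) : `|a| <= K -> `|b| <= L -> `|a * b| <= K * L.
Proof. by move=> aK bL; rewrite normrM ler_pM. Qed.

Lemma cof_bound n (A : 'M[R]_n) K : n = 2%N \/ n = 3%N -> 1 <= K ->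
  (forall i j, `|A i j| <= K) -> forall i j, `|cof A i j| <= 2 * K ^+ 2.
Proof.
move=> hn K1 AK i j; have K0 : 0 <= K by exact: le_trans K1.
case: hn => hn; subst n; rewrite mxE.
  rewrite cofactor2E normrM normrX normrN1 expr1n mul1r (le_trans (AK _ _))//.
  nra.
rewrite cofactor3E (le_trans (ler_normB _ _))//.
have := mul2_bound (AK (i + 1) (j + 1)) (AK (i + 2) (j + 2)).
have := mul2_bound (AK (i + 1) (j + 2)) (AK (i + 2) (j + 1)).
by rewrite -expr2; lra.
Qed.

Lemma det_bound n (A : 'M[R]_n) K : n = 2%N \/ n = 3%N ->
  (forall i j, `|A i j| <= K) -> `|\det A| <= 6 * K ^+ n.
Proof.
move=> hn AK; have n0 : (0 < n)%N by case: hn => ->.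
have K0 : 0 <= K by exact: le_trans (AK (Ordinal n0) (Ordinal n0)).
apply: (le_trans (ler_norm_sum _ _ _)).
apply: (@le_trans _ _ (\sum_(s : {perm 'I_n}) K ^+ n)).
  apply: ler_sum => s _; rewrite normrM normrX normrN1 expr1n mul1r normr_prod.
  rewrite -[in leRHS](card_ord n) -prodr_const ler_prod// => i _.
  by rewrite normr_ge0 AK.
(* The constant 6 bounds n! for n = 2 and n = 3. *)
rewrite sumr_const (card_Sn n) -[leLHS]mulr_natl ler_wpM2r ?exprn_ge0// ler_nat.
by case: hn => ->.
Qed.

(** For n = 3, 24 = 18 + 6: nine entries of A against cofactors of B, each of size at most 2 L^2,
    and det B with L^3 <= K L^2. For n = 2 the bound 6 L^2 of det B is enough, as K >= 1. *)
Lemma det_remainder n (A B : 'M[R]_n) K : n = 2%N \/ n = 3%N -> 1 <= K ->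
  (forall i j, `|A i j| <= K) -> forall L, 0 <= L <= K -> (forall i j, `|B i j| <= L) ->
  `|\det (A - B) - \det A + ddot (cof A) B| <= 24 * K * L ^+ 2.
Proof.
move=> hn K1 AK L /andP[L0 LK] BL.
have dB := det_bound hn BL.
case: hn => hn; subst n; rewrite ?det_taylor2 ?det_taylor3.
  by apply: (le_trans dB); nra.
apply: (le_trans (ler_normB _ _)).
have cB i j : `|cofactor B i j| <= 2 * L ^+ 2.
  rewrite cofactor3E (le_trans (ler_normB _ _))//.
  have := mul2_bound (BL (i + 1) (j + 1)) (BL (i + 2) (j + 2)).
  have := mul2_bound (BL (i + 1) (j + 2)) (BL (i + 2) (j + 1)).
  by rewrite -expr2; lra.
have h : `|ddot A (cof B)| <= 18 * K * L ^+ 2.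
  apply: (le_trans (ler_norm_sum _ _ _)).
  apply: (@le_trans _ _ (\sum_(i < 3) \sum_(j < 3) (K * (2 * L ^+ 2)))).
    apply: ler_sum => i _; apply: (le_trans (ler_norm_sum _ _ _)); apply: ler_sum => j _.
    by rewrite mxE; exact: mul2_bound.
  by rewrite !big_ord3; lra.
have : 6 * L ^+ 3 <= 6 * K * L ^+ 2.
  by rewrite exprS mulrA ler_wpM2r ?sqr_ge0// ler_pM2l.
lra.
Qed.

(** For n = 3 a cofactor is a difference of two products, each of which changes by at most 3 K L. *)
Lemma cof_lipschitz n (A B : 'M[R]_n) K : n = 2%N \/ n = 3%N -> 1 <= K ->
  (forall i j, `|A i j| <= K) -> forall L, 0 <= L <= K -> (forall i j, `|B i j| <= L) ->
  forall i j, `|cof (A + B) i j - cof A i j| <= 6 * K * L.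
Proof.
move=> hn K1 AK L /andP[L0 LK] BL i j; rewrite !mxE.
case: hn => hn; subst n.
  rewrite !cofactor2E mxE -mulrBr addrAC subrr add0r normrM normrX normrN1 expr1n mul1r.
  by apply: (le_trans (BL _ _)); nra.
rewrite !cofactor3E !mxE.
set a := A _ _; set b := A _ _; set c := A _ _; set d := A _ _.
set a' := B _ _; set b' := B _ _; set c' := B _ _; set d' := B _ _.
have -> : (a + a') * (b + b') - (c + c') * (d + d') - (a * b - c * d) =
  (a * b' + a' * b + a' * b') - (c * d' + c' * d + c' * d') by ring.
have h (x y x' y' : R) : `|x| <= K -> `|y| <= K -> `|x'| <= L -> `|y'| <= L ->
    `|x * y' + x' * y + x' * y'| <= 3 * K * L.
  move=> xK yK xL yL; have h1 := mul2_bound xK yL; have h2 := mul2_bound xL yK.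
  have h3 := mul2_bound xL yL; have h4 : L * L <= K * L by rewrite ler_wpM2r.
  apply: (le_trans (ler_normD _ _)); have := ler_normD (x * y') (x' * y).
  by move: h2; rewrite [L * K]mulrC; lra.
apply: (le_trans (ler_normB _ _)).
have := h a b a' b' (AK _ _) (AK _ _) (BL _ _) (BL _ _).
have := h c d c' d' (AK _ _) (AK _ _) (BL _ _) (BL _ _).
lra.
Qed.

End entrywise_bounds.

Section matrix_limits.
Variables (R : realType) (I : Type) (F : set_system I).
Context {FF : Filter F}.

Lemma cvg_det n (A_ : I -> 'M[R]_n) (A : 'M[R]_n) :
  (forall i j, A_ s i j @[s --> F] --> A i j) -> \det (A_ s) @[s --> F] --> \det A.
Proof.
move=> h; rewrite /determinant; apply: cvg_big => [|s _]; first exact: add_continuous.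
apply: cvgM; first exact: cvg_cst.
by apply: cvg_big => [|i _]; [exact: mul_continuous|exact: h].
Qed.

Lemma cvg_cof n (A_ : I -> 'M[R]_n) (A : 'M[R]_n) i j :
  (forall i j, A_ s i j @[s --> F] --> A i j) -> cof (A_ s) i j @[s --> F] --> cof A i j.
Proof.
move=> h; rewrite mxE; under eq_fun do rewrite mxE.
apply: cvgM; first exact: cvg_cst.
apply: cvg_det => k l; rewrite !mxE; under eq_fun do rewrite !mxE.
exact: h.
Qed.

End matrix_limits.

(** * Positive definite matrices and their cofactors *)

Section positive_definite.
Variables (R : realType) (n : nat).

Definition qform (A : 'M[R]_n) (xi : 'cV[R]_n) : R := (xi^T *m A *m xi) 0 0.

Definition posdef (A : 'M[R]_n) := forall xi, xi != 0 -> 0 < qform A xi.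

Lemma posdef_det_neq0 A : posdef A -> \det A != 0.
Proof.
move=> pA; apply/negP => /eqP/eqP/det0P[v v0 vA].
have : v^T != 0 by rewrite -trmx0 (inj_eq trmx_inj).
by move/pA; rewrite /qform trmxK vA mul0mx mxE ltxx.
Qed.

(** The segment from the identity to A consists of positive definite matrices, so det does not
    vanish on it; the intermediate value theorem fixes the sign. *)
Lemma posdef_det_gt0 A : posdef A -> 0 < \det A.
Proof.
move=> pA; pose B (t : R) := (1 - t) *: 1%:M + t *: A.
have pB t : 0 <= t <= 1 -> posdef (B t).
  move=> /andP[t0 t1] xi xi0; have p1 : 0 < qform 1%:M xi.
    rewrite /qform mulmx1 mxE.
    have /existsP[i xii] : [exists i, xi i 0 != 0].
      apply: contraT => /existsPn h; case/eqP: xi0; apply/matrixP => i j.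
      by rewrite ord1 mxE; apply/eqP; have := h i; rewrite negbK.
    rewrite (bigD1 i)//= ltr_wpDr//; last by rewrite mxE -expr2 exprn_even_gt0.
    by apply: sumr_ge0 => k _; rewrite mxE -expr2 sqr_ge0.
  have -> : qform (B t) xi = (1 - t) * qform 1%:M xi + t * qform A xi.
    by rewrite /qform /B mulmxDr mulmxDl -!scalemxAr -!scalemxAl !mxE.
  have pAx := pA xi xi0.
  have [->|tn0] := eqVneq t 0; first by rewrite subr0 mul1r mul0r addr0.
  have tp : 0 < t by rewrite lt_neqAle eq_sym tn0.
  by rewrite ltr_wpDl ?mulr_gt0// mulr_ge0 ?subr_ge0// ltW.
have B0 : B 0 = 1%:M by rewrite /B subr0 scale1r scale0r addr0.
have B1 : B 1 = A by rewrite /B subrr scale1r scale0r add0r.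
rewrite ltNge; apply/negP => dA.
have cB : continuous (fun t => \det (B t)).
  move=> t; apply: cvg_det => i j; rewrite /B !mxE.
  under eq_fun do rewrite !mxE.
  apply: cvgD; (apply: cvgM; last exact: cvg_cst); last exact: cvg_id.
  by apply: cvgB; [exact: cvg_cst|exact: cvg_id].
have [] := @IVT _ (fun t => \det (B t)) 0 1 0 ler01.
- exact: continuous_subspaceT.
- by rewrite B0 B1 det1 ge_min le_max ler01 dA orbT.
move=> c; rewrite in_itv /= => c01 dc.
by have := posdef_det_neq0 (pB c c01); rewrite dc eqxx.
Qed.

(** With y = adj(A) xi one has A y = det(A) xi, hence $y^T A y = \det(A)\, \xi^T \mathrm{cof}(A)\,
    \xi$. *)
Lemma posdef_cof A : posdef A -> posdef (cof A).
Proof.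
move=> pA xi xi0; have dA := posdef_det_gt0 pA.
pose y := \adj A *m xi.
have Ay : A *m y = \det A *: xi by rewrite mulmxA mul_mx_adj mul_scalar_mx.
have y0 : y != 0.
  apply: contra_neq xi0 => y0; move: Ay; rewrite y0 mulmx0 => /esym/eqP.
  by rewrite scaler_eq0 gt_eqF//= => /eqP.
have := pA y y0; rewrite /qform -mulmxA Ay -scalemxAr mxE pmulr_rgt0//.
rewrite /y trmx_mul (_ : (\adj A)^T = cof A)//.
by apply/matrixP => i j; rewrite !mxE.
Qed.

End positive_definite.

Section compact_sets.
Variables (R : realType) (n : nat).

Lemma compact_cball (c : 'rV[R]_n) (r : R) : compact [set y | `|c - y| <= r].
Proof.
apply: bounded_closed_compact.
  exists (`|c| + r); split; first exact: num_real.
  move=> M hM y /= yr; apply: le_trans (ltW hM).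
  by rewrite -lerBlDl (le_trans _ yr)// distrC lerB_dist.
apply: (closed_comp (f := fun y : 'rV[R]_n => `|c - y|) (D := [set t | t <= r])); last exact: closed_le.
move=> y _; apply: (@cvg_norm _ _ _ (nbhs y) _ (fun y => c - y)).
by apply: cvgB; [exact: cvg_cst|exact: cvg_id].
Qed.

Lemma compact_margin (K U : set 'rV[R]_n) : compact K -> open U -> K `<=` U ->
  exists2 d : R, 0 < d & forall x, K x -> forall y, `|x - y| <= d -> U y.
Proof.
move=> /compact_near_coveringP cK oU KU.
have : \forall d \near 0^'+, forall x, K x -> forall y, `|x - y| <= (d : R) -> U y.
  apply: cK => x Kx.
  have /nbhs_ballP[r /= r0 hr] := open_nbhs_nbhs (conj oU (KU _ Kx)).
  have r2 : 0 < r / 2 by rewrite divr_gt0.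
  exists ([set z | `|x - z| < r / 2], [set d : R | d < r / 2]) => /=.
    split; first by apply/nbhs_ballP; exists (r / 2) => // z; rewrite ball_rVE /= distrC.
    exact: nbhs_right_lt.
  move=> [z d] /= [xz dr] y zy; apply: hr; rewrite ball_rVE /= distrC.
  rewrite -(subrK z x) -addrA (le_lt_trans (ler_normD _ _))// (splitr r) ltrD//.
  exact: le_lt_trans dr.
move=> h; near (0 : R)^'+ => d; exists d; first by [].
by near: d.
Unshelve. all: by end_near. Qed.

End compact_sets.

Section piola.
Variables (R : realType).

Lemma Cinf_cof n (w : 'rV[R]_n -> R) i j : Cinf w -> Cinf (fun x => cof (hessian w x) i j).
Proof.
move=> cw; rewrite (_ : (fun x => _) = fun x => (-1) ^+ (i + j) *
  \sum_(s : {perm 'I_n.-1}) (-1) ^+ s *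
    \prod_k pder [:: lift i k; lift j (s k)] w x).
  apply: CinfM; first exact: Cinf_cst.
  apply: Cinf_sum => s; apply: CinfM; first exact: Cinf_cst.
  by apply: Cinf_prod => k; exact: (Cinf_pder [:: lift i k; lift j (s k)] cw).
apply/funext => x; rewrite mxE /cofactor /determinant; congr (_ * _).
by apply: eq_bigr => s _; congr (_ * _); apply: eq_bigr => k _; rewrite !mxE.
Qed.

Lemma pder_minor n (a b c d : 'rV[R]_n -> R) i x : Cinf a -> Cinf b -> Cinf c -> Cinf d ->
  pder [:: i] (fun y => a y * b y - c y * d y) x =
  pder [:: i] a x * b x + a x * pder [:: i] b x - (pder [:: i] c x * d x + c x * pder [:: i] d x).
Proof.
move=> ca cb cc cd; rewrite -(pderM i x ca cb) -(pderM i x cc cd).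
rewrite -mulN1r -(pderZ (-1) i x (CinfM cc cd)).
rewrite -(pderD i x (CinfM ca cb) (CinfM (Cinf_cst n (-1)) (CinfM cc cd))).
by congr (pder [:: i] _ x); apply/funext => y; rewrite mulN1r.
Qed.

(* The rows of the cofactor matrix of a Hessian are divergence free. *)
Lemma piola n (w : 'rV[R]_n -> R) j x : n = 2%N \/ n = 3%N -> Cinf w ->
  (forall k i l, pder [:: k; i; l] w = pder [:: i; k; l] w) ->
  \sum_i pder [:: i] (fun y => cof (hessian w y) i j) x = 0.
Proof.
move=> hn cw sw; have cp k l := Cinf_pder [:: k; l] cw.
case: hn => hn; subst n.
  have h i : pder [:: i] (fun y => cof (hessian w y) i j) x =
      (-1) ^+ (i + j) * pder [:: i; i + 1; j + 1] w x.
    rewrite (_ : (fun y => _) = fun y => (-1) ^+ (i + j) * pder [:: i + 1; j + 1] w y).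
      by rewrite pderZ.
    by apply/funext => y; rewrite mxE cofactor2E mxE.
  have e : 1 + 1 = 0 :> 'I_2 by apply/val_inj.
  rewrite big_ord2 !h add0r e sw; case: j {h} => -[|[|//]] j2; rewrite /=; ring.
have h i : pder [:: i] (fun y => cof (hessian w y) i j) x =
    pder [:: i; i + 1; j + 1] w x * pder [:: i + 2; j + 2] w x +
    pder [:: i + 1; j + 1] w x * pder [:: i; i + 2; j + 2] w x -
    (pder [:: i; i + 1; j + 2] w x * pder [:: i + 2; j + 1] w x +
     pder [:: i + 1; j + 2] w x * pder [:: i; i + 2; j + 1] w x).
  rewrite -(pder_minor i x (cp _ _) (cp _ _) (cp _ _) (cp _ _)).
  by congr (pder [:: i] _ x); apply/funext => y; rewrite mxE cofactor3E !mxE.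
have [e1 e2 e3 e4 [e5 e6]] := I3_add.
rewrite big_ord3 !h !(e1, e2, e3, e4, e5, e6).
(* H stands for the second and D for the third derivatives: symmetry of D in its first two indices
   makes the terms cancel in pairs. *)
have alg (H : 'I_3 -> 'I_3 -> R) (D : 'I_3 -> 'I_3 -> 'I_3 -> R) (c d : 'I_3) :
    (forall k i l, D k i l = D i k l) ->
    D 0 1 c * H 2 d + H 1 c * D 0 2 d - (D 0 1 d * H 2 c + H 1 d * D 0 2 c) +
    (D 1 2 c * H 0 d + H 2 c * D 1 0 d - (D 1 2 d * H 0 c + H 2 d * D 1 0 c)) +
    (D 2 0 c * H 1 d + H 0 c * D 2 1 d - (D 2 0 d * H 1 c + H 0 d * D 2 1 c)) = 0.
  by move=> sD; rewrite !(sD 1 0) !(sD 2 0) !(sD 2 1); ring.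
apply: (alg (fun k l => pder [:: k; l] w x) (fun k i l => pder [:: k; i; l] w x)).
by move=> k i l; rewrite sw.
Qed.

End piola.

(** * The linearised operator in divergence and non-divergence form *)

Section divergence_form.
Variables (R : realType) (n : nat) (Omega : set 'rV[R]_n) (T : mesh R n).
Hypotheses (hn : n = 2%N \/ n = 3%N) (OmegaT : meshed Omega T).
Local Notation mu := (lebesgue_rV R n).
Local Notation Int f := (Rintegral mu setT f).
Local Notation E := (elem_interiors T).
Implicit Types (s phi psi : 'rV[R]_n -> R) (p q : 'I_(nelem T) -> 'rV[R]_n -> R).

Let oO := meshed_open OmegaT.

Lemma bmeas_on_interiors (f : 'rV[R]_n -> R) M : (forall x, E x -> {for x, continuous f}) ->
  (forall x, E x -> `|f x| <= M) -> bmeas (f \_ E).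
Proof.
move=> cf fM; have [r r0 hr] := domain_bounded OmegaT.
apply: (@bmeas_patch _ _ _ _ M r) => //.
- exact: measurable_elem_interiors.
- apply: continuous_on_open_measurable; first exact: elem_interiors_open.
  exact: cf.
- by move=> x /(elem_interiors_sub OmegaT)/subset_closure; exact: hr.
Qed.

Lemma hessianE s i j x : hessian s x i j = pder [:: i; j] s x.
Proof. by rewrite mxE. Qed.

Lemma hessian_bound s p : pw Omega s p ->
  exists2 K, 1 <= K & forall x, E x -> forall i j, `|hessian s x i j| <= K.
Proof.
move=> sp; have /choice[M hM] : forall ij : 'I_n * 'I_n, exists M, 0 <= M /\
    forall x, E x -> `|pder [:: ij.1; ij.2] s x| <= M.
  by move=> ij; have [M M0 h] := bounded_interiors OmegaT sp [:: ij.1; ij.2]; exists M.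
exists (1 + \sum_ij M ij); first by rewrite lerDl sumr_ge0// => i _; exact: (hM i).1.
move=> x Ex i j; rewrite mxE; apply: (le_trans ((hM (i, j)).2 x Ex)).
rewrite (bigD1 (i, j))//= addrCA lerDl addr_ge0// sumr_ge0// => k _; exact: (hM k).1.
Qed.

Lemma continuous_hessian s p i j x : pw Omega s p -> E x ->
  {for x, continuous (fun y => hessian s y i j)}.
Proof.
move=> sp Ex; rewrite (_ : (fun y => _) = pder [:: i; j] s).
  exact: (@continuous_interiors _ _ _ _ _ _ sp [:: i; j] _ Ex).
by apply/funext => y; rewrite mxE.
Qed.

Lemma continuous_cof_hessian s p i j x : pw Omega s p -> E x ->
  {for x, continuous (fun y => cof (hessian s y) i j)}.
Proof.
move=> sp Ex; have h k l := @continuous_hessian _ _ k l _ sp Ex.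
exact: (@cvg_cof _ _ (nbhs x) _ n (hessian s) (hessian s x) i j h).
Qed.

Lemma bmeas_cof_hessian s p i j : pw Omega s p -> bmeas ((fun y => cof (hessian s y) i j) \_ E).
Proof.
move=> sp; have [K K1 hK] := hessian_bound sp.
apply: (@bmeas_on_interiors _ (2 * K ^+ 2)).
  by move=> x Ex; exact: continuous_cof_hessian sp Ex.
by move=> x Ex; apply: cof_bound => //; exact: hK.
Qed.

Section mollified_hessian.
Variables (v : 'rV[R]_n -> R) (pv : 'I_(nelem T) -> 'rV[R]_n -> R) (vp : pw Omega v pv).
Variables (d : R) (d0 : 0 < d).
Let F := v \_ Omega.
Let bF : bmeas F := bmeas_domain OmegaT vp.

Let mt : test (mol d) := mol_test n d0.

Lemma pder_mol_support (l : seq 'I_n) U x : (forall y, `|x - y| <= d -> U y) ->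
  exists K, [/\ compact K, K `<=` U & forall y, ~ K y -> pder l (mol d) (x - y) = 0].
Proof.
move=> xU; exists [set y | `|x - y| <= d]; split => //; first exact: compact_cball.
move=> y /= /negP; rewrite -ltNge => dxy; apply: pder_eq0.
have : \forall z \near x - y, d < `|z|.
  by apply: (cvgr_gt _ (@norm_continuous _ _ (x - y))).
by apply: filterS => z dz; apply: mol_eq0 => //; exact: ltW.
Qed.

(** The derivatives of the kernel are passed to v one after the other, first j and then i; the
    symmetry of the kernel's derivatives brings them into this order. The intermediate functions,
    restricted to E and to Omega, differ on a null set. *)
Lemma pder2_conv_mol i j x : (forall y, `|x - y| <= d -> Omega y) ->
  pder [:: i; j] (conv F (mol d)) x = conv (pder [:: i; j] v \_ E) (mol d) x.
Proof.
move=> xO; rewrite pder_conv// (bump_sym [::] i j d0).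
rewrite -[pder [:: j; i] _]/(pder [:: j] (pder [:: i] (mol d))).
rewrite (conv_wder (U := Omega) (G := pder [:: j] v \_ E))//; last 4 first.
- exact: (bmeas_interiors OmegaT vp [:: j]).
- exact: (pw_wder OmegaT j vp).
- exact: test_pder.
- exact: pder_mol_support.
rewrite -(conv_wder (U := Omega) (F := pder [:: j] v \_ Omega) (i := i)
  (G := pder [:: i; j] v \_ E) (rho := mol d))//; last 4 first.
- exact: (bmeas_pder1 OmegaT vp).
- exact: (bmeas_interiors OmegaT vp [:: i; j]).
- exact: (pw_wder2 OmegaT j i vp).
- exact: (pder_mol_support [::]).
have [N [mN N0 hN]] := elem_interiors_conull OmegaT.
have tm := test_pder [:: i] mt.
apply: (@Int_ae_eq _ _ _ _ N) => //.
- by have [] := conv_bmeas x (bmeas_interiors OmegaT vp [:: j]) tm.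
- by have [] := conv_bmeas x (bmeas_pder1 OmegaT vp j) tm.
move=> y Ny; congr (_ * _); rewrite !patchE; have [Oy|Oy] := pselect (Omega y).
  by rewrite !mem_set//; exact: (hN _ (subset_closure Oy)).
by rewrite !memNset// => /(elem_interiors_sub OmegaT).
Qed.

End mollified_hessian.

Variables (v p : 'rV[R]_n -> R) (pv pp : 'I_(nelem T) -> 'rV[R]_n -> R).
Hypotheses (vp : pw Omega v pv) (ppw : pw Omega p pp).

Let C i j := (fun y => cof (hessian v y) i j) \_ E.

Let bC i j : bmeas (C i j) := bmeas_cof_hessian i j vp.
Let bp1 j : bmeas (pder [:: j] p \_ Omega) := bmeas_pder1 OmegaT ppw j.
Let bp2 i j : bmeas (pder [:: i; j] p \_ E) := bmeas_interiors OmegaT ppw [:: i; j].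

(** Mollifying v with radius at most the distance d from the support K of phi to the complement of
    Omega makes the Hessian of [w m] on K an average of that of v: bounded by [k0], and convergent
    on E. The identity for [w m] then passes to the limit by dominated convergence. *)
Lemma divergence_test phi : test_function Omega phi ->
  \sum_j \sum_i Int (fun x => (pder [:: j] p \_ Omega) x * (pder [:: i] phi x * C i j x)) =
  - \sum_j \sum_i Int (fun x => (pder [:: i; j] p \_ E) x * (phi x * C i j x)).
Proof.
move=> tphi; have t := test_function_test tphi.
have /test_functionP[_ [K [cK KO phiK]]] := tphi.
have [d d0 hd] := compact_margin cK oO KO.
pose e (m : nat) : R := d * m.+1%:R^-1.
have e0 m : 0 < e m by rewrite mulr_gt0 ?invr_gt0.
have ed m : e m <= d by rewrite ger_pMr// invf_le1// ler1n.
have ec : e @ \oo --> 0.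
  by rewrite -[X in _ --> X](mulr0 d); apply: cvgM; [exact: cvg_cst|exact: cvg_harmonic].
pose w m := conv (v \_ Omega) (mol (e m)).
have bF := bmeas_domain OmegaT vp.
have cw m : Cinf (w m) by apply: conv_Cinf => //; exact: mol_test.
pose D m i j x := cof (hessian (w m) x) i j.
have cD m i j : Cinf (D m i j) by exact: Cinf_cof.
have [k0 k1 hk] := hessian_bound vp.
have hw m i j x : K x -> pder [:: i; j] (w m) x = conv (pder [:: i; j] v \_ E) (mol (e m)) x.
  move=> Kx; apply: (pder2_conv_mol vp (e0 m)) => // y xy; apply: (hd _ Kx).
  exact: le_trans xy (ed m).
have Db m i j x : K x -> `|D m i j x| <= 2 * k0 ^+ 2.
  move=> Kx; apply: cof_bound => // k l; rewrite mxE hw//; apply: conv_mol_bound => // [|y].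
    exact: (bmeas_interiors OmegaT vp [:: k; l]).
  rewrite patchE; case: ifPn => [/set_mem Ey|_]; last by rewrite normr0 (le_trans _ k1).
  by have := hk y Ey k l; rewrite mxE.
have Dc i j x : K x -> E x -> D m i j x @[m --> \oo] --> C i j x.
  move=> Kx Ex; rewrite /C patchE mem_set//; apply: cvg_cof => k l.
  have -> : (fun m => hessian (w m) x k l) = fun m => conv (pder [:: k; l] v \_ E) (mol (e m)) x.
    by apply/funext => m; rewrite hessianE hw.
  have -> : hessian v x k l = (pder [:: k; l] v \_ E) x.
    by rewrite hessianE; apply/esym; rewrite patchE mem_set.
  apply: (conv_mol_cvg (z := fun=> x)) => //; [exact: (bmeas_interiors OmegaT vp [:: k; l])|exact: cvg_cst|].
  have h : \forall z \near x, pder [:: k; l] v z = (pder [:: k; l] v \_ E) z.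
    apply: filterS (open_nbhs_nbhs (conj (@elem_interiors_open _ _ T) Ex)) => z Ez.
    by rewrite patchE mem_set.
  rewrite /prop_for /continuous_at patchE mem_set//.
  exact: cvg_trans (near_eq_cvg h) (@continuous_interiors _ _ _ _ _ _ vp [:: k; l] _ Ex).
have step m : \sum_j \sum_i Int (fun x => (pder [:: j] p \_ Omega) x * (pder [:: i] phi x * D m i j x)) =
  - \sum_j \sum_i Int (fun x => (pder [:: i; j] p \_ E) x * (phi x * D m i j x)).
  have tD i j := test_functionM tphi (cD m i j).
  have bphiD i j (a b : seq 'I_n) : bmeas (fun x => pder a phi x * pder b (D m i j) x).
    apply: test_bmeas; apply: testM; last exact: Cinf_pder.
    exact: test_pder.
  rewrite -sumrN; apply: eq_bigr => j _; rewrite -sumrN.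
  have h i : - Int (fun x => (pder [:: i; j] p \_ E) x * (phi x * D m i j x)) =
      Int (fun x => (pder [:: j] p \_ Omega) x * (pder [:: i] phi x * D m i j x)) +
      Int (fun x => (pder [:: j] p \_ Omega) x * (phi x * pder [:: i] (D m i j) x)).
    rewrite -(pw_wder2 OmegaT j i ppw (tD i j)) -IntD.
    - apply: eq_Rintegral => x _; rewrite -mulrDr; congr (_ * _).
      by rewrite (pderM i x t.1 (cD m i j)).
    - exact: bmeasMM (bp1 j) (bphiD i j [:: i] [::]).
    - exact: bmeasMM (bp1 j) (bphiD i j [::] [:: i]).
  rewrite (eq_bigr _ (fun i _ => h i)) big_split -[LHS]addr0; congr (_ + _).
  rewrite -Int_sum; last by move=> i _; exact: bmeasMM (bp1 j) (bphiD i j [::] [:: i]).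
  rewrite -[LHS](Int0 R n); apply: eq_Rintegral => x _.
  (* The terms in which the derivative falls on the cofactors cancel by the Piola identity. *)
  have P : \sum_i pder [:: i] (D m i j) x = 0.
    apply: (piola j x hn (cw m)) => k i l.
    by rewrite !(pder_conv _ bF (mol_test n (e0 m))) (bump_sym [:: l] k i (e0 m)).
  by rewrite -mulr_sumr -mulr_sumr P !mulr0.
have [N [mN N0 hN]] := elem_interiors_conull OmegaT.
have lim (g z : 'rV[R]_n -> R) i j : bmeas g -> bmeas z -> Cinf z -> (forall x, ~ K x -> z x = 0) ->
    Int (fun x => g x * (z x * D m i j x)) @[m --> \oo] --> Int (fun x => g x * (z x * C i j x)).
  move=> bg bz cz zK.
  have [Mg [_ [hMg _]]] := bg.2; have [Mz [_ [hMz _]]] := bz.2.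
  have [r r0 hr] := domain_bounded OmegaT.
  apply: (@Int_dominated _ _ (fun m x => g x * (z x * D m i j x)) _ N (Mg * (Mz * (2 * k0 ^+ 2))) r) => //.
  - move=> m; apply: measurable_funM; first exact: bg.1.
    apply: measurable_funM; first exact: bz.1.
    by apply: continuous_rV_measurable; exact: Cinf_continuous.
  - by have [] := bmeasMM bg (bmeasMM bz (bC i j)).
  - move=> m x; apply: mul2_bound => //; have [Kx|Kx] := pselect (K x).
      by apply: mul2_bound => //; exact: Db.
    rewrite zK// mul0r normr0 mulr_ge0 ?(le_trans (normr_ge0 _) (hMz x))//.
    by rewrite mulr_ge0 ?sqr_ge0.
  - move=> m x rx; rewrite zK ?mul0r ?mulr0// => /KO/subset_closure/hr.
    by rewrite ltNge rx.
  move=> x Nx; apply: cvgM; first exact: cvg_cst.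
  have [Kx|Kx] := pselect (K x).
    apply: cvgM; first exact: cvg_cst.
    by apply: Dc => //; exact: (hN _ (subset_closure (KO _ Kx))).
  rewrite zK// mul0r; under eq_fun do rewrite mul0r; exact: cvg_cst.
have dphiK i x : ~ K x -> pder [:: i] phi x = 0.
  move=> Kx; apply: pder_eq0.
  have oK : open (~` K) by apply: closed_openC; apply: compact_closed => //; exact: norm_hausdorff.
  by apply: filterS (open_nbhs_nbhs (conj oK Kx)) => y; exact: phiK.
have l1 : \sum_j \sum_i Int (fun x => (pder [:: j] p \_ Omega) x * (pder [:: i] phi x * D m i j x))
    @[m --> \oo] --> \sum_j \sum_i Int (fun x => (pder [:: j] p \_ Omega) x * (pder [:: i] phi x * C i j x)).
  apply: cvg_big => [|j _]; first exact: add_continuous.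
  apply: cvg_big => [|i _]; first exact: add_continuous.
  apply: lim => //; [exact: test_bmeas (test_pder [:: i] t)|exact: Cinf_pder t.1|exact: dphiK].
have l2 : - \sum_j \sum_i Int (fun x => (pder [:: i; j] p \_ E) x * (phi x * D m i j x))
    @[m --> \oo] --> - \sum_j \sum_i Int (fun x => (pder [:: i; j] p \_ E) x * (phi x * C i j x)).
  apply: cvgN; apply: cvg_big => [|j _]; first exact: add_continuous.
  apply: cvg_big => [|i _]; first exact: add_continuous.
  by apply: lim => //; [exact: test_bmeas|exact: t.1].
rewrite (_ : (fun m => _) = fun m => - \sum_j \sum_i Int (fun x => (pder [:: i; j] p \_ E) x * (phi x * D m i j x))) in l1; last first.
  by apply/funext => m; exact: step.
exact: (cvg_unique _ l1 l2).
Qed.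

Lemma divergence_H10 psi q : pw Omega psi q -> H10 Omega psi ->
  \sum_j \sum_i Int (fun x => (pder [:: j] p \_ Omega) x * ((pder [:: i] psi \_ E) x * C i j x)) =
  - \sum_j \sum_i Int (fun x => (pder [:: i; j] p \_ E) x * ((psi \_ Omega) x * C i j x)).
Proof.
move=> hq h0; apply/eqP; rewrite -subr_eq0 opprK -normr_le0; set X := _ + _.
pose c1 i j := fun x => (pder [:: j] p \_ Omega) x * C i j x.
pose c2 i j := fun x => (pder [:: i; j] p \_ E) x * C i j x.
have b1 i j : bmeas (c1 i j) by exact: bmeasMM.
have b2 i j : bmeas (c2 i j) by exact: bmeasMM.
pose c := \sum_j \sum_i (Num.sqrt (Int (fun x => c1 i j x ^+ 2)) + Num.sqrt (Int (fun x => c2 i j x ^+ 2))).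
have cge0 : 0 <= c.
  by apply: sumr_ge0 => j _; apply: sumr_ge0 => i _; rewrite addr_ge0// sqrtr_ge0.
suff h e : 0 < e -> `|X| <= c * e.
  apply/ler_addgt0Pl => e e0; rewrite addr0.
  have C1 : 0 < c + 1 by rewrite ltr_wpDl.
  apply: (le_trans (h (e / (c + 1)) _)); first by rewrite divr_gt0.
  rewrite mulrCA ler_piMr ?(ltW e0)// ler_pdivrMr// mul1r lerDl//.
move=> e0; have [phi [tphi a0 ak]] := H10_approx OmegaT hq h0 e0.
have t := test_function_test tphi.
have bphi := test_bmeas t; have bdphi i := test_bmeas (test_pder [:: i] t).
have bpsi := bmeas_domain OmegaT hq; have bdpsi i := bmeas_interiors OmegaT hq [:: i].
have -> : X = \sum_j \sum_i (
    Int (fun x => c1 i j x * ((pder [:: i] psi \_ E) x - pder [:: i] phi x)) +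
    Int (fun x => c2 i j x * ((psi \_ Omega) x - phi x))).
  have := divergence_test tphi; move/eqP; rewrite -subr_eq0 opprK => /eqP Y0.
  rewrite -[LHS]subr0 -[X in _ - X = _]Y0 /X opprD addrACA -!sumrB -big_split.
  apply: eq_bigr => j _; rewrite -!sumrB -big_split; apply: eq_bigr => i _.
  have bb (f g : 'rV[R]_n -> R) : bmeas f -> bmeas g -> bmeas (fun x => f x * (g x * C i j x)).
    by move=> bf bg; exact: bmeasMM bf (bmeasMM bg (bC i j)).
  rewrite -(IntB (bb _ _ (bp1 j) (bdpsi i)) (bb _ _ (bp1 j) (bdphi i))).
  rewrite -(IntB (bb _ _ (bp2 i j) bpsi) (bb _ _ (bp2 i j) bphi)).
  by congr (_ + _); apply: eq_Rintegral => x _; rewrite /c1 /c2; ring.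
apply: (le_trans (ler_norm_sum _ _ _)); rewrite mulr_suml; apply: ler_sum => j _.
apply: (le_trans (ler_norm_sum _ _ _)); rewrite mulr_suml; apply: ler_sum => i _.
apply: (le_trans (ler_normD _ _)); rewrite mulrDl lerD//.
  by apply: Int_mul_sqrt_le => //; [exact: bmeasB|exact: ltW].
by apply: Int_mul_sqrt_le => //; [exact: bmeasB|exact: ltW].
Qed.

Lemma MA'E psi q : pw Omega psi q -> MA' T v p psi =
  - \sum_j \sum_i Int (fun x => (pder [:: j] p \_ Omega) x * ((pder [:: i] psi \_ E) x * C i j x)).
Proof.
move=> hq; rewrite /MA' Rintegral_mkcond; congr (- _).
under eq_bigr => j _.
  rewrite -Int_sum; last first.
    by move=> i _; apply: bmeasMM => //; apply: bmeasMM => //; exact: (bmeas_interiors OmegaT hq [:: i]).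
  over.
rewrite -Int_sum; last first.
  move=> j _; apply: bmeas_sum => i _; apply: bmeasMM => //.
  by apply: bmeasMM => //; exact: (bmeas_interiors OmegaT hq [:: i]).
apply: eq_Rintegral => x _; rewrite [LHS]patchE; case: ifPn => [/set_mem Ex|xE]; last first.
  rewrite big1// => j _; rewrite big1// => i _.
  by rewrite /C !patchE (negbTE xE) !mulr0.
have Ox := elem_interiors_sub OmegaT Ex.
rewrite mxE exchange_big; apply: eq_bigr => i _; rewrite mxE mxE mulr_suml; apply: eq_bigr => j _.
by rewrite /C !patchE !mem_set// !mxE; ring.
Qed.

(** This form lets the linearisation be subtracted from the determinants pointwise, under one
    integral. *)
Lemma MA'_divergence psi q : pw Omega psi q -> H10 Omega psi ->
  MA' T v p psi = \int[mu]_(x in E) (ddot (cof (hessian v x)) (hessian p x) * psi x).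
Proof.
move=> hq h0; rewrite (MA'E hq) (divergence_H10 hq h0) opprK Rintegral_mkcond.
under eq_bigr => j _.
  rewrite -Int_sum; last first.
    by move=> i _; apply: bmeasMM => //; apply: bmeasMM => //; exact: (bmeas_domain OmegaT hq).
  over.
rewrite -Int_sum; last first.
  move=> j _; apply: bmeas_sum => i _; apply: bmeasMM => //.
  by apply: bmeasMM => //; exact: (bmeas_domain OmegaT hq).
apply: eq_Rintegral => x _; rewrite [RHS]patchE; case: ifPn => [/set_mem Ex|xE]; last first.
  rewrite big1// => j _; rewrite big1// => i _.
  by rewrite /C !patchE (negbTE xE) !mul0r.
have Ox := elem_interiors_sub OmegaT Ex.
rewrite exchange_big /ddot mulr_suml; apply: eq_bigr => i _; rewrite mulr_suml; apply: eq_bigr => j _.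
by rewrite /C !patchE !mem_set// !mxE; ring.
Qed.

End divergence_form.

(** * Convexity *)

Section second_differences.
Variables (R : realType) (n : nat).
Local Notation flat := (@smooth_alg R n (fun=> False)).
Implicit Types (f : 'rV[R]_n -> R) (x v : 'rV[R]_n).

(** The directional derivative of a flat function, by [flat_derive_dir]; written with partial
    derivatives it stays in the flat algebra and can be iterated. *)
Definition dirgrad v f x := \sum_i v ord0 i * pder [:: i] f x.

Lemma flat_sum (I : Type) (s : seq I) (F : I -> 'rV[R]_n -> R) :
  (forall i, flat (F i)) -> flat (fun x => \sum_(i <- s) F i x).
Proof.
move=> fF; elim: s => [|i s IH].
  rewrite (_ : (fun x => _) = fun=> 0); first exact: sa_cst.
  by apply/funext => x; rewrite big_nil.
rewrite (_ : (fun x => _) = fun x => F i x + \sum_(i <- s) F i x); first exact: sa_add.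
by apply/funext => x; rewrite big_cons.
Qed.

Lemma flat_dirgrad v f : flat f -> flat (dirgrad v f).
Proof.
move=> ff; apply: flat_sum => i; apply: sa_mul; first exact: sa_cst.
exact: flat_pder.
Qed.

Lemma dirgrad_aff (a : R) (v w : 'rV[R]_n) f x : dirgrad (a *: v + w) f x = a * dirgrad v f x + dirgrad w f x.
Proof.
by rewrite /dirgrad mulr_sumr -big_split; apply: eq_bigr => i _; rewrite !mxE mulrDl mulrA.
Qed.

Lemma dirgradN v f x : dirgrad (- v) f x = - dirgrad v f x.
Proof. by rewrite /dirgrad -sumrN; apply: eq_bigr => i _; rewrite mxE mulNr. Qed.

Lemma flat_derive_line f x v (t : R) : flat f ->
  is_derive t 1 (fun s : R => f (s *: v + x)) (dirgrad v f (t *: v + x)).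
Proof. by move=> ff; apply: is_derive_line_at; exact: flat_derive_dir. Qed.

Lemma flat_line_continuous f x v : flat f -> continuous (fun s : R => f (s *: v + x)).
Proof.
move=> ff s; apply/differentiable_continuous/derivable1_diffP.
by have [] := flat_derive_line x v s ff.
Qed.

Lemma MVT0 (h dh : R -> R) (t : R) : 0 < t -> (forall s : R, is_derive s (1 : R) h (dh s)) ->
  exists c : R, [/\ 0 < c, c < t & h t - h 0 = dh c * t].
Proof.
move=> t0 dhP; have [|c + hc] := MVT t0 (fun s _ => dhP s).
  apply: continuous_subspaceT => s; apply/differentiable_continuous/derivable1_diffP.
  by have [] := dhP s.
by rewrite in_itv /= => /andP[c0 ct]; exists c; split; rewrite // hc subr0.
Qed.

(** The function h is even, so its derivative vanishes at 0: the mean value theorem is applied to h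
    on [0, t] and to its derivative on [0, c]. *)
Lemma second_difference f x v (t : R) : flat f -> 0 < t ->
  exists c e : R, [/\ 0 < e, e < c, c < t &
    f (t *: v + x) + f (t *: (- v) + x) - 2 * f x =
    t * c * (dirgrad v (dirgrad v f) (e *: v + x) + dirgrad v (dirgrad v f) (e *: (- v) + x))].
Proof.
move=> ff t0; pose h (s : R) := f (s *: v + x) + f (s *: (- v) + x).
pose dh (s : R) := dirgrad v f (s *: v + x) - dirgrad v f (s *: (- v) + x).
pose ddh (s : R) := dirgrad v (dirgrad v f) (s *: v + x) + dirgrad v (dirgrad v f) (s *: (- v) + x).
have hP (s : R) : is_derive s (1 : R) h (dh s).
  apply: is_deriveD; first exact: flat_derive_line.
  by rewrite -dirgradN; exact: flat_derive_line.
have dhP (s : R) : is_derive s (1 : R) dh (ddh s).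
  rewrite /ddh -[X in _ + X]opprK -dirgradN.
  by apply: is_deriveB; exact: flat_derive_line (flat_dirgrad v ff).
have [c [c0 ct hc]] := MVT0 t0 hP; have [e [e0 ec he]] := MVT0 c0 dhP.
exists c, e; split => //; rewrite -/(ddh e).
have h0 : h 0 = 2 * f x by rewrite /h !scale0r add0r mulr_natl mulr2n.
have dh0 : dh 0 = 0 by rewrite /dh !scale0r subrr.
rewrite dh0 subr0 in he; rewrite -h0 -/(h t) hc he; ring.
Qed.

Lemma qformE (A : 'M[R]_n) xi : qform A xi = \sum_i \sum_j xi i 0 * A i j * xi j 0.
Proof.
rewrite /qform mxE exchange_big; apply: eq_bigr => j _; rewrite mxE mulr_suml.
by apply: eq_bigr => i _; rewrite mxE.
Qed.

Lemma dirgrad2_qform f x v : flat f -> dirgrad v (dirgrad v f) x = qform (hessian f x) v^T.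
Proof.
move=> ff; rewrite /qform trmxK mxE /dirgrad.
have ch i : Cinf (pder [:: i] f) by apply: Cinf_flat; exact: flat_pder.
have h j : pder [:: j] (fun y => \sum_i v ord0 i * pder [:: i] f y) x =
    \sum_i v ord0 i * pder [:: j; i] f x.
  elim: (index_enum _) => [|i s IH].
    rewrite big_nil (_ : (fun y => _) = fun=> 0); first exact: derive_cst.
    by apply/funext => y; rewrite big_nil.
  rewrite big_cons -IH -(pderZ _ _ _ (ch i)).
  rewrite -(pderD j x (CinfM (Cinf_cst n (v ord0 i)) (ch i))).
    by congr (pder [:: j] _ x); apply/funext => y; rewrite big_cons.
  by apply: Cinf_sum => k; exact: (CinfM (Cinf_cst n (v ord0 k)) (ch k)).
rewrite (eq_bigr _ (fun j _ => congr1 (fun t => v ord0 j * t) (h j))).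
under eq_bigr do rewrite mulr_sumr.
rewrite exchange_big; apply: eq_bigr => i _; rewrite !mxE mulr_suml.
by apply: eq_bigr => j _; rewrite !mxE; ring.
Qed.

Definition sqn v := \sum_i v ord0 i ^+ 2.

Lemma sqn_second_difference x v (t : R) :
  sqn (t *: v + x) + sqn (t *: (- v) + x) - 2 * sqn x = 2 * t ^+ 2 * sqn v.
Proof.
rewrite /sqn !mulr_sumr -big_split -sumrB; apply: eq_bigr => i _.
by rewrite !mxE /=; ring.
Qed.

Lemma sqn_gt0 v : v != 0 -> 0 < sqn v.
Proof.
move=> v0; have /existsP[i vi] : [exists i, v ord0 i != 0].
  apply: contraT => /existsPn h; case/eqP: v0; apply/rowP => i.
  by rewrite mxE; apply/eqP; have := h i; rewrite negbK.
rewrite /sqn (bigD1 i)//= ltr_wpDr ?exprn_even_gt0//.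
by apply: sumr_ge0 => j _; exact: sqr_ge0.
Qed.

Lemma le_sqn v (r : R) : `|v| <= r -> sqn v <= n%:R * r ^+ 2.
Proof.
move=> vr; rewrite mulr_natl -[X in _ *+ X](card_ord n) -sumr_const; apply: ler_sum => i _.
rewrite -real_normK ?num_real// ler_pXn2r ?nnegrE//; last exact: le_trans vr.
exact: le_trans (coord_norm_le _ _) vr.
Qed.

(** At a minimum of f - l the second difference of f is at least that of l, namely 2 es t^2, whereas
    t c q is smaller. *)
Lemma second_difference_contra (t c fp fm fx lp lm lx q es : R) : 0 < c -> c < t ->
  lp + lm - 2 * lx = 2 * es * t ^+ 2 -> fp + fm - 2 * fx = t * c * q -> q < es + es -> 0 < es ->
  fx - lx <= fp - lp -> fx - lx <= fm - lm -> False.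
Proof.
move=> c0 ct a1 a2 a3 es0 a5 a6; have t0 := lt_trans c0 ct.
have b1 : t * c * q < t * c * (2 * es) by rewrite ltr_pM2l ?mulr_gt0//; lra.
have b2 : t * c * (2 * es) <= t * t * (2 * es).
  by rewrite ler_wpM2r ?mulr_ge0 ?(ltW es0)// ler_wpM2l ?ltW.
by move: a1; rewrite expr2; lra.
Qed.

(* A flat function whose graph lies above a paraboloid touching it at x. *)
Lemma touching_paraboloid_posdef f x (e r : R) (l : 'rV[R]_n -> R) : flat f -> 0 < e -> 0 < r ->
  (forall (v : 'rV[R]_n) t, l (t *: v + x) + l (t *: (- v) + x) - 2 * l x = 2 * e * t ^+ 2 * sqn v) ->
  (forall y : 'rV[R]_n, `|y - x| < r -> f x - l x <= f y - l y) -> posdef (hessian f x).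
Proof.
move=> ff e0 r0 lE fmin xi xi0; pose v := xi^T.
have v0 : v != 0 by rewrite -trmx0 (inj_eq trmx_inj).
have sv := sqn_gt0 v0.
rewrite -[xi]trmxK -/v -dirgrad2_qform//; set Q := dirgrad v (dirgrad v f).
have fQ : flat Q by exact: flat_dirgrad (flat_dirgrad v ff).
rewrite (lt_le_trans (mulr_gt0 e0 sv))// leNgt; apply/negP => Qx.
have cont (w : 'rV[R]_n) : \forall s \near (0 : R)^'+, Q (s *: w + x) < e * sqn v.
  apply: (cvgr_lt (Q x)) => //.
  have := @flat_line_continuous Q x w fQ 0; rewrite /continuous_at scale0r add0r.
  exact: cvg_at_right_filter.
have [d /= d0 hd] : \forall s \near (0 : R)^'+, Q (s *: v + x) < e * sqn v /\
    Q (s *: (- v) + x) < e * sqn v.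
  by apply: filterI; exact: cont.
have nv : 0 < `|v| by rewrite normr_gt0.
have [t [t0 td tr]] : exists t : R, [/\ 0 < t, t < d & t * `|v| < r].
  exists (Num.min (d / 2) (r / (2 * `|v|))).
  split; first by rewrite lt_min !divr_gt0// mulr_gt0.
    apply: (@le_lt_trans _ _ (d / 2)); first by rewrite ge_min lexx.
    by rewrite ltr_pdivrMr// mulr_natr mulr2n ltrDl.
  apply: (@le_lt_trans _ _ (r / (2 * `|v|) * `|v|)).
    by rewrite ler_wpM2r// ge_min lexx orbT.
  rewrite (_ : _ * _ = r / 2); last by field; rewrite gt_eqF.
  by rewrite ltr_pdivrMr// mulr_natr mulr2n ltrDl.
have [c [s [s0 sc ct fE]]] := second_difference x v ff t0.
have tv (w : 'rV[R]_n) : `|w| = `|v| -> `|t *: w + x - x| < r.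
  by move=> wv; rewrite addrK normrZ gtr0_norm// wv.
have h1 : f x - l x <= f (t *: v + x) - l (t *: v + x) by apply: fmin; exact: tv.
have h2 : f x - l x <= f (t *: (- v) + x) - l (t *: (- v) + x).
  by apply: fmin; apply: tv; exact: normrN.
have lE' : l (t *: v + x) + l (t *: (- v) + x) - 2 * l x = 2 * (e * sqn v) * t ^+ 2.
  by rewrite lE; ring.
have [||q1 q2] := hd s; [|exact: s0|].
  by rewrite /= sub0r normrN gtr0_norm// (lt_trans sc)// (lt_trans ct).
exact: (second_difference_contra (lt_trans s0 sc) ct lE' fE (ltrD q1 q2) (mulr_gt0 e0 sv) h1 h2).
Qed.

End second_differences.

Lemma cvg_qform (R : realType) (I : Type) (F : set_system I) {FF : Filter F} n
    (A_ : I -> 'M[R]_n) (A : 'M[R]_n) xi :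
  (forall i j, A_ s i j @[s --> F] --> A i j) -> qform (A_ s) xi @[s --> F] --> qform A xi.
Proof.
move=> h; rewrite (_ : (fun s => _) = fun s => \sum_k \sum_j xi k 0 * A_ s k j * xi j 0).
  rewrite qformE; apply: cvg_big => [|k _]; first exact: add_continuous.
  apply: cvg_big => [|j _]; first exact: add_continuous.
  apply: cvgM; last exact: cvg_cst.
  by apply: cvgM; [exact: cvg_cst|exact: h].
by apply/funext => s; rewrite qformE.
Qed.

Section convex_splines.
Variables (R : realType) (n : nat) (Omega : set 'rV[R]_n) (T : mesh R n).
Hypotheses (OmegaT : meshed Omega T).
Local Notation flat := (@smooth_alg R n (fun=> False)).
Local Notation E := (elem_interiors T).
Implicit Types pu : 'I_(nelem T) -> 'rV[R]_n -> R.

(** Convexity alone gives the weak inequality. It becomes strict by applying the weak one at the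
    midpoint of x and y and strict convexity to that midpoint. *)
Lemma strictly_convex_tangent (f u : 'rV[R]_n -> R) (U : set 'rV[R]_n) x y : flat f ->
  strictly_convex Omega u -> U `<=` Omega -> (forall z, U z -> u z = f z) ->
  (forall z w t, U z -> U w -> 0 <= t <= 1 -> U (t *: z + (1 - t) *: w)) ->
  U x -> U y -> x <> y -> f x + dirgrad (y - x) f x < f y.
Proof.
move=> ff sc UO uf cU Ux Uy xy.
have weak z : U z -> x <> z -> f x + dirgrad (z - x) f x <= f z.
  move=> Uz xz; rewrite leNgt; apply/negP => h.
  pose v := z - x; pose L := f z - f x.
  have LD : L < dirgrad v f x by move: h; rewrite /L -/v; lra.
  have [d /= d0 hd] : \forall s \near (0 : R)^'+, L < dirgrad v f (s *: v + x).
    apply: (cvgr_gt (dirgrad v f x)) => //.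
    have := @flat_line_continuous _ _ _ x v (flat_dirgrad v ff) 0.
    rewrite /continuous_at scale0r add0r; exact: cvg_at_right_filter.
  pose t := Num.min (d / 2) (1 / 2).
  have t0 : 0 < t by rewrite lt_min !divr_gt0.
  have t1 : t < 1 by rewrite (@le_lt_trans _ _ (1 / 2))// ?ge_min ?lexx ?orbT//; lra.
  have td : t < d.
    apply: (@le_lt_trans _ _ (d / 2)); first by rewrite ge_min lexx.
    by rewrite ltr_pdivrMr// mulr_natr mulr2n ltrDl.
  have [c [c0 ct]] := MVT0 t0 (fun s => flat_derive_line x v s ff).
  rewrite scale0r add0r => fE.
  have := hd c; rewrite /= sub0r normrN gtr0_norm// => /(_ (lt_trans ct td) c0) Lc.
  have := sc z x t (UO _ Uz) (UO _ Ux) (fun e => xz (esym e)).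
  rewrite t0 t1 => /(_ isT).
  have -> : t *: z + (1 - t) *: x = t *: v + x.
    by apply/rowP => i; rewrite !mxE; ring.
  have Ut : U (t *: v + x).
    have := cU z x t Uz Ux; rewrite !ltW// => /(_ isT); congr U.
    by apply/rowP => i; rewrite !mxE; ring.
  rewrite !uf// => cv; have : L * t < dirgrad v f (c *: v + x) * t by rewrite ltr_pM2r.
  by move: cv fE; rewrite /L; lra.
have Um : U (2^-1 *: y + (1 - 2^-1) *: x) by apply: cU => //; lra.
have xm : x <> 2^-1 *: y + (1 - 2^-1) *: x.
  move=> e; apply: xy; apply/rowP => i; have := congr1 (fun z : 'rV[R]_n => z ord0 i) e.
  by rewrite !mxE; lra.
have := weak _ Um xm.
have -> : 2^-1 *: y + (1 - 2^-1) *: x - x = 2^-1 *: (y - x) + 0.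
  by apply/rowP => i; rewrite !mxE; ring.
rewrite dirgrad_aff [dirgrad 0 _ _]big1 => [|i _]; last by rewrite mxE mul0r.
have := sc y x 2^-1 (UO _ Uy) (UO _ Ux) (fun e => xy (esym e)).
rewrite (_ : 0 < 2^-1 < 1); last by lra.
by move=> /(_ isT); rewrite !uf//; lra.
Qed.

(** Density is the most one can expect: a strictly convex polynomial such as the sum of the $x_i^4$
    has points with degenerate Hessian. *)
Lemma posdef_dense u pu V : pw Omega u pu -> strictly_convex Omega u -> open V ->
  V `&` E !=set0 -> exists x, [/\ V x, E x & posdef (hessian u x)].
Proof.
move=> up sc oV [x0 [Vx0 [i _ xi0]]]; have ff := pw_flat up i; set f := pu i in ff.
have [r r0 hr] : exists2 r : R, 0 < r & forall y, `|y - x0| <= r -> V y /\ (elem T i)° y.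
  have : nbhs x0 (V `&` (elem T i)°).
    apply: open_nbhs_nbhs; split; last by split.
    by apply: openI => //; exact: open_interior.
  move=> /nbhs_ballP[r /= r0 hr]; exists (r / 2); first by rewrite divr_gt0.
  move=> y yr; apply: hr; rewrite ball_rVE /= (le_lt_trans yr)//.
  by rewrite ltr_pdivrMr// mulr_natr mulr2n ltrDl.
pose U := [set y | `|y - x0| <= r].
have UO : U `<=` Omega by move=> y /hr[_]; exact: (elem_interior_sub OmegaT).
have uf z : U z -> u z = f z by move=> /hr[_ /interior_subset]; exact: (pw_eq up).
have cU z w (t : R) : U z -> U w -> 0 <= t <= 1 -> U (t *: z + (1 - t) *: w).
  rewrite /U /= => zr wr /andP[t0 t1].
  have -> : t *: z + (1 - t) *: w - x0 = t *: (z - x0) + (1 - t) *: (w - x0).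
    by apply/rowP => k; rewrite !mxE; ring.
  apply: (le_trans (ler_normD _ _)); rewrite !normrZ !ger0_norm ?subr_ge0//.
  rewrite (_ : r = t * r + (1 - t) * r); last by ring.
  by rewrite lerD// ler_wpM2l// subr_ge0.
have Ux0 : U x0 by rewrite /U /= subrr normr0 ltW.
have tangent y : U y -> x0 <> y -> f x0 + dirgrad (y - x0) f x0 < f y.
  by move=> Uy xy; exact: (strictly_convex_tangent ff sc UO uf cU Ux0 Uy xy).
pose l y := f x0 + dirgrad (y - x0) f x0.
have cl : flat l.
  apply: sa_add; first exact: sa_cst.
  apply: flat_sum => k; apply: sa_mul; last exact: sa_cst.
  rewrite (_ : (fun x => _) = fun x : 'rV[R]_n => x ord0 k + - x0 ord0 k); last first.
    by apply/funext => x; rewrite !mxE.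
  by apply: sa_add; [exact: sa_coord|exact: sa_cst].
have csq : flat (fun y => sqn (y - x0)).
  apply: flat_sum => k.
  rewrite (_ : (fun x => _) = fun x : 'rV[R]_n => (x ord0 k + - x0 ord0 k) * (x ord0 k + - x0 ord0 k)); last first.
    by apply/funext => x; rewrite !mxE expr2.
  by apply: sa_mul; apply: sa_add; [exact: sa_coord|exact: sa_cst|exact: sa_coord|exact: sa_cst].
have cont g A : flat g -> {within A, continuous g}.
  by move=> fg; apply: continuous_subspaceT; exact/Cinf_continuous/Cinf_flat.
pose S := [set y | `|y - x0| = r].
have flatB g h : flat g -> flat h -> flat (fun y => g y - h y).
  move=> fg fh; rewrite (_ : (fun y => _) = fun y => g y + -1 * h y); last first.
    by apply/funext => y; rewrite mulN1r.
  by apply: sa_add => //; apply: sa_mul => //; exact: sa_cst.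
have cUc : compact U.
  rewrite (_ : U = [set y | `|x0 - y| <= r]); first exact: compact_cball.
  by apply/seteqP; split=> y; rewrite /U /= distrC.
have cS : compact S.
  apply: (subclosed_compact _ cUc); last by move=> y; rewrite /S /U /= => ->.
  apply: (closed_comp (f := fun y : 'rV[R]_n => `|y - x0|) (D := [set r])); last exact: closed_eq.
  move=> y _; apply: (@cvg_norm _ _ _ (nbhs y) _ (fun y => y - x0)).
  by apply: cvgB; [exact: cvg_id|exact: cvg_cst].
have S0 : S !=set0.
  exists (x0 + const_mx r); rewrite /S /= addrC addKr.
  apply/eqP; rewrite eq_le; apply/andP; split.
    by apply/rV_norm_leP; [exact: ltW|move=> k; rewrite mxE gtr0_norm].
  have := coord_norm_le (const_mx r : 'rV[R]_n) (Ordinal (meshed_dim OmegaT)).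
  by rewrite mxE gtr0_norm.
have [z0 /set_mem Sz0 zmin] := EVT_min_rV S0 cS (cont _ S (flatB _ _ ff cl)).
(* The minimum over the sphere of the gap between f and its tangent plane at [x0], positive by
   strict convexity. *)
pose m := f z0 - l z0.
have m0 : 0 < m.
  rewrite subr_gt0; apply: tangent; first by rewrite /U /= Sz0.
  by move=> e; move: Sz0 r0; rewrite /S /= -e subrr normr0 => <-; rewrite ltxx.
(* On the sphere the paraboloid stays below m, since n r^2 bounds [sqn] there. As f - L vanishes at
   [x0], its minimum over the closed ball is attained in the interior. *)
pose e := m / (n%:R * r ^+ 2 + 1).
have D0 : 0 < n%:R * r ^+ 2 + 1 by rewrite ltr_wpDl// mulr_ge0// sqr_ge0.
have e0 : 0 < e by rewrite divr_gt0.
pose L y := l y + e * sqn (y - x0).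
have fL : flat (fun y => f y - L y).
  apply: flatB => //; apply: sa_add => //; apply: sa_mul => //; exact: sa_cst.
have [x1 /set_mem Ux1 xmin] := EVT_min_rV (ex_intro _ _ Ux0) cUc (cont _ U fL).
have x1r : `|x1 - x0| < r.
  rewrite lt_neqAle Ux1 andbT; apply/negP => /eqP Sx1.
  have h1 := zmin x1 (mem_set Sx1); have h2 := xmin x0 (mem_set Ux0).
  have : e * sqn (x1 - x0) < m.
    apply: (@le_lt_trans _ _ (e * (n%:R * r ^+ 2))).
      by rewrite ler_wpM2l ?(ltW e0)// le_sqn.
    by rewrite /e mulrAC ltr_pdivrMr// ltr_pM2l// ltrDl.
  have l0 : l x0 = f x0.
    by rewrite /l subrr [dirgrad _ _ _]big1 ?addr0// => k _; rewrite mxE mul0r.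
  have s0 : sqn (x0 - x0) = 0 by rewrite subrr /sqn big1// => k _; rewrite mxE expr0n.
  by move: h1 h2; rewrite /L l0 s0 -/m; lra.
have [Vx1 Ex1] := hr x1 Ux1.
exists x1; split => //; first by exists i.
have -> : hessian u x1 = hessian f x1.
  apply/matrixP => k k'.
  exact: etrans (hessianE u k k' x1) (etrans (pder_interior up [:: k; k'] Ex1) (esym (hessianE f k k' x1))).
have rr : 0 < r - `|x1 - x0| by rewrite subr_gt0.
apply: (@touching_paraboloid_posdef _ _ f x1 e (r - `|x1 - x0|) L) => //.
- move=> v t; rewrite /L /l -!addrA !dirgrad_aff dirgradN.
  rewrite -[RHS](_ : e * (2 * t ^+ 2 * sqn v) = _); last by ring.
  by rewrite -(sqn_second_difference (x1 - x0)); ring.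
- move=> y yr; apply: xmin; apply: mem_set; rewrite /U /= ltW//.
  by rewrite -(subrK x1 y) -addrA (le_lt_trans (ler_normD _ _))// -ltrBrDr.
Qed.

(** A negative value would persist on an open set, which contains a point with positive definite
    Hessian. *)
Lemma convex_cof_ge0 u pu x xi : pw Omega u pu -> strictly_convex Omega u -> E x ->
  0 <= qform (cof (hessian u x)) xi.
Proof.
move=> up sc Ex; rewrite leNgt; apply/negP => h.
have c : {for x, continuous (fun y => qform (cof (hessian u y)) xi)}.
  have cc k j := @continuous_cof_hessian _ _ _ _ _ _ k j _ up Ex.
  exact: (@cvg_qform _ _ (nbhs x) _ _ (fun y => cof (hessian u y)) _ xi cc).
have h1 : \forall y \near x, qform (cof (hessian u y)) xi < 0 by exact: (cvgr_lt _ c).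
have [y [Vy Ey py]] := posdef_dense (V := [set y | qform (cof (hessian u y)) xi < 0]°)
  up sc (open_interior _) (ex_intro _ x (conj h1 Ex)).
have := interior_subset Vy; rewrite /= ltNge => /negP; apply.
have [->|xi0] := eqVneq xi 0; first by rewrite /qform mulmx0 mxE.
exact/ltW/posdef_cof.
Qed.

End convex_splines.

(** * Newton's method *)

Section spline_space.
Variables (R : realType) (n : nat) (Omega : set 'rV[R]_n) (T : mesh R n) (d : nat).
Hypothesis OmegaT : meshed Omega T.
Implicit Types (f g s t : 'rV[R]_n -> R) (a : R).
Local Notation E := (elem_interiors T).

Let oO := meshed_open OmegaT.

Lemma Ck1_comb f g a : Ck 1 Omega f -> Ck 1 Omega g -> Ck 1 Omega (fun x => f x + a * g x).
Proof.
move=> cf cg.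
have D h x i : Ck 1 Omega h -> Omega x -> is_derive x 'e_i h (pder [:: i] h x).
  by move=> ch Ox; have [_ /(_ isT i)/derivableP] := ch [::] isT x Ox.
have D2 x i : Omega x -> is_derive x 'e_i (fun x => f x + a * g x) (pder [:: i] f x + a * pder [:: i] g x).
  move=> Ox; apply: is_derive_add; first exact: D.
  rewrite (_ : a * _ = 0 * g x + a * pder [:: i] g x); last by rewrite mul0r add0r.
  exact: (is_derive_mul (is_derive_cst a x 'e_i) (D _ _ _ cg Ox)).
have C (h h' : 'rV[R]_n -> R) x : {for x, continuous h} -> {for x, continuous h'} ->
    {for x, continuous (fun y => h y + a * h' y)}.
  move=> ch ch'; apply: (@continuousD _ _ _ h (fun y => a * h' y)) => //.
  by apply: (@continuousM _ _ (fun=> a) h') => //; exact: cst_continuous.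
case=> [|j [|//]] _ x Ox.
  split; first by apply: C; [have [] := cf [::] isT x Ox|have [] := cg [::] isT x Ox].
  by move=> _ i; have [] := D2 x i Ox.
split=> //; have h : \forall y \near x, pder [:: j] f y + a * pder [:: j] g y =
    pder [:: j] (fun x => f x + a * g x) y.
  apply: filterS (open_nbhs_nbhs (conj oO Ox)) => y Oy.
  by have [_ <-] := D2 y j Oy.
have := C (pder [:: j] f) (pder [:: j] g) x.
rewrite /prop_for /continuous_at (nbhs_singleton h) => cc.
apply: cvg_trans (near_eq_cvg h) _.
by apply: cc; [have [] := cf [:: j] isT x Ox|have [] := cg [:: j] isT x Ox].
Qed.

Lemma is_poly_comb (p q : 'rV[R]_n -> R) a : is_poly d p -> is_poly d q ->
  is_poly d (fun x => p x + a * q x).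
Proof.
move=> [c pc] [c' qc]; exists (fun m => c m + a * c' m) => x.
rewrite pc qc mulr_sumr -big_split; apply: eq_bigr => m _ /=.
by rewrite mulrDl mulrA.
Qed.

Lemma spline_comb s t a : spline Omega T d s -> spline Omega T d t ->
  spline Omega T d (fun x => s x + a * t x).
Proof.
move=> [cs sp] [ct tp]; split; first exact: Ck1_comb.
move=> i; have [p hp sE] := sp i; have [q hq tE] := tp i.
exists (fun x => p x + a * q x); first exact: is_poly_comb.
by move=> x xi; rewrite sE// tE.
Qed.

(** The pointwise description of $V_0^h$; [zspline_H10] and [spline0_zspline] identify it with
    [spline0]. *)
Definition zspline s := spline Omega T d s /\ forall x, boundary Omega x -> s x = 0.

Lemma zspline_comb s t a : zspline s -> zspline t -> zspline (fun x => s x + a * t x).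
Proof.
move=> [ss s0] [st t0]; split; first exact: spline_comb.
by move=> x bx; rewrite s0// t0// mulr0 addr0.
Qed.

Lemma zspline_cst0 : zspline (fun=> 0).
Proof.
split=> //; split=> [|i].
  by move=> s hs x Ox; exact: ((smooth_setTP (fun=> 0)).2 (Cinf_cst n 0) 1%N s hs x I).
by exists (fun=> 0) => //; exists (fun=> 0) => x; rewrite big1// => m _; rewrite mul0r.
Qed.

Lemma zspline_sum (I : Type) (r : seq I) (b : I -> 'rV[R]_n -> R) (z : I -> R) :
  (forall j, zspline (b j)) -> zspline (fun x => \sum_(j <- r) z j * b j x).
Proof.
move=> Zb; elim: r => [|j r IH].
  rewrite (_ : (fun x => _) = fun=> 0); first exact: zspline_cst0.
  by apply/funext => x; rewrite big_nil.
rewrite (_ : (fun x => _) = fun x => \sum_(j <- r) z j * b j x + z j * b j x).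
  exact: zspline_comb.
by apply/funext => x; rewrite big_cons addrC.
Qed.

Lemma zspline_H10 s : zspline s -> spline0 Omega T d s.
Proof.
move=> [ss s0]; split => //; have [p sp] := spline_pw ss.
exact: (boundary_H10 OmegaT sp).
Qed.

Lemma spline0_zspline s : spline0 Omega T d s -> zspline s.
Proof.
move=> [ss s0]; split => //; have [p sp] := spline_pw ss => x bx.
exact: (H10_boundary OmegaT sp).
Qed.

Definition free_on N (b : 'I_N -> 'rV[R]_n -> R) :=
  forall z : 'rV[R]_N, (forall x, Omega x -> \sum_j z ord0 j * b j x = 0) -> z = 0.

(** With more functions than coefficients per function, the coefficient matrix has a nontrivial left
    kernel, and the corresponding combination vanishes on every element. *)
Lemma free_bound N (b : 'I_N -> 'rV[R]_n -> R) : (forall j, zspline (b j)) -> free_on b ->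
  (N <= #|{: 'I_(nelem T) * mindex n d}|)%N.
Proof.
move=> Zb fb; set M := #|_|; rewrite leqNgt; apply/negP => MN.
have /choice[c hc] : forall ji : 'I_N * 'I_(nelem T), exists c : mindex n d -> R,
    forall x, elem T ji.2 x -> b ji.1 x =
      \sum_(m : mindex n d | (mdeg m <= d)%N) c m * \prod_i x ord0 i ^+ m i.
  move=> [j i]; have [[_ /(_ i)[p [c pc] bp]] _] := Zb j.
  by exists c => x xi; rewrite bp.
pose C : 'M[R]_(N, M) := \matrix_(j, k) c (j, (enum_val k).1) (enum_val k).2.
have : kermx C != 0.
  by rewrite kermx_eq0 /row_free neq_ltn (leq_ltn_trans (rank_leq_col C) MN).
move=> /rowV0Pn[z /sub_kermxP zC]; apply/negP; rewrite negbK; apply/eqP.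
apply: fb => x Ox; have [i xi] := elem_cover OmegaT (subset_closure Ox).
under eq_bigr do rewrite (hc (_, i))// mulr_sumr.
rewrite exchange_big big1// => m _ /=.
under eq_bigr do rewrite mulrA.
rewrite -mulr_suml [X in X * _](_ : _ = 0) ?mul0r//.
have := congr1 (fun w : 'rV[R]_M => w ord0 (enum_rank (i, m))) zC; rewrite !mxE => zCm.
by rewrite -[RHS]zCm; apply: eq_bigr => j _; rewrite !mxE enum_rankK.
Qed.

(** A free family of maximal size, which exists by [free_bound]. It spans, since a spline outside
    its span could be added to it. *)
Lemma spline_basis : exists N (b : 'I_N -> 'rV[R]_n -> R),
  [/\ forall j, zspline (b j), free_on b &
    forall s, zspline s -> exists z : 'rV[R]_N, forall x, Omega x -> s x = \sum_j z ord0 j * b j x].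
Proof.
pose P N := `[< exists b : 'I_N -> 'rV[R]_n -> R, (forall j, zspline (b j)) /\ free_on b >].
have exP : exists N, P N.
  exists 0%N; apply/asboolP; exists (fun _ _ => 0); split; first by case.
  by move=> z _; apply/rowP; case.
have maxP N : P N -> (N <= #|{: 'I_(nelem T) * mindex n d}|)%N.
  by move=> /asboolP[b [Zb fb]]; exact: free_bound Zb fb.
case: (ex_maxnP exP maxP) => N /asboolP[b [Zb fb]] Nmax.
exists N, b; split => // s Zs; apply: contrapT => nos.
suff /Nmax : P N.+1 by rewrite ltnn.
apply/asboolP; pose b' (j : 'I_N.+1) := if unlift ord0 j is Some k then b k else s.
exists b'; split; first by move=> j; rewrite /b'; case: unlift.
move=> z hz; have {}hz x : Omega x ->
    z ord0 ord0 * s x + \sum_j z ord0 (lift ord0 j) * b j x = 0.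
  move=> /hz; rewrite big_ord_recl /b' unlift_none => zx.
  by rewrite -[RHS]zx; congr (_ + _); apply: eq_bigr => j _; rewrite liftK.
have [z0|z0] := eqVneq (z ord0 ord0) 0.
  pose w : 'rV[R]_N := \row_j z ord0 (lift ord0 j).
  have w0 : w = 0.
    apply: fb => x Ox; have := hz x Ox; rewrite z0 mul0r add0r => {2}<-.
    by apply: eq_bigr => j _; rewrite mxE.
  apply/rowP => j; rewrite mxE; case: (unliftP ord0 j) => [k ->|->] //.
  by have := congr1 (fun v : 'rV[R]_N => v ord0 k) w0; rewrite !mxE.
exfalso; apply: nos; exists (\row_j (- (z ord0 ord0)^-1 * z ord0 (lift ord0 j))) => x Ox.
under eq_bigr do rewrite mxE -mulrA.
rewrite -mulr_sumr; have /eqP := hz x Ox; rewrite addrC addr_eq0 => /eqP ->.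
by rewrite mulrNN mulKf.
Qed.

End spline_space.

Section piecewise_combinations.
Variables (R : realType) (n : nat) (Omega : set 'rV[R]_n) (T : mesh R n).
Hypothesis OmegaT : meshed Omega T.
Implicit Types (f g s t : 'rV[R]_n -> R) (a : R) (p q : 'I_(nelem T) -> 'rV[R]_n -> R).
Local Notation E := (elem_interiors T).

Lemma pder_comb f g a l : Cinf f -> Cinf g ->
  pder l (fun x => f x + a * g x) = fun x => pder l f x + a * pder l g x.
Proof.
move=> cf cg; elim: l => [//|i l IH].
apply/funext => x; rewrite -[pder (i :: l) _]/(pder [:: i] (pder l _)) IH.
have ca := CinfM (Cinf_cst n a) (Cinf_pder l cg).
by rewrite (pderD i x (Cinf_pder l cf) ca) (pderZ a i x (Cinf_pder l cg)).
Qed.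

Lemma pw_comb s t p q a : pw Omega s p -> pw Omega t q ->
  pw Omega (fun x => s x + a * t x) (fun i x => p i x + a * q i x).
Proof.
move=> [cs ps sE] [ct pt tE]; split.
- exact: (Ck1_comb OmegaT a cs ct).
- by move=> i; apply: sa_add => //; apply: sa_mul => //; exact: sa_cst.
- by move=> i x xi; rewrite (sE i)// (tE i).
Qed.

Lemma pw_pder_comb s t p q a l x : pw Omega s p -> pw Omega t q -> E x ->
  pder l (fun x => s x + a * t x) x = pder l s x + a * pder l t x.
Proof.
move=> sp tq [i _ xi]; rewrite (pder_interior (pw_comb a sp tq) l xi).
rewrite (pder_interior sp l xi) (pder_interior tq l xi) pder_comb//.
  exact: Cinf_flat (pw_flat sp i).
exact: Cinf_flat (pw_flat tq i).
Qed.

Lemma pw_sum (I : Type) (r : seq I) (b : I -> 'rV[R]_n -> R) (z : I -> R) :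
  (forall j, exists p, pw Omega (b j) p) ->
  (exists p, pw Omega (fun x => \sum_(j <- r) z j * b j x) p) /\
  forall l x, E x -> pder l (fun x => \sum_(j <- r) z j * b j x) x = \sum_(j <- r) z j * pder l (b j) x.
Proof.
move=> hb; elim: r => [|j r [[p hp] IH]].
  rewrite (_ : (fun x => _) = fun=> 0); last by apply/funext => x; rewrite big_nil.
  split; last first.
    move=> l x _; rewrite big_nil; by apply: pder_eq0; apply: filterE.
  exists (fun i => fun=> 0); split => //; last by move=> i; exact: sa_cst.
  exact: (zspline_cst0 Omega T 0%N).1.1.
have [q hq] := hb j.
rewrite (_ : (fun x => _) = fun x => \sum_(j <- r) z j * b j x + z j * b j x); last first.
  by apply/funext => x; rewrite big_cons addrC.
split; first by eexists; exact: (pw_comb (z j) hp hq).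
by move=> l x Ex; rewrite (pw_pder_comb _ _ hp hq Ex) IH// big_cons addrC.
Qed.

Lemma pder_eq_on s t l x : (forall y, Omega y -> s y = t y) -> Omega x -> pder l s x = pder l t x.
Proof.
move=> st Ox; have h : \forall y \near x, s y = t y.
  by apply: filterS (open_nbhs_nbhs (conj (meshed_open OmegaT) Ox)) => y; exact: st.
exact: (nbhs_singleton (near_eq_pder l h)).
Qed.

End piecewise_combinations.

Lemma cvg_energy (R : realType) (I : Type) (F : set_system I) {FF : Filter F} n
    (A_ : 'I_n -> 'I_n -> I -> R) A (g_ : 'I_n -> I -> R) g :
  (forall i j, A_ i j s @[s --> F] --> (A i j : R)) -> (forall j, g_ j s @[s --> F] --> (g j : R)) ->
  \sum_i \sum_j A_ i j s * (g_ j s * g_ i s) @[s --> F] --> \sum_i \sum_j A i j * (g j * g i).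
Proof.
move=> cA cg; apply: cvg_big => [|i _]; first exact: add_continuous.
apply: cvg_big => [|j _]; first exact: add_continuous.
by apply: cvgM; [exact: cA|apply: cvgM; exact: cg].
Qed.

(** * The energy form and its definiteness *)

Section energy.
Variables (R : realType) (n : nat) (Omega : set 'rV[R]_n) (T : mesh R n).
Hypotheses (hn : n = 2%N \/ n = 3%N) (OmegaT : meshed Omega T).
Implicit Types (s psi u v f g : 'rV[R]_n -> R) (a : R) (p q pu pv ps : 'I_(nelem T) -> 'rV[R]_n -> R).
Local Notation E := (elem_interiors T).
Local Notation mu := (lebesgue_rV R n).
Local Notation Int f := (Rintegral mu setT f).

Definition energy_density v s psi x : R :=
  \sum_i \sum_j cof (hessian v x) i j * (pder [:: j] s x * pder [:: i] psi x).

Lemma MA'_energy v s psi : MA' T v s psi = - Int (energy_density v s psi \_ E).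
Proof.
rewrite /MA' Rintegral_mkcond; congr (- _); apply: eq_Rintegral => x _.
rewrite !patchE; case: ifPn => // _; rewrite mxE; apply: eq_bigr => i _.
by rewrite !mxE mulr_suml; apply: eq_bigr => j _; rewrite !mxE mulrA.
Qed.

Lemma energy_density_qform v s x : energy_density v s s x = qform (cof (hessian v x)) (gradient s x).
Proof.
rewrite qformE; apply: eq_bigr => i _; apply: eq_bigr => j _.
by rewrite [gradient _ _ _ _]mxE [gradient _ _ j _]mxE; ring.
Qed.

Lemma bmeas_energy v pv s ps psi q : pw Omega v pv -> pw Omega s ps -> pw Omega psi q ->
  bmeas (energy_density v s psi \_ E).
Proof.
move=> vp sp hq.
rewrite (_ : _ \_ _ = fun x => \sum_i \sum_j ((fun y => cof (hessian v y) i j) \_ E) x *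
   ((pder [:: j] s \_ E) x * (pder [:: i] psi \_ E) x)).
  apply: bmeas_sum => i _; apply: bmeas_sum => j _; apply: bmeasMM.
    exact: (bmeas_cof_hessian hn OmegaT i j vp).
  by apply: bmeasMM; [exact: (bmeas_interiors OmegaT sp [:: j])|exact: (bmeas_interiors OmegaT hq [:: i])].
apply/funext => x; rewrite patchE; case: ifPn => xE.
  by apply: eq_bigr => i _; apply: eq_bigr => j _; rewrite !patchE xE.
by rewrite big1// => i _; rewrite big1// => j _; rewrite !patchE (negbTE xE) mul0r.
Qed.

Lemma bmeas_cst_interiors : bmeas ((fun=> 1 : R) \_ E).
Proof. by apply: (bmeas_on_interiors OmegaT (M := 1)) => x _; [exact: cst_continuous|rewrite normr1]. Qed.

Lemma Int_interiors_bound f M : bmeas (f \_ E) -> (forall x, E x -> `|f x| <= M) ->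
  `|Int (f \_ E)| <= M * Int ((fun=> 1 : R) \_ E).
Proof.
move=> bf fM; apply: (le_trans (Int_norm bf)); rewrite -IntZ; last exact: bmeas_cst_interiors.
apply: le_Int; [exact: bmeas_norm|exact/bmeasZ/bmeas_cst_interiors|move=> x].
rewrite !patchE; case: ifPn => [/set_mem Ex|_]; last by rewrite normr0 mulr0.
by rewrite mulr1; exact: fM.
Qed.

Lemma Int_interiors_ge0 f : bmeas (f \_ E) -> (forall x, E x -> 0 <= f x) -> 0 <= Int (f \_ E).
Proof.
move=> bf f0; rewrite -[leLHS](Int0 R n); apply: le_Int => //; first exact: bmeas0.
by move=> x; rewrite patchE; case: ifPn => // /set_mem; exact: f0.
Qed.

Lemma elem_segment i x y (t : R) : elem T i x -> elem T i y -> 0 <= t <= 1 ->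
  elem T i (t *: y + (1 - t) *: x).
Proof.
move=> [lam [l0 l1 _ ->]] [lam' [l0' l1' _ ->]] /andP[t0 t1].
exists (t *: lam' + (1 - t) *: lam); split.
- by move=> a; rewrite !mxE addr_ge0// mulr_ge0// subr_ge0.
- under eq_bigr do rewrite !mxE.
  by rewrite big_split -!mulr_sumr l1 l1' /= !mulr1 addrC subrK.
- by move=> a /(_ I).
- by rewrite mulmxDl -!scalemxAl.
Qed.

Section definite.
Variables (u s : 'rV[R]_n -> R) (pu ps : 'I_(nelem T) -> 'rV[R]_n -> R).
Hypotheses (up : pw Omega u pu) (sp : pw Omega s ps).
Hypothesis sc : strictly_convex Omega u.

Lemma energy_density_ge0 x : E x -> 0 <= energy_density u s s x.
Proof. by move=> Ex; rewrite energy_density_qform; exact: (convex_cof_ge0 OmegaT _ up sc Ex). Qed.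

Lemma continuous_energy x : E x -> {for x, continuous (energy_density u s s \_ E)}.
Proof.
move=> Ex; have h : \forall y \near x, energy_density u s s y = (energy_density u s s \_ E) y.
  apply: filterS (open_nbhs_nbhs (conj (@elem_interiors_open _ _ T) Ex)) => y Ey.
  by rewrite patchE mem_set.
rewrite /prop_for /continuous_at -(nbhs_singleton h).
apply: cvg_trans (near_eq_cvg h) _; have cc i j := @continuous_cof_hessian _ _ _ _ _ _ i j _ up Ex.
have cd j := @continuous_interiors _ _ _ _ _ _ sp [:: j] _ Ex.
exact: (@cvg_energy _ _ (nbhs x) _ n (fun i j y => cof (hessian u y) i j) _ (fun j => pder [:: j] s) _ cc cd).
Qed.

(** Zero energy makes the continuous nonnegative density vanish on E. A nonzero derivative at x
    would persist nearby, hence at a point where the Hessian of u is positive definite, and there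
    the density forces the gradient to be 0. *)
Lemma energy_eq0_gradient x j : Int (energy_density u s s \_ E) = 0 -> E x -> pder [:: j] s x = 0.
Proof.
move=> W0 Ex; have dens y : E y -> energy_density u s s y = 0.
  move=> Ey; apply/eqP; rewrite eq_le energy_density_ge0// andbT leNgt; apply/negP => Wy.
  suff : 0 < Int (energy_density u s s \_ E) by rewrite W0 ltxx.
  apply: (@Int_gt0 _ _ _ y); first exact: bmeas_energy up sp sp.
  - by move=> z; rewrite patchE; case: ifPn => // /set_mem; exact: energy_density_ge0.
  - by rewrite patchE mem_set.
  - exact: continuous_energy.
apply/eqP; apply: contraT => sx.
have cd := @continuous_interiors _ _ _ _ _ _ sp [:: j] _ Ex.
have h : \forall y \near x, pder [:: j] s y != 0 by exact: (cvgr_neq0 _ cd).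
have [y [Vy Ey py]] := posdef_dense OmegaT (V := [set y | pder [:: j] s y != 0]°)
  up sc (@open_interior _ _) (ex_intro _ x (conj h Ex)).
have := dens y Ey; rewrite energy_density_qform => q0.
have : posdef (cof (hessian u y)) by exact: posdef_cof.
move=> /(_ (gradient s y)); rewrite q0 ltxx => h0.
have g0 : gradient s y = 0 by apply/eqP; apply: contraT => /h0.
have := interior_subset Vy => /eqP; case.
by have := congr1 (fun w : 'cV[R]_n => w j 0) g0; rewrite !mxE.
Qed.

(** With zero gradient s is constant on each element. Gluing with Lipschitz constant 0, the
    complement of Omega being one more piece, makes the extension by 0 constant along every line,
    and lines leave Omega. *)
Lemma energy_eq0 : (forall x, boundary Omega x -> s x = 0) ->
  Int (energy_density u s s \_ E) = 0 -> forall x, Omega x -> s x = 0.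
Proof.
move=> s0 W0.
have g0 i j x : elem T i x -> pder [:: j] (ps i) x = 0.
  move=> xi; apply: (@closure_continuous_eq0 _ _ (elem T i)°) => [||y yi].
  - exact: (elem_dense OmegaT xi).
  - exact: Cinf_continuous (Cinf_pder [:: j] (Cinf_flat (pw_flat sp i))) _.
  - by rewrite -(pder_interior sp [:: j] yi); apply: energy_eq0_gradient => //; exists i.
have const i (x v : 'rV[R]_n) (t : R) : elem T i x -> elem T i (t *: v + x) -> ps i (t *: v + x) = ps i x.
  move=> xi yi; have [c [c0 c1]] := MVT0 ltr01 (fun r => flat_derive_line x (t *: v) r (pw_flat sp i)).
  rewrite scale1r scale0r add0r mulr1 => h; apply/eqP; rewrite -subr_eq0 h.
  apply/eqP; rewrite /dirgrad big1// => j _; rewrite g0 ?mulr0//.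
  have := elem_segment (t := c) xi yi; rewrite !ltW// => /(_ isT); congr (elem T i).
  by apply/rowP => k; rewrite !mxE; ring.
have Wc (x v : 'rV[R]_n) (t : R) : `|(s \_ Omega) (t *: v + x) - (s \_ Omega) x| <= 0 * `|t|.
  apply: (@lipschitz_glue R _ (option 'I_(nelem T)) _
    (fun o => if o is Some i then elem T i else ~` Omega)).
  - move=> [i|]; first exact: (elem_closed OmegaT).
    exact: open_closedC (meshed_open OmegaT).
  - move=> y; have [Oy|Oy] := pselect (Omega y); last by exists None.
    by have [i yi] := elem_cover OmegaT (subset_closure Oy); exists (Some i).
  have sE i y : elem T i y -> (s \_ Omega) y = ps i y.
    move=> yi; rewrite patchE; have [Oy|Oy] := pselect (Omega y).
      by rewrite mem_set// (pw_eq sp yi).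
    rewrite memNset// -(pw_eq sp yi) s0//; split => //.
    exact: (elem_closure OmegaT yi).
  move=> [i|] y r /=.
    by move=> yi zi; rewrite !(sE i)// const// subrr normr0 mul0r.
  by move=> yO zO; rewrite !patchE !memNset// subrr normr0 mul0r.
move=> x Ox; have [r r0 hr] := domain_bounded OmegaT.
have := Wc x (const_mx r - x) 1; rewrite mul0r normr_le0 subr_eq0 scale1r subrK.
rewrite [in X in _ == X]patchE mem_set// patchE memNset; first by move=> /eqP.
move=> /subset_closure/hr; apply/negP; rewrite -leNgt.
have := coord_norm_le (const_mx r : 'rV[R]_n) (Ordinal (meshed_dim OmegaT)).
by rewrite mxE gtr0_norm.
Qed.

End definite.
End energy.

Lemma sum2_cst (R : realType) n (a : R) : \sum_(i < n) \sum_(j < n) a = n%:R * (n%:R * a).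
Proof. by rewrite !sumr_const !card_ord !mulr_natl. Qed.

Section coercivity.
Variables (R : realType) (N : nat).

Lemma posdef_coercive (A : 'M[R]_N) : posdef A ->
  exists2 c : R, 0 < c & forall z : 'rV[R]_N, c * `|z| ^+ 2 <= qform A z^T.
Proof.
move=> pA; pose S := [set z : 'rV[R]_N | `|z| = 1].
have unit z : z != 0 -> S (`|z|^-1 *: z).
  by move=> z0; rewrite /S /= normrZ normfV normr_id mulVf// normr_eq0.
have q0 : qform A 0^T = 0 by rewrite /qform trmx0 mulmx0 mxE.
(* The sphere is empty when N = 0; then z = 0 and any constant works. *)
have [S0|S0] := pselect (S !=set0); last first.
  exists 1 => // z; have [->|z0] := eqVneq z 0; first by rewrite q0 normr0 expr0n mulr0.
  by case: S0; exists (`|z|^-1 *: z); exact: unit.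
have cS : compact S.
  have cB : compact [set z : 'rV[R]_N | `|0 - z| <= 1] by exact: compact_cball.
  apply: (subclosed_compact _ cB); last by move=> y; rewrite /S /= sub0r normrN => ->.
  apply: (closed_comp (f := fun y : 'rV[R]_N => `|y|) (D := [set 1])); last exact: closed_eq.
  by move=> y _; exact: norm_continuous.
have fq : smooth_alg (fun=> False) (fun z : 'rV[R]_N => qform A z^T).
  rewrite (_ : (fun z => _) = fun z : 'rV[R]_N => \sum_i \sum_j z ord0 i * A i j * z ord0 j).
    apply: flat_sum => i; apply: flat_sum => j; apply: sa_mul; last exact: sa_coord.
    by apply: sa_mul; [exact: sa_coord|exact: sa_cst].
  apply/funext => z; rewrite qformE; apply: eq_bigr => i _; apply: eq_bigr => j _.
  by rewrite !mxE.
have cq : {within S, continuous (fun z : 'rV[R]_N => qform A z^T)}.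
  by apply: continuous_subspaceT; exact/Cinf_continuous/Cinf_flat.
have [z0 /set_mem Sz0 zmin] := EVT_min_rV S0 cS cq.
have z00 : z0 != 0.
  by apply/eqP => z00; move: Sz0; rewrite /S /= z00 normr0 => /esym/eqP; rewrite oner_eq0.
exists (qform A z0^T).
  by apply: pA; rewrite -trmx0 (inj_eq trmx_inj).
move=> z; have [->|zn] := eqVneq z 0; first by rewrite q0 normr0 expr0n mulr0.
have := zmin _ (mem_set (unit z zn)).
have -> : qform A (`|z|^-1 *: z)^T = `|z| ^- 2 * qform A z^T.
  rewrite /qform linearZ /= -scalemxAr linearZ /= -!scalemxAl !mxE mulrA.
  by rewrite -invfM -expr2.
by rewrite mulrC ler_pdivlMr// exprn_gt0// normr_gt0.
Qed.

End coercivity.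

(** Newton's method linearises at the iterate, so the expansion is about A + B, whose entries are
    bounded by 2 K. *)
Lemma det_perturb_remainder (R : realType) n (A B : 'M[R]_n) K L : n = 2%N \/ n = 3%N -> 1 <= K ->
  (forall i j, `|A i j| <= K) -> 0 <= L <= K -> (forall i j, `|B i j| <= L) ->
  `|\det (A + B) - \det A - ddot (cof (A + B)) B| <= 48 * K * L ^+ 2.
Proof.
move=> hn K1 AK /andP[L0 LK] BL; have K2 : 1 <= 2 * K by lra.
have A2 i j : `|(A + B) i j| <= 2 * K.
  by rewrite mxE (le_trans (ler_normD _ _))//; have := AK i j; have := BL i j; lra.
have L2 : 0 <= L <= 2 * K by rewrite L0; lra.
have := det_remainder hn K2 A2 L2 BL; rewrite addrK -normrN.
rewrite (_ : 24 * (2 * K) * L ^+ 2 = 48 * K * L ^+ 2); last by ring.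
by congr (`|_| <= _); ring.
Qed.

(* al is the coercivity constant at the solution, C bounds the derivatives of a
   spline by its coordinates, K bounds the Hessian of the solution, and m0 is
   the measure of the domain. *)
Definition newton_radius (R : realType) n (al C K m0 : R) :=
  Num.min (K / C) (al / (2 * (n%:R * (n%:R * (6 * K * C * (C * C))) * m0 + 1))).

Section newton_arithmetic.
Variables (R : realType) (n : nat) (al C K m0 : R).
Hypotheses (al0 : 0 < al) (C0 : 0 < C) (K0 : 0 < K) (m00 : 0 <= m0).
Let C3 := n%:R * (n%:R * (6 * K * C * (C * C))).

Let C30 : 0 <= C3.
Proof. by rewrite !mulr_ge0// ltW. Qed.

Let D0 : 0 < C3 * m0 + 1.
Proof. by rewrite ltr_wpDl// mulr_ge0. Qed.

Lemma newton_radius_gt0 : 0 < newton_radius n al C K m0.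
Proof. by rewrite lt_min !divr_gt0// mulr_gt0. Qed.

Lemma newton_radius_le ny : ny <= newton_radius n al C K m0 -> C * ny <= K.
Proof. by rewrite le_min => /andP[h _]; rewrite mulrC -ler_pdivlMr. Qed.

(** The second term of [newton_radius] makes C3 m0 ny at most al / 2, so that half of the coercivity
    constant survives the perturbation. *)
Lemma coercivity_arith (ny nz e1 e2 : R) : 0 <= ny -> ny <= newton_radius n al C K m0 ->
  al * nz ^+ 2 <= e2 ->
  `|e1 - e2| <= n%:R * (n%:R * (6 * K * (C * ny) * ((C * nz) * (C * nz)))) * m0 ->
  al / 2 * nz ^+ 2 <= e1.
Proof.
move=> ny0; rewrite le_min -/C3 => /andP[_ yc] h.
rewrite (_ : _ * m0 = C3 * m0 * ny * nz ^+ 2); last by rewrite /C3; ring.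
move=> h2; have h3 : C3 * m0 * ny * nz ^+ 2 <= al / 2 * nz ^+ 2.
  rewrite ler_wpM2r ?sqr_ge0//.
  apply: (@le_trans _ _ (C3 * m0 * (al / (2 * (C3 * m0 + 1))))).
    by apply: ler_wpM2l => //; exact: mulr_ge0.
  rewrite (_ : _ * _ = al / 2 * (C3 * m0 / (C3 * m0 + 1))); last by field; rewrite gt_eqF.
  by rewrite ler_piMr ?divr_ge0 ?(ltW al0)// ler_pdivrMr// mul1r lerDl.
by have [h4 _] := ler_normlP _ _ (le_trans h2 h3); move: h4 h; lra.
Qed.

(** One factor ny' cancels between the coercivity and the bound of the remainder; the [+ 1] keeps
    the constant positive when m0 = 0. *)
Lemma contraction_arith (ny ny' e1 : R) : 0 <= ny' -> al / 2 * ny' ^+ 2 <= e1 ->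
  `|e1| <= 48 * K * C ^+ 2 * ny ^+ 2 * (C * ny') * m0 ->
  ny' <= (2 * (48 * K * C ^+ 2 * C * m0) / al + 1) * ny ^+ 2.
Proof.
set C4 := 48 * K * C ^+ 2 * C * m0 => y0 h h2.
have C40 : 0 <= C4 by rewrite !mulr_ge0// ?exprn_ge0 ?ltW.
have h3 : al / 2 * ny' ^+ 2 <= C4 * ny ^+ 2 * ny'.
  apply: (le_trans h); apply: (le_trans (ler_norm _)); apply: (le_trans h2).
  by rewrite le_eqVlt /C4; apply/orP; left; apply/eqP; ring.
have [->|yn] := eqVneq ny' 0.
  by rewrite mulr_ge0 ?sqr_ge0// addr_ge0// divr_ge0 ?(ltW al0)// mulr_ge0.
have yp : 0 < ny' by rewrite lt_neqAle eq_sym yn.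
have h4 : al / 2 * ny' <= C4 * ny ^+ 2.
  by move: h3; rewrite expr2 mulrA ler_pM2r.
have h5 : ny' <= 2 * C4 / al * ny ^+ 2.
  rewrite (_ : _ * _ = 2 * (C4 * ny ^+ 2) / al); last by field; rewrite gt_eqF.
  by rewrite ler_pdivlMr//; move: h4; lra.
by rewrite mulrDl mul1r (le_trans h5)// lerDl sqr_ge0.
Qed.

End newton_arithmetic.

(** Termwise 2 |ab| <= a^2 + b^2; each square is then counted n times. *)
Lemma energy_le (R : realType) n (A : 'I_n -> 'I_n -> R) (g : 'I_n -> R) (K : R) :
  (forall i j, `|A i j| <= K) ->
  \sum_i \sum_j A i j * (g j * g i) <= K * n%:R * \sum_k g k ^+ 2.
Proof.
move=> AK; apply: (@le_trans _ _ (\sum_(i < n) \sum_(j < n) (K / 2 * g j ^+ 2 + K / 2 * g i ^+ 2))).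
  apply: ler_sum => i _; apply: ler_sum => j _; apply: (le_trans (ler_norm _)).
  rewrite normrM (@le_trans _ _ (K * `|g j * g i|))// ?ler_wpM2r//.
  have K0 : 0 <= K := le_trans (normr_ge0 _) (AK i j).
  rewrite -mulrDr -mulrA ler_wpM2l// normrM -(real_normK (num_real (g j))) -(real_normK (num_real (g i))).
  have := sqr_ge0 (`|g j| - `|g i|); rewrite sqrrB; lra.
set S := \sum_k g k ^+ 2.
rewrite (eq_bigr (fun i => K / 2 * S + n%:R * (K / 2 * g i ^+ 2))) => [|i _]; last first.
  by rewrite big_split /= sumr_const card_ord -mulr_sumr mulr_natl.
rewrite big_split /= sumr_const card_ord -mulr_sumr -mulr_sumr -/S -[X in X + _]mulr_natl.
by rewrite le_eqVlt; apply/orP; left; apply/eqP; field.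
Qed.

(** * One Newton step in coordinates *)

Section newton_coordinates.
Variables (R : realType) (n : nat) (Omega : set 'rV[R]_n) (T : mesh R n).
Hypotheses (hn : n = 2%N \/ n = 3%N) (OmegaT : meshed Omega T).
Local Notation E := (elem_interiors T).
Local Notation mu := (lebesgue_rV R n).
Local Notation Int f := (Rintegral mu setT f).
Variables (u : 'rV[R]_n -> R) (pu : 'I_(nelem T) -> 'rV[R]_n -> R).
Hypotheses (up : pw Omega u pu) (sc : strictly_convex Omega u).
Variables (N : nat) (b : 'I_N -> 'rV[R]_n -> R).
Hypotheses (bp : forall j, exists p : 'I_(nelem T) -> 'rV[R]_n -> R, pw Omega (b j) p)
  (b0 : forall j x, boundary Omega x -> b j x = 0) (bfree : free_on Omega b).
Implicit Types (y z w : 'rV[R]_N) (x : 'rV[R]_n) (v s psi : 'rV[R]_n -> R).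
Implicit Types (pv ps q : 'I_(nelem T) -> 'rV[R]_n -> R).

Definition comb z : 'rV[R]_n -> R := fun x => \sum_j z ord0 j * b j x.
(** The factor [1] matches the shape s + a t of [pw_comb] and [spline_comb]. *)
Definition perturb y : 'rV[R]_n -> R := fun x => u x + 1 * comb y x.

Lemma comb_pw z : exists p : 'I_(nelem T) -> 'rV[R]_n -> R, pw Omega (comb z) p.
Proof. by have [] := pw_sum OmegaT (index_enum 'I_N) (z ord0) bp. Qed.

Lemma comb_pder z l x : E x -> pder l (comb z) x = \sum_j z ord0 j * pder l (b j) x.
Proof. by have [_] := pw_sum OmegaT (index_enum 'I_N) (z ord0) bp; apply. Qed.

Lemma comb_boundary z x : boundary Omega x -> comb z x = 0.
Proof. by move=> bx; rewrite /comb big1// => j _; rewrite b0// mulr0. Qed.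

Lemma perturb_pw y : exists p : 'I_(nelem T) -> 'rV[R]_n -> R, pw Omega (perturb y) p.
Proof. by have [p hp] := comb_pw y; eexists; exact: (pw_comb OmegaT 1 up hp). Qed.

Lemma perturb_hessian y x : E x -> hessian (perturb y) x = hessian u x + hessian (comb y) x.
Proof.
move=> Ex; have [p hp] := comb_pw y; apply/matrixP => i j.
have := pw_pder_comb OmegaT 1 [:: i; j] up hp Ex; rewrite mul1r => h.
rewrite [RHS]mxE; apply: etrans (hessianE (perturb y) i j x) _; apply: etrans h _.
by congr (_ + _); apply: esym; exact: hessianE.
Qed.

Lemma patch_eq (f G : 'rV[R]_n -> R) : (forall x, E x -> f x = G x) ->
  (forall x, ~ E x -> G x = 0) -> f \_ E = G.
Proof.
move=> fG G0; apply/funext => x; have [Ex|Ex] := pselect (E x).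
  by rewrite patchE mem_set// fG.
by rewrite patchE memNset// G0.
Qed.

Lemma patchM (f g : 'rV[R]_n -> R) : (fun x => f x * g x) \_ E = fun x => (f \_ E) x * (g \_ E) x.
Proof.
by apply: patch_eq => x Ex; [rewrite !patchE mem_set|rewrite patchE memNset// mul0r].
Qed.

Lemma patchB (f g : 'rV[R]_n -> R) : (fun x => f x - g x) \_ E = fun x => (f \_ E) x - (g \_ E) x.
Proof.
by apply: patch_eq => x Ex; [rewrite !patchE mem_set|rewrite !patchE memNset// subrr].
Qed.

(** The derivatives of order at most 2, indexed by a finite type so that a single constant bounds
    them all. *)
Let order (t : option ('I_n * option 'I_n)) : seq 'I_n :=
  match t with None => [::] | Some (i, None) => [:: i] | Some (i, Some j) => [:: i; j] end.

Lemma comb_bound : exists2 C : R, 1 <= C & forall z t x, E x -> `|pder (order t) (comb z) x| <= C * `|z|.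
Proof.
have /choice[M hM] : forall jt : 'I_N * option ('I_n * option 'I_n), exists M, 0 <= M /\
    forall x, E x -> `|pder (order jt.2) (b jt.1) x| <= M.
  move=> [j t]; have [p hp] := bp j.
  by have [M M0 h] := bounded_interiors OmegaT hp (order t); exists M.
exists (1 + \sum_jt M jt); first by rewrite lerDl sumr_ge0// => i _; exact: (hM i).1.
move=> z t x Ex; rewrite comb_pder//; apply: (le_trans (ler_norm_sum _ _ _)).
apply: (@le_trans _ _ (\sum_j M (j, t) * `|z|)).
  apply: ler_sum => j _; rewrite normrM mulrC ler_pM//; first exact: (hM (j, t)).2.
  exact: coord_norm_le.
rewrite -mulr_suml ler_wpM2r//.
apply: (@le_trans _ _ (\sum_jt M jt)); last by rewrite lerDr.
rewrite [leRHS](_ : _ = \sum_j \sum_t M (j, t)); last first.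
  by rewrite pair_bigA; apply: eq_bigr => -[].
apply: ler_sum => j _; rewrite (bigD1 t)//= lerDl.
by apply: sumr_ge0 => s _; exact: (hM (j, s)).1.
Qed.

Lemma energy_comb_l v pv psi q z : pw Omega v pv -> pw Omega psi q ->
  Int (energy_density v (comb z) psi \_ E) = \sum_j z ord0 j * Int (energy_density v (b j) psi \_ E).
Proof.
move=> vp hq; have be j : bmeas (energy_density v (b j) psi \_ E).
  by have [p hp] := bp j; exact: bmeas_energy vp hp hq.
under [RHS]eq_bigr do rewrite -IntZ//.
rewrite -Int_sum; last by move=> j _; exact: bmeasZ.
congr (Rintegral mu setT _); apply: patch_eq => x Ex; last first.
  by rewrite big1// => j _; rewrite patchE memNset// mulr0.
rewrite /energy_density; under eq_bigr do under eq_bigr do rewrite comb_pder// mulr_suml mulr_sumr.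
under [RHS]eq_bigr do rewrite patchE mem_set// mulr_sumr.
rewrite [RHS]exchange_big; apply: eq_bigr => i _; rewrite exchange_big; apply: eq_bigr => k _.
rewrite mulr_sumr; apply: eq_bigr => j _; ring.
Qed.

Lemma energy_combB v pv psi q z w : pw Omega v pv -> pw Omega psi q ->
  Int (energy_density v (comb (z - w)) psi \_ E) =
  Int (energy_density v (comb z) psi \_ E) - Int (energy_density v (comb w) psi \_ E).
Proof.
move=> vp hq.
rewrite (energy_comb_l (z - w) vp hq) (energy_comb_l z vp hq) (energy_comb_l w vp hq) -sumrB.
apply: eq_bigr => j _.
by rewrite !mxE mulrBl.
Qed.

Lemma energy_comb_r v pv s ps z : pw Omega v pv -> pw Omega s ps ->
  Int (energy_density v s (comb z) \_ E) = \sum_j z ord0 j * Int (energy_density v s (b j) \_ E).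
Proof.
move=> vp hs; have be j : bmeas (energy_density v s (b j) \_ E).
  by have [p hp] := bp j; exact: bmeas_energy vp hs hp.
under [RHS]eq_bigr do rewrite -IntZ//.
rewrite -Int_sum; last by move=> j _; exact: bmeasZ.
congr (Rintegral mu setT _); apply: patch_eq => x Ex; last first.
  by rewrite big1// => j _; rewrite patchE memNset// mulr0.
rewrite /energy_density; under eq_bigr do under eq_bigr do rewrite comb_pder// !mulr_sumr.
under [RHS]eq_bigr do rewrite patchE mem_set// mulr_sumr.
rewrite [RHS]exchange_big; apply: eq_bigr => i _; rewrite exchange_big; apply: eq_bigr => k _.
rewrite mulr_sumr; apply: eq_bigr => j _; ring.
Qed.

Lemma bmeas_det v pv : pw Omega v pv -> bmeas ((fun x => \det (hessian v x)) \_ E).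
Proof.
move=> vp; have [K K1 hK] := hessian_bound OmegaT vp.
apply: (bmeas_on_interiors OmegaT (M := 6 * K ^+ n)) => x Ex; last first.
  by apply: det_bound => //; exact: hK.
have h i j := @continuous_hessian _ _ _ _ _ _ i j _ vp Ex.
exact: (@cvg_det _ _ (nbhs x) _ n (hessian v) _ h).
Qed.

Lemma bmeas_ddot v pv s ps : pw Omega v pv -> pw Omega s ps ->
  bmeas ((fun x => ddot (cof (hessian v x)) (hessian s x)) \_ E).
Proof.
move=> vp sp; rewrite (_ : _ \_ _ = fun x => \sum_i \sum_j ((fun y : 'rV[R]_n => cof (hessian v y) i j) \_ E) x *
   (pder [:: i; j] s \_ E) x).
  apply: bmeas_sum => i _; apply: bmeas_sum => j _; apply: bmeasMM.
    exact: (bmeas_cof_hessian hn OmegaT i j vp).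
  exact: (bmeas_interiors OmegaT sp [:: i; j]).
apply/funext => x; rewrite patchE; case: ifPn => xE.
  by apply: eq_bigr => i _; apply: eq_bigr => j _; rewrite !patchE xE hessianE.
by rewrite big1// => i _; rewrite big1// => j _; rewrite !patchE (negbTE xE) mul0r.
Qed.

Lemma comb_bmeas z : bmeas (comb z \_ E).
Proof. by have [p hp] := comb_pw z; exact: (bmeas_interiors OmegaT hp [::]). Qed.

Lemma Int_comb (g : 'rV[R]_n -> R) z : bmeas (g \_ E) ->
  Int ((fun x => g x * comb z x) \_ E) = \sum_j z ord0 j * Int ((fun x => g x * b j x) \_ E).
Proof.
move=> bg; have be j : bmeas ((fun x => g x * b j x) \_ E).
  by rewrite patchM; apply: bmeasMM => //; have [p hp] := bp j; exact: (bmeas_interiors OmegaT hp [::]).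
under [RHS]eq_bigr do rewrite -IntZ//.
rewrite -Int_sum; last by move=> j _; exact: bmeasZ.
congr (Rintegral mu setT _); apply: patch_eq => x Ex; last first.
  by rewrite big1// => j _; rewrite patchE memNset// mulr0.
by rewrite /comb mulr_sumr; apply: eq_bigr => j _; rewrite patchE mem_set//; ring.
Qed.

(** The matrix of [- MA' T v] in the basis b, by [MA'_energy]. *)
Definition stiffness v : 'M[R]_N := \matrix_(j, k) Int (energy_density v (b j) (b k) \_ E).

Lemma stiffnessE v pv z w : pw Omega v pv ->
  Int (energy_density v (comb z) (comb w) \_ E) = (z *m stiffness v *m w^T) 0 0.
Proof.
move=> vp; have [p hp] := comb_pw w; rewrite (energy_comb_l z vp hp) -mulmxA mxE.
apply: eq_bigr => j _; have [q hq] := bp j; rewrite (energy_comb_r w vp hq) mxE; congr (_ * _).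
by apply: eq_bigr => k _; rewrite !mxE mulrC.
Qed.

Lemma stiffness_posdef : posdef (stiffness u).
Proof.
move=> xi xi0; have := stiffnessE xi^T xi^T up; rewrite trmxK -/(qform _ _) => <-.
have [p hp] := comb_pw xi^T.
rewrite lt_neqAle; apply/andP; split; last first.
  by apply: (Int_interiors_ge0 (bmeas_energy hn OmegaT up hp hp)) => x Ex; exact: (energy_density_ge0 OmegaT _ up sc Ex).
apply: contra_neq xi0 => /esym W0; rewrite -[xi]trmxK.
suff -> : xi^T = 0 by rewrite trmx0.
apply: bfree => x Ox; exact: (energy_eq0 hn OmegaT up hp sc (@comb_boundary _) W0 Ox).
Qed.

Lemma Int_interiors_bounded : exists2 m0 : R, 0 <= m0 & forall (f : 'rV[R]_n -> R) M,
  bmeas (f \_ E) -> (forall x, E x -> `|f x| <= M) -> `|Int (f \_ E)| <= M * m0.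
Proof.
exists (Int ((fun=> 1 : R) \_ E)); last by move=> f M; exact: (Int_interiors_bound OmegaT).
by apply: (Int_interiors_ge0 (bmeas_cst_interiors OmegaT)) => x _; exact: ler01.
Qed.

Lemma energy_difference v pv v' pv' s ps (A B m0 : R) : 0 <= m0 ->
  (forall (f : 'rV[R]_n -> R) M, bmeas (f \_ E) -> (forall x, E x -> `|f x| <= M) ->
    `|Int (f \_ E)| <= M * m0) ->
  pw Omega v pv -> pw Omega v' pv' -> pw Omega s ps ->
  (forall x, E x -> forall i j, `|cof (hessian v x) i j - cof (hessian v' x) i j| <= A) ->
  (forall x, E x -> forall j, `|pder [:: j] s x| <= B) ->
  `|Int (energy_density v s s \_ E) - Int (energy_density v' s s \_ E)| <=
  n%:R * (n%:R * (A * (B * B))) * m0.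
Proof.
move=> m00 hm vp vp' sp cb db.
have b1 := bmeas_energy hn OmegaT vp sp sp; have b2 := bmeas_energy hn OmegaT vp' sp sp.
rewrite -(IntB b1 b2) -patchB; apply: hm; first by rewrite patchB; exact: bmeasB.
move=> x Ex; rewrite /energy_density -sumrB; apply: (le_trans (ler_norm_sum _ _ _)).
rewrite -sum2_cst; apply: ler_sum => i _; rewrite -sumrB; apply: (le_trans (ler_norm_sum _ _ _)).
apply: ler_sum => j _; rewrite -mulrBl; apply: mul2_bound; first exact: cb.
by apply: mul2_bound; exact: db.
Qed.

(** Here y represents $u_k - u_h$, z the Newton increment and y + z the new error. The equation for
    z is Newton's with both signs reversed and the load replaced by the determinant of $D^2u_h$. The
    three claims are existence, uniqueness (as injectivity) and the quadratic estimate. *)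
Lemma newton_coordinates : exists C c : R, [/\ 0 < c, 0 < C & forall y, `|y| <= c ->
  [/\ exists z, forall k, Int (energy_density (perturb y) (comb z) (b k) \_ E) =
        Int ((fun x => (\det (hessian (perturb y) x) - \det (hessian u x)) * b k x) \_ E),
      forall z, (forall k, Int (energy_density (perturb y) (comb z) (b k) \_ E) = 0) -> z = 0 &
      forall z, (forall k, Int (energy_density (perturb y) (comb z) (b k) \_ E) =
        Int ((fun x => (\det (hessian (perturb y) x) - \det (hessian u x)) * b k x) \_ E)) ->
        `|y + z| <= C * `|y| ^+ 2]].
Proof.
have [K K1 hK] := hessian_bound OmegaT up.
have [C C1 hC] := comb_bound.
have [al al0 hal] := posdef_coercive stiffness_posdef.
have [m0 m00 hm] := Int_interiors_bounded.
have C0 : 0 < C by exact: lt_le_trans C1.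
have K0 : 0 < K by exact: lt_le_trans K1.
have c0 := newton_radius_gt0 n al0 C0 K0 m00; set c := newton_radius n al C K m0 in c0.
pose C4 := 48 * K * C ^+ 2 * C * m0.
have C40 : 0 <= C4 by rewrite !mulr_ge0// ?exprn_ge0 ?ltW.
exists (2 * C4 / al + 1), c; split => //; first by rewrite ltr_wpDl// divr_ge0 ?(ltW al0)// mulr_ge0.
move=> y yc.
have CyK := newton_radius_le C0 yc.
have [pU hU] := perturb_pw y.
have Hy x : E x -> forall i j, `|hessian (comb y) x i j| <= C * `|y|.
  by move=> Ex i j; rewrite hessianE; exact: (hC y (Some (i, Some j)) x Ex).
have Cy0 : 0 <= C * `|y| by rewrite mulr_ge0// ltW.
(* Coercivity at u passes to [perturb y] because the cofactors change by at most 6 K C |y|. *)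
have coer z : al / 2 * `|z| ^+ 2 <= Int (energy_density (perturb y) (comb z) (comb z) \_ E).
  have [p hp] := comb_pw z.
  have b1 := bmeas_energy hn OmegaT hU hp hp; have b2 := bmeas_energy hn OmegaT up hp hp.
  have e2 : qform (stiffness u) z^T = Int (energy_density u (comb z) (comb z) \_ E).
    by rewrite /qform trmxK -(stiffnessE z z up).
  have := hal z; rewrite e2 => h.
  have cb x : E x -> forall i j,
      `|cof (hessian (perturb y) x) i j - cof (hessian u x) i j| <= 6 * K * (C * `|y|).
    by move=> Ex; rewrite perturb_hessian//; apply: cof_lipschitz => //; [exact: hK|rewrite Cy0|exact: Hy].
  have db x : E x -> forall j, `|pder [:: j] (comb z) x| <= C * `|z|.
    by move=> Ex j; exact: (hC z (Some (j, None))).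
  have h2 := energy_difference m00 hm hU up hp cb db.
  exact: (coercivity_arith al0 C0 K0 m00 (normr_ge0 y) yc h h2).
have unq z : (forall k, Int (energy_density (perturb y) (comb z) (b k) \_ E) = 0) -> z = 0.
  move=> hz; have [p hp] := comb_pw z.
  have := coer z; rewrite (energy_comb_r z hU hp) big1 => [|k _]; last by rewrite hz mulr0.
  rewrite pmulr_rle0 ?divr_gt0// => h; apply/eqP; rewrite -normr_eq0 -sqrf_eq0 eq_le h.
  exact: sqr_ge0.
split => //.
  pose r : 'rV[R]_N := \row_k Int ((fun x => (\det (hessian (perturb y) x) - \det (hessian u x)) * b k x) \_ E).
  have Au : stiffness (perturb y) \in unitmx.
    rewrite -row_free_unit -kermx_eq0; apply/rowV0P => z /sub_kermxP zA; apply: unq => k.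
    have [q hq] := bp k; rewrite (energy_comb_l z hU hq).
    have := congr1 (fun w : 'rV[R]_N => w ord0 k) zA; rewrite !mxE => h; rewrite -[RHS]h.
    by apply: eq_bigr => j _; rewrite mxE.
  exists (r *m invmx (stiffness (perturb y))) => k; have [q hq] := bp k.
  rewrite (energy_comb_l _ hU hq).
  have := congr1 (fun w : 'rV[R]_N => w ord0 k) (mulmxKV Au r); rewrite [r ord0 k]mxE => <-.
  by rewrite [RHS]mxE; apply: eq_bigr => j _; rewrite [stiffness _ _ _]mxE.
move=> z hz; set y' := y + z.
have [p' hp'] := comb_pw y'; have [py hy] := comb_pw y; have [pz hpz] := comb_pw z.
pose dd x := \det (hessian (perturb y) x) - \det (hessian u x).
pose cc x := ddot (cof (hessian (perturb y) x)) (hessian (comb y) x).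
have bdd : bmeas (dd \_ E).
  by rewrite /dd patchB; apply: bmeasB; [exact: bmeas_det hU|exact: bmeas_det up].
have bcc : bmeas (cc \_ E) := bmeas_ddot hU hy.
have h10 : H10 Omega (comb y') := boundary_H10 OmegaT hp' (@comb_boundary y').
(* Only the direction y, not z, is put into non-divergence form: it meets the determinants in the
   remainder. *)
have e1 : Int (energy_density (perturb y) (comb y) (comb y') \_ E) =
    - Int ((fun x => cc x * comb y' x) \_ E).
  by apply: oppr_inj; rewrite opprK -MA'_energy (MA'_divergence hn OmegaT hU hy hp' h10) Rintegral_mkcond.
have e2 : Int (energy_density (perturb y) (comb z) (comb y') \_ E) =
    Int ((fun x => dd x * comb y' x) \_ E).
  rewrite (energy_comb_r y' hU hpz) Int_comb//.
  by apply: eq_bigr => k _; rewrite hz.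
(* Adding up, the new error y' solves the linearised equation with the Taylor remainder of det as
   right-hand side; testing with y' itself allows coercivity to be used. *)
have e3 : Int (energy_density (perturb y) (comb y') (comb y') \_ E) =
    Int ((fun x => (dd x - cc x) * comb y' x) \_ E).
  have eR : Int ((fun x => (dd x - cc x) * comb y' x) \_ E) =
      Int ((fun x => dd x * comb y' x) \_ E) - Int ((fun x => cc x * comb y' x) \_ E).
    rewrite -IntB; [|by rewrite patchM; apply: bmeasMM => //; exact: comb_bmeas..].
    rewrite -patchB; congr (Rintegral mu setT (_ \_ E)); apply/funext => x.
    by rewrite mulrBl.
  rewrite eR -e2 -e1 (energy_comb_l y' hU hp') (energy_comb_l y hU hp') (energy_comb_l z hU hp').
  rewrite -big_split; apply: eq_bigr => j _.
  by rewrite /y' mxE mulrDl addrC.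
have := coer y'; rewrite e3 => h.
have bR : bmeas ((fun x => (dd x - cc x) * comb y' x) \_ E).
  rewrite patchM; apply: bmeasMM; last exact: comb_bmeas.
  by rewrite patchB; exact: bmeasB.
have Rb x : E x -> `|(dd x - cc x) * comb y' x| <= 48 * K * C ^+ 2 * `|y| ^+ 2 * (C * `|y'|).
  move=> Ex; apply: mul2_bound; last exact: (hC y' None x Ex).
  have Ly : 0 <= C * `|y| <= K by rewrite Cy0.
  rewrite /dd /cc perturb_hessian//.
  by have := det_perturb_remainder hn K1 (hK x Ex) Ly (Hy x Ex); rewrite exprMn mulrA.
exact: (contraction_arith al0 C0 K0 m00 (normr_ge0 y') h (hm _ _ bR Rb)).
Qed.


Definition comb_h1norm2 z := h1norm2 Omega (comb z) (fun k => pder [:: k] (comb z) \_ E).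

Lemma comb_weak1 (e : 'rV[R]_n -> R) z : (forall x, Omega x -> e x = comb z x) ->
  weak1 Omega e (fun k => pder [:: k] (comb z) \_ E) /\ e \_ Omega = comb z \_ Omega.
Proof.
move=> eE; have eO : e \_ Omega = comb z \_ Omega.
  by apply/funext => x; rewrite !patchE; case: ifPn => // /set_mem; exact: eE.
have [p hp] := comb_pw z; have [w1 w2 w3 w4] := pw_weak1 OmegaT hp.
by split => //; split; rewrite ?eO.
Qed.

Lemma Wnorm_comb (e : 'rV[R]_n -> R) z : (forall x, Omega x -> e x = comb z x) ->
  Wnorm 1 2%:E Omega e = (Num.sqrt (comb_h1norm2 z))%:E.
Proof.
move=> /comb_weak1[ew eO]; rewrite (Wnorm_weak1 (meshed_open OmegaT) ew).
by rewrite /comb_h1norm2 /h1norm2 eO.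
Qed.

Lemma Int_domain_interiors (f : 'rV[R]_n -> R) : bmeas (f \_ Omega) -> bmeas (f \_ E) ->
  Int (fun x => (f \_ Omega) x ^+ 2) = Int (fun x => (f \_ E) x ^+ 2).
Proof.
move=> bO bE; have [M [mM M0 hM]] := elem_interiors_conull OmegaT.
apply: (@Int_ae_eq _ _ _ _ M) => //; [by have [] := bmeasMM bO bO|by have [] := bmeasMM bE bE|].
move=> x Mx; congr (_ ^+ 2); rewrite !patchE; have [Ox|Ox] := pselect (Omega x).
  by rewrite !mem_set//; exact: (hM _ (subset_closure Ox)).
by rewrite !memNset// => /(elem_interiors_sub OmegaT).
Qed.

(** From below, the norm is compared with the energy at u, coercive in coordinates and at most 2 K^2
    n times the squared gradient norm. From above, each of the n + 1 integrals is at most C^2 m0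
    |z|^2. *)
Lemma comb_h1norm2_equiv : exists c1 c2 : R, [/\ 0 < c1, 0 < c2 &
  forall z, c1 * `|z| ^+ 2 <= comb_h1norm2 z <= c2 * `|z| ^+ 2].
Proof.
have [K K1 hK] := hessian_bound OmegaT up.
have [C C1 hC] := comb_bound.
have [al al0 hal] := posdef_coercive stiffness_posdef.
have [m0 m00 hm] := Int_interiors_bounded.
have n0 : 0 < n%:R :> R by rewrite ltr0n; exact: (meshed_dim OmegaT).
have C0 : 0 < C := lt_le_trans ltr01 C1.
have K0 : 0 < K := lt_le_trans ltr01 K1.
have D0 : 0 < 2 * K ^+ 2 * n%:R by rewrite !mulr_gt0.
exists (al / (2 * K ^+ 2 * n%:R)), ((n.+1)%:R * (C * C * m0) + 1); split.
- by rewrite divr_gt0.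
- by rewrite ltr_wpDl// !mulr_ge0// ltW.
move=> z; have [p hp] := comb_pw z.
have bz := bmeas_domain OmegaT hp; have bl l := bmeas_interiors OmegaT hp l.
have e0 : comb_h1norm2 z = Int (fun x => (comb z \_ E) x ^+ 2) +
    \sum_k Int (fun x => (pder [:: k] (comb z) \_ E) x ^+ 2).
  by rewrite /comb_h1norm2 /h1norm2 Int_domain_interiors//; exact: (bl [::]).
apply/andP; split.
  rewrite mulrAC ler_pdivrMr//.
  have h := hal z; rewrite /qform trmxK -(stiffnessE z z up) in h; apply: (le_trans h).
  rewrite e0 mulrDl; apply: ler_wpDl.
    rewrite mulr_ge0 ?(ltW D0)// -[leLHS](Int0 R n); apply: le_Int; [exact: bmeas0|exact: bmeasMM (bl [::]) (bl [::])|].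
    by move=> x; exact: sqr_ge0.
  have bk k : bmeas (fun x => (pder [:: k] (comb z) \_ E) x ^+ 2) by exact: bmeasMM (bl [:: k]) (bl [:: k]).
  rewrite -Int_sum// mulrC -IntZ; last exact: bmeas_sum.
  apply: le_Int; [exact: (bmeas_energy hn OmegaT up hp hp)|by apply: bmeasZ; exact: bmeas_sum|move=> x].
  rewrite patchE; case: ifPn => [/set_mem Ex|xE]; last first.
    by rewrite mulr_ge0 ?(ltW D0)// sumr_ge0// => k _; exact: sqr_ge0.
  under [X in _ <= _ * X]eq_bigr do rewrite patchE mem_set//.
  apply: energy_le => i j; apply: cof_bound => //; exact: hK.
have hb l : (forall x, E x -> `|pder l (comb z) x| <= C * `|z|) ->
    Int (fun x => (pder l (comb z) \_ E) x ^+ 2) <= C * C * m0 * `|z| ^+ 2.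
  move=> hl; rewrite (_ : (fun x => _) = (fun x => pder l (comb z) x * pder l (comb z) x) \_ E).
    have h : `|Int ((fun x => pder l (comb z) x * pder l (comb z) x) \_ E)| <= C * `|z| * (C * `|z|) * m0.
      by apply: hm; [rewrite patchM; exact: bmeasMM|move=> x Ex; apply: mul2_bound; exact: hl].
    apply: (le_trans (ler_norm _)); apply: (le_trans h).
    by rewrite le_eqVlt; apply/orP; left; apply/eqP; ring.
  by rewrite patchM.
rewrite e0; apply: (@le_trans _ _ (C * C * m0 * `|z| ^+ 2 + \sum_(k < n) (C * C * m0 * `|z| ^+ 2))).
  apply: lerD; first by apply: (hb [::]) => x Ex; exact: (hC z None).
  by apply: ler_sum => k _; apply: (hb [:: k]) => x Ex; exact: (hC z (Some (k, None))).
rewrite sumr_const card_ord -mulrS -[leLHS]mulr_natl mulrA mulrDl mul1r lerDl.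
exact: sqr_ge0.
Qed.

End newton_coordinates.

(** * Locality: the forms depend only on values in Omega *)

Section dependence_on_domain.
Variables (R : realType) (n : nat) (Omega : set 'rV[R]_n) (T : mesh R n).
Hypothesis OmegaT : meshed Omega T.
Implicit Types (v w psi p : 'rV[R]_n -> R).
Local Notation E := (elem_interiors T).

Lemma hessian_eq_on v w x : (forall y, Omega y -> v y = w y) -> Omega x -> hessian v x = hessian w x.
Proof.
move=> vw Ox; apply/matrixP => i j.
apply: etrans (hessianE v i j x) _; apply: etrans (esym (hessianE w i j x)).
exact: (pder_eq_on OmegaT [:: i; j] vw Ox).
Qed.

Lemma MA_eq_on v w psi psi' : (forall y, Omega y -> v y = w y) ->
  (forall y, Omega y -> psi y = psi' y) -> MA T v psi = MA T w psi'.
Proof.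
move=> vw pp; apply: eq_Rintegral => x /set_mem/(elem_interiors_sub OmegaT) Ox.
by rewrite (hessian_eq_on vw Ox) pp.
Qed.

Lemma MA'_eq_on v w p p' psi psi' : (forall y, Omega y -> v y = w y) ->
  (forall y, Omega y -> p y = p' y) -> (forall y, Omega y -> psi y = psi' y) ->
  MA' T v p psi = MA' T w p' psi'.
Proof.
move=> vw pp ss; rewrite !MA'_energy.
have -> // : energy_density v p psi \_ E = energy_density w p' psi' \_ E.
apply: patch_eq => x Ex; last by rewrite patchE memNset.
have Ox := elem_interiors_sub OmegaT Ex.
rewrite patchE mem_set// /energy_density (hessian_eq_on vw Ox).
apply: eq_bigr => i _; apply: eq_bigr => j _.
by rewrite (pder_eq_on OmegaT [:: j] pp Ox) (pder_eq_on OmegaT [:: i] ss Ox).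
Qed.

End dependence_on_domain.

(** * The Newton iteration *)

Section newton_method.
Variables (R : realType) (n : nat) (Omega : set 'rV[R]_n) (T : mesh R n) (d : nat).
Hypotheses (hn : n = 2%N \/ n = 3%N) (OmegaT : meshed Omega T).
Variables (f g u : 'rV[R]_n -> R).
Hypotheses (u_sol : discrete_solution Omega T d f g u) (sc : strictly_convex Omega u).
Local Notation E := (elem_interiors T).
Local Notation mu := (lebesgue_rV R n).
Local Notation Int f := (Rintegral mu setT f).

Section in_coordinates.
Variables (pu : 'I_(nelem T) -> 'rV[R]_n -> R) (up : pw Omega u pu).
Variables (N : nat) (b : 'I_N -> 'rV[R]_n -> R).
Hypotheses (Zb : forall j, zspline Omega T d (b j)) (bfree : free_on Omega b)
  (bspan : forall s, zspline Omega T d s ->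
     exists z : 'rV[R]_N, forall x, Omega x -> s x = \sum_j z ord0 j * b j x).
Implicit Types (y z w : 'rV[R]_N).

Let bp j : exists p : 'I_(nelem T) -> 'rV[R]_n -> R, pw Omega (b j) p.
Proof. by have [sb _] := Zb j; exact: spline_pw sb. Qed.

Let newton_eq y z := forall k, Int (energy_density (perturb u b y) (comb b z) (b k) \_ E) =
  Int ((fun x => (\det (hessian (perturb u b y) x) - \det (hessian u x)) * b k x) \_ E).

Lemma zspline_comb_coord z : zspline Omega T d (comb b z).
Proof. exact: zspline_sum. Qed.

Lemma MA_perturb y w : Int ((fun x => (\det (hessian (perturb u b y) x) - \det (hessian u x)) * comb b w x) \_ E) =
  MA T (perturb u b y) (comb b w) - MA T u (comb b w).
Proof.
have [pU hU] := perturb_pw OmegaT up bp y.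
have b1 : bmeas ((fun x => \det (hessian (perturb u b y) x) * comb b w x) \_ E).
  by rewrite patchM; apply: bmeasMM; [exact: (bmeas_det hn OmegaT hU)|exact: (comb_bmeas OmegaT bp)].
have b2 : bmeas ((fun x => \det (hessian u x) * comb b w x) \_ E).
  by rewrite patchM; apply: bmeasMM; [exact: (bmeas_det hn OmegaT up)|exact: (comb_bmeas OmegaT bp)].
have MAE v : MA T v (comb b w) = Int ((fun x => \det (hessian v x) * comb b w x) \_ E).
  exact: Rintegral_mkcond.
rewrite (MAE (perturb u b y)) (MAE u); apply: etrans (IntB b1 b2).
congr (Rintegral mu setT _); rewrite -patchB; congr (_ \_ E); apply/funext => x.
exact: mulrBl.
Qed.

Lemma newton_eqP y z : newton_eq y z <-> forall w,
  MA' T (perturb u b y) (comb b z) (comb b w) = - (MA T (perturb u b y) (comb b w) - MA T u (comb b w)).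
Proof.
have [pU hU] := perturb_pw OmegaT up bp y; have [pz hz] := comb_pw OmegaT bp z.
have bd : bmeas ((fun x => \det (hessian (perturb u b y) x) - \det (hessian u x)) \_ E).
  by rewrite patchB; apply: bmeasB; [exact: (bmeas_det hn OmegaT hU)|exact: (bmeas_det hn OmegaT up)].
split=> [h w|h k].
  rewrite MA'_energy -MA_perturb (energy_comb_r hn OmegaT bp w hU hz) (Int_comb OmegaT bp w bd).
  by congr (- _); apply: eq_bigr => k _; rewrite h.
pose w : 'rV[R]_N := \row_j (j == k)%:R.
have wE x : comb b w x = b k x.
  rewrite /comb (bigD1 k)//= big1 ?addr0 => [|j jk]; first by rewrite mxE eqxx mul1r.
  by rewrite mxE (negbTE jk) mul0r.
have := h w; rewrite MA'_energy -MA_perturb => /oppr_inj.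
by have -> : comb b w = b k by apply/funext.
Qed.

(** As u solves the discrete problem, f enters only through u and can be eliminated from the Newton
    equation. *)
Lemma discrete_load psi w : spline0 Omega T d psi -> (forall x, Omega x -> psi x = comb b w x) ->
  load Omega f psi = MA T u (comb b w).
Proof.
move=> s0 pw; have [_ _ h] := u_sol; rewrite -h//.
by apply: (MA_eq_on OmegaT).
Qed.

Lemma perturb_spline y : spline Omega T d (perturb u b y) /\
  {in boundary Omega, perturb u b y =1 g}.
Proof.
have [su ug _] := u_sol; have [sy y0] := zspline_comb_coord y; split.
  exact: (spline_comb OmegaT).
by move=> x bx; rewrite /perturb y0 ?mulr0 ?addr0 ?ug//; exact: set_mem.
Qed.

Lemma perturb_coord v : spline Omega T d v -> {in boundary Omega, v =1 g} ->
  exists y, forall x, Omega x -> v x = perturb u b y x.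
Proof.
move=> sv vg; have [su ug _] := u_sol.
have Z : zspline Omega T d (fun x => v x + -1 * u x).
  split; first exact: (spline_comb OmegaT).
  by move=> x bx; rewrite vg ?ug ?mulN1r ?subrr//; exact: mem_set.
have [y hy] := bspan Z; exists y => x Ox; rewrite /perturb mul1r /comb -hy//.
by rewrite mulN1r addrC subrK.
Qed.

Lemma newton_step_coord v v' y y' : (forall x, Omega x -> v x = perturb u b y x) ->
  spline Omega T d v' -> {in boundary Omega, v' =1 g} ->
  (forall x, Omega x -> v' x = perturb u b y' x) ->
  newton_step Omega T d f g v v' <-> newton_eq y (y' - y).
Proof.
move=> vy sv' gv' v'y'.
have dE x : Omega x -> (v' \- v) x = comb b (y' - y) x.
  move=> Ox; rewrite /= v'y'// vy// /perturb !mul1r opprD addrACA subrr add0r /comb -sumrB.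
  by apply: eq_bigr => j _; rewrite !mxE mulrBl.
have refl z x : Omega x -> comb b z x = comb b z x by [].
split=> [[_ _ h]|h].
  apply/newton_eqP => w; have sw := zspline_H10 OmegaT (zspline_comb_coord w).
  have := h _ sw; rewrite (discrete_load sw (refl w)).
  by rewrite (MA'_eq_on OmegaT vy dE (refl w)) (MA_eq_on OmegaT vy (refl w)).
split=> // psi s0; have [w hw'] := bspan (spline0_zspline OmegaT s0).
have hw x : Omega x -> psi x = comb b w x by exact: hw'.
rewrite (discrete_load s0 hw) (MA'_eq_on OmegaT vy dE hw) (MA_eq_on OmegaT vy hw).
exact: (newton_eqP y (y' - y)).1 h w.
Qed.

End in_coordinates.

Lemma newton_convergence : exists delta C : R, [/\ 0 < delta, 0 < C &
  forall u0 : 'rV[R]_n -> R,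
    spline Omega T d u0 -> {in boundary Omega, u0 =1 g} ->
    (Wnorm 1 2%:E Omega (u0 \- u)%R < delta%:E)%E ->
  exists v : nat -> 'rV[R]_n -> R,
    [/\ v 0%N = u0,
        forall k, newton_step Omega T d f g (v k) (v k.+1) /\
          forall w, newton_step Omega T d f g (v k) w -> {in Omega, w =1 v k.+1},
        Wnorm 1 2%:E Omega (v k \- u) @[k --> \oo] --> 0%E &
        forall k, (Wnorm 1 2%:E Omega (v k.+1 \- u)%R <=
          C%:E * (Wnorm 1 2%:E Omega (v k \- u)%R * Wnorm 1 2%:E Omega (v k \- u)%R))%E]].
Proof.
have [su ug _] := u_sol; have [pu up] := spline_pw su.
have [N [b [Zb bfree bspan]]] := spline_basis d OmegaT.
have bp j : exists p : 'I_(nelem T) -> 'rV[R]_n -> R, pw Omega (b j) p.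
  by have [sb _] := Zb j; exact: spline_pw sb.
have b0 j x : boundary Omega x -> b j x = 0 by have [_] := Zb j; apply.
have [C [c [c0 C0 hnc]]] := newton_coordinates hn OmegaT up sc bp b0 bfree.
have [c1 [c2 [c10 c20 hH]]] := comb_h1norm2_equiv hn OmegaT up sc bp b0 bfree.
pose H := comb_h1norm2 Omega T b.
(* Below c a step exists, is unique and satisfies the quadratic bound; below 1/(2C) that bound
   halves the error, so the iterates stay in the ball. *)
pose rho := Num.min c (2 * C)^-1.
have rho0 : 0 < rho by rewrite lt_min c0 invr_gt0 mulr_gt0.
have WE v y : (forall x, Omega x -> v x = perturb u b y x) ->
    Wnorm 1 2%:E Omega (v \- u) = (Num.sqrt (H y))%:E.
  move=> vy; apply: (Wnorm_comb OmegaT bp) => x Ox /=.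
  by rewrite vy// /perturb mul1r addrC addKr.
(* F picks the Newton increment for y in the ball of radius c; elsewhere nothing is required of
   it. *)
have [F hF] : exists F : 'rV[R]_N -> 'rV[R]_N, forall y, `|y| <= c -> forall k,
    Int (energy_density (perturb u b y) (comb b (F y)) (b k) \_ E) =
    Int ((fun x => (\det (hessian (perturb u b y) x) - \det (hessian u x)) * b k x) \_ E).
  have h y : exists z, `|y| <= c -> forall k,
    Int (energy_density (perturb u b y) (comb b z) (b k) \_ E) =
    Int ((fun x => (\det (hessian (perturb u b y) x) - \det (hessian u x)) * b k x) \_ E).
    have [yc|yc] := pselect (`|y| <= c); last by exists 0.
    by have [[z hz] _ _] := hnc y yc; exists z.
  by have [F hF] := choice h; exists F.
(* The lower norm bound turns an $H^1$ ball of radius sqrt(c1) rho into the coordinate ball of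
   radius rho. In the rate, sqrt(c2) comes from the new error and 1/c1 from the square of the old
   one. *)
exists (Num.sqrt c1 * rho), (Num.sqrt c2 * C / c1); split.
- by rewrite mulr_gt0// sqrtr_gt0.
- by rewrite divr_gt0// mulr_gt0// sqrtr_gt0.
move=> u0 su0 gu0; have [y0 hy0] := perturb_coord bspan su0 gu0.
rewrite (WE _ _ hy0) lte_fin => Hy0.
have y0r : `|y0| <= rho.
  rewrite leNgt; apply/negP => ry; move: Hy0; apply/negP; rewrite -leNgt.
  rewrite -(ler_pXn2r (n := 2))// ?nnegrE ?mulr_ge0 ?sqrtr_ge0 ?(ltW rho0)//.
  have /andP[h _] := hH y0; rewrite exprMn !sqr_sqrtr ?(ltW c10)//; last first.
    by apply: le_trans h; rewrite mulr_ge0 ?sqr_ge0// ltW.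
  apply: le_trans h; rewrite ler_wpM2l ?(ltW c10)//.
  by rewrite ler_pXn2r ?nnegrE ?(ltW rho0)// ltW.
pose y := fix y k := if k is k'.+1 then y k' + F (y k') else y0.
have contr z : `|z| <= rho -> `|z + F z| <= C * `|z| ^+ 2.
  move=> zr; have zc : `|z| <= c by apply: (le_trans zr); rewrite ge_min lexx.
  by have [_ _ h] := hnc z zc; apply: h => k; exact: hF.
have half z : `|z| <= rho -> `|z + F z| <= 2^-1 * `|z|.
  move=> zr; apply: (le_trans (contr z zr)); rewrite expr2 mulrA ler_wpM2r//.
  rewrite mulrC -ler_pdivlMr// -invfM; apply: (le_trans zr); by rewrite ge_min lexx orbT.
have yb k : `|y k| <= 2^-1 ^+ k * `|y0| /\ `|y k| <= rho.
  elim: k => [|k [IH1 IH2]]; first by rewrite expr0 mul1r.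
  have h := half _ IH2; split=> /=.
    apply: (le_trans h); rewrite exprS -mulrA ler_wpM2l// invr_ge0//.
  apply: (le_trans h); apply: le_trans IH2; rewrite ler_piMl//.
  by rewrite invf_le1// ler1n.
(* The sequence starts with [u0] itself, which agrees with [perturb u b y0] on Omega only. *)
pose v k := if k is k'.+1 then perturb u b (y k) else u0.
have vE k x : Omega x -> v k x = perturb u b (y k) x by case: k => [/hy0|].
have sv k : spline Omega T d (v k) /\ {in boundary Omega, v k =1 g}.
  by case: k => [//|k]; exact: perturb_spline.
exists v; split => //.
- move=> k; have [_ ykr] := yb k.
  have ykc : `|y k| <= c by apply: (le_trans ykr); rewrite ge_min lexx.
  have [sv1 gv1] := sv k.+1.
  have yk : y k.+1 - y k = F (y k) by rewrite /= addrC addKr.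
  split.
    apply/(newton_step_coord up Zb bspan (vE k) sv1 gv1 (vE k.+1)) => j.
    by rewrite yk; exact: hF.
  move=> w hw; have [sw gw _] := hw; have [yw hyw] := perturb_coord bspan sw gw.
  have := (newton_step_coord up Zb bspan (vE k) sw gw hyw).1 hw.
  have [_ unq _] := hnc _ ykc => ew.
  have [pU hU] := perturb_pw OmegaT up bp (y k).
  have ywE : yw = y k.+1.
    apply/eqP; rewrite -subr_eq0; apply/eqP; apply: unq => j; have [pj hj] := bp j.
    have -> : yw - y k.+1 = (yw - y k) - F (y k) by rewrite /= opprD addrA.
    apply: etrans (energy_combB hn OmegaT bp _ _ hU hj) _; apply/eqP; rewrite subr_eq0; apply/eqP.
    exact: etrans (ew j) (esym (hF _ ykc j)).
  by move=> x /set_mem Ox; rewrite hyw// vE// ywE.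
- rewrite (_ : (fun k => _) = fun k => (Num.sqrt (H (y k)))%:E); last first.
    by apply/funext => k; exact: WE (vE k).
  apply: cvg_EFin; first exact: nearW.
  rewrite /comp /=.
  apply: (@squeeze_cvgr _ _ _ _ (fun=> 0) (fun k => Num.sqrt c2 * (2^-1 ^+ k * `|y0|))).
  + apply: nearW => k; rewrite sqrtr_ge0 /=.
    have /andP[_ h] := hH (y k); apply: (@le_trans _ _ (Num.sqrt c2 * `|y k|)).
      rewrite -[X in _ * X]normr_id -sqrtr_sqr -sqrtrM ?(ltW c20)//.
      by rewrite ler_wsqrtr.
    by rewrite ler_wpM2l ?sqrtr_ge0// (yb k).1.
  + exact: cvg_cst.
  rewrite -[X in _ --> X](mulr0 (Num.sqrt c2)); apply: cvgM; first exact: cvg_cst.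
  rewrite -[X in _ --> X](mul0r `|y0|); apply: cvgM; last exact: cvg_cst.
  by apply: cvg_expr; rewrite ger0_norm ?invr_ge0// invf_lt1// ltr1n.
move=> k; rewrite !(WE _ _ (vE _)) -!EFinM lee_fin.
have [_ ykr] := yb k.
have /andP[l1 _] := hH (y k); have /andP[_ l2] := hH (y k.+1).
have Hk : 0 <= H (y k) by apply: le_trans l1; rewrite mulr_ge0 ?sqr_ge0// ltW.
rewrite -expr2 sqr_sqrtr//.
apply: (@le_trans _ _ (Num.sqrt c2 * `|y k.+1|)).
  rewrite -[X in _ * X]normr_id -sqrtr_sqr -sqrtrM ?(ltW c20)//.
  by rewrite ler_wsqrtr.
rewrite -!mulrA ler_wpM2l ?sqrtr_ge0//; apply: (le_trans (contr _ ykr)).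
by rewrite ler_wpM2l ?(ltW C0)// mulrC ler_pdivlMr// mulrC.
Qed.

End newton_method.

Theorem mainTheorem5 (R : realType) (n : nat) (hn : n = 2%N \/ n = 3%N)
  (Omega : set 'rV[R]_n)
  (Omega_open : open Omega) (Omega_neq0 : Omega !=set0)
  (Omega_bounded : bounded_set Omega)
  (Omega_convex : convex_set (Omega : set (convex_lmodType 'rV[R]_n)))
  (Omega_lipschitz : lipschitz_boundary Omega)
  (H : set R) (T : R -> mesh R n) (T_family : mesh_family Omega H T)
  (d : nat)
  (V_approx : approximation_property Omega H T d)
  (V_inverse : inverse_estimates Omega H T d)
  (f : 'rV[R]_n -> R) (f_cont : {within Omega, continuous f})
  (f_gt0 : forall x, Omega x -> 0 < f x)
  (f_dual : forall h psi, H h -> spline0 Omega (T h) d psi ->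
     L1 Omega (fun x => f x * psi x))
  (g : 'rV[R]_n -> R) (g_cont : {within boundary Omega, continuous g})
  (G : 'rV[R]_n -> R) (G_smooth : smooth setT G)
  (G_ext : {in boundary Omega, G =1 g})
  (N : forall h, seq (node (T h)))
  (N_unisolvent : forall h, H h -> unisolvent Omega d (N h))
  (g_ : R -> 'rV[R]_n -> R)
  (g_interp : forall h, H h -> interpolant Omega d (N h) G (g_ h))
  (u_ : R -> 'rV[R]_n -> R)
  (u_sol : forall h, H h ->
     discrete_solution Omega (T h) d f (g_ h) (u_ h) /\
     strictly_convex Omega (u_ h))
  (u_unique : forall h w, H h ->
     discrete_solution Omega (T h) d f (g_ h) w ->
     strictly_convex Omega w -> {in Omega, w =1 u_ h}) :
  exists2 h0 : R, 0 < h0 & forall h, H h -> h < h0 ->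
  exists delta C : R, [/\ 0 < delta, 0 < C &
  forall u0 : 'rV[R]_n -> R,
    spline Omega (T h) d u0 -> {in boundary Omega, u0 =1 g_ h} ->
    (Wnorm 1 2%:E Omega (u0 \- u_ h)%R < delta%:E)%E ->
  exists u : nat -> 'rV[R]_n -> R,
    [/\ u 0%N = u0,
        forall k, newton_step Omega (T h) d f (g_ h) (u k) (u k.+1) /\
          forall w, newton_step Omega (T h) d f (g_ h) (u k) w ->
            {in Omega, w =1 u k.+1},
        Wnorm 1 2%:E Omega (u k \- u_ h) @[k --> \oo] --> 0%E &
        forall k, (Wnorm 1 2%:E Omega (u k.+1 \- u_ h)%R <=
          C%:E * (Wnorm 1 2%:E Omega (u k \- u_ h)%R *
                  Wnorm 1 2%:E Omega (u k \- u_ h)%R))%E]].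
Proof.
exists 1 => // h Hh _.
have OT : meshed Omega (T h).
  split => //; first by case: hn => ->.
  by have [tri _ _ _] := T_family; exact: tri.
have [sol conv] := u_sol h Hh.
exact: (newton_convergence hn OT sol conv).
Qed.
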